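(* Let $1\le m\leq d$ be integers and let $\mathbf{K}=\{K_1,\dots,K_m\}$ be a strongly separated family of convex bodies in $\mathbb{R}^d$. Then the set $\mathcal{T}(\mathbf{K})$ of all affine hyperplanes that are tangent to every $K_i$ and have the entire family on the same side is homeomorphic to the sphere $\mathbb{S}^{d-m}$.
   Context: A convex body in $\mathbb{R}^d$ is a compact convex set with nonempty interior. For a nonzero vector $u\in\mathbb{R}^d$ and $\alpha\in\mathbb{R}$, the affine hyperplane $H=H_{u,\alpha}=\{x:\langle x,u\rangle=\alpha\}$ has open sides $H^+=\{x:\langle x,u\rangle>\alpha\}$ and $H^-=\{x:\langle x,u\rangle<\alpha\}$, and closed sides $H^{\ge}=H^+\cup H$ and $H^{\le}=H^-\cup H$. Replacing $(u,\alpha)$ by $(-u,-\alpha)$ exchanges the sides. A family $\{S_1,\dots,S_m\}$ of sets in $\mathbb{R}^d$ is strongly separated if for every subset $I\subseteq[m]=\{1,\dots,m\}$ there exists an affine hyperplane $H$ such that $\bigcup_{i\in I}S_i\subseteq H^-$ and $\bigcup_{i\notin I}S_i\subseteq H^+$. A hyperplane $H$ is tangent to a set $S$ if $S\cap H\neq\emptyset$ and $S$ is contained in one of the two closed halfspaces defined by $H$. $\mathcal{T}(\mathbf{K})$ is the set of hyperplanes $H$ that are tangent to every $K_i$ and such that $\bigcup_i K_i$ is contained in a single closed halfspace of $H$. It carries the subspace topology from the space of all affine hyperplanes of $\mathbb{R}^d$, which is parametrized by real projective space $\mathbb{RP}^d$ (the hyperplane $H_{u,\alpha}$ corresponds to the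 class $[u:\alpha]$, with $u\ne 0$). $\mathbb{S}^k$ is the $k$-dimensional sphere; $\mathbb{S}^0$ consists of two points. *)

(* Defs.v *)
From HB Require Import structures.
From mathcomp Require Import all_boot all_order all_algebra.
From mathcomp Require Import all_classical all_reals all_analysis.

Set Implicit Arguments.
Unset Strict Implicit.
Unset Printing Implicit Defensive.

Import Order.TTheory GRing.Theory Num.Theory.
Import numFieldNormedType.Exports.

Local Open Scope classical_set_scope.
Local Open Scope ring_scope.
Local Open Scope quotient_scope.

Definition homeomorphic (X Y : topologicalType) : Prop :=
  exists f : X -> Y, exists g : Y -> X,
    [/\ cancel f g, cancel g f, continuous f & continuous g].

Section EuclideanSpace.
Context {R : realType}.

Definition dot n (x y : 'rV[R]_n) : R := \sum_(i < n) x 0 i * y 0 i.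

Definition sphere (k : nat) : set 'rV[R]_k.+1 := [set x | dot x x = 1].

Definition convex_body d (K : set 'rV[R]_d) : Prop :=
  [/\ compact K, convex_set (K : set (convex_lmodType 'rV[R]_d))
    & interior K !=set0].

End EuclideanSpace.
Arguments sphere : clear implicits.

Section RealProjectiveSpace.
Context {R : realType} {n : nat}.

Definition nonzero_vectors : set 'rV[R]_(n + 1) := [set v | v != 0].

(* [set_type] carries the subspace topology. *)
Definition proportional (v w : set_type nonzero_vectors) : bool :=
  `[< exists2 c : R, c != 0 & set_val v = c *: set_val w >].

Lemma proportional_equiv : equiv_class_of proportional.
Proof.
split=> [v | v w | v u w].
- by apply/asboolP; exists 1; rewrite ?oner_eq0// scale1r.
- apply/asboolP/asboolP => -[c c0 e]; exists c^-1; rewrite ?invr_eq0//.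
    by rewrite e scalerA mulVf// scale1r.
  by rewrite e scalerA mulVf// scale1r.
- move=> /asboolP[a a0 ea] /asboolP[b b0 eb]; apply/asboolP; exists (a * b).
    by rewrite mulf_neq0.
  by rewrite ea eb scalerA.
Qed.

Canonical proportional_equiv_rel := EquivRelPack proportional_equiv.

End RealProjectiveSpace.

Definition RP (R : realType) (n : nat) : topologicalType :=
  quotient_topology {eq_quot @proportional_equiv_rel R n}.

Section AffineHyperplanes.
Context {R : realType} {d : nat}.
Implicit Types (u : 'rV[R]_d) (a : R) (S : set 'rV[R]_d).

Definition hyperplane u a : set 'rV[R]_d := [set x | dot x u = a].
Definition open_pos u a : set 'rV[R]_d := [set x | dot x u > a].
Definition open_neg u a : set 'rV[R]_d := [set x | dot x u < a].
Definition closed_pos u a : set 'rV[R]_d := open_pos u a `|` hyperplane u a.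
Definition closed_neg u a : set 'rV[R]_d := open_neg u a `|` hyperplane u a.

Definition is_hyperplane S : Prop :=
  exists2 ua : 'rV[R]_d * R, ua.1 != 0 & S = hyperplane ua.1 ua.2.

Record affine_hyperplane := AffineHyperplane {
  points :> set 'rV[R]_d;
  pointsP : is_hyperplane points }.

HB.instance Definition _ := gen_eqMixin affine_hyperplane.
HB.instance Definition _ := gen_choiceMixin affine_hyperplane.

Lemma homogeneous_subproof u a :
  u != 0 -> row_mx u (a%:M : 'M[R]_1) \in @nonzero_vectors R d.
Proof.
move=> u0; apply/mem_set; apply: contra_neq u0 => e.
by rewrite -[u](row_mxKl _ (a%:M : 'M[R]_1)) e linear0.
Qed.

(* The point [u : a]. *)
Definition homogeneous u a (u0 : u != 0) : RP R d :=
  \pi_{eq_quot @proportional_equiv_rel R d}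
    (exist _ (row_mx u (a%:M : 'M[R]_1)) (homogeneous_subproof a u0)).

(* Equation (u, a) of H picked by choice; the resulting projective point does
   not depend on it, see [parametrizationE]. *)
Definition parametrization (H : affine_hyperplane) : RP R d :=
  let e := cid2 (pointsP H) in homogeneous (s2val e).2 (s2valP e).

HB.instance Definition _ := Topological.copy affine_hyperplane
  (initial_topology parametrization).

(* H does not determine which of its two closed sides is the positive one. *)
Definition closed_halfspaces (H : affine_hyperplane) : set (set 'rV[R]_d) :=
  [set C | exists u a, [/\ u != 0, points H = hyperplane u a
                         & C = closed_pos u a \/ C = closed_neg u a]].

Definition tangent (H : affine_hyperplane) S : Prop :=
  S `&` H !=set0 /\ exists2 C, closed_halfspaces H C & S `<=` C.

Definition strongly_separated m (S : 'I_m -> set 'rV[R]_d) : Prop :=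
  forall I : set 'I_m, exists u a,
    [/\ u != 0, \bigcup_(i in I) S i `<=` open_neg u a
      & \bigcup_(i in ~` I) S i `<=` open_pos u a].

Definition common_tangents m (K : 'I_m -> set 'rV[R]_d) :
    set affine_hyperplane :=
  [set H | (forall i, tangent H (K i)) /\
           exists2 C, closed_halfspaces H C & \bigcup_i K i `<=` C].

Lemma dotDl (x y u : 'rV[R]_d) : dot (x + y) u = dot x u + dot y u.
Proof.
by rewrite /dot -big_split; apply: eq_bigr => i _; rewrite mxE mulrDl.
Qed.

Lemma dotZl c (x u : 'rV[R]_d) : dot (c *: x) u = c * dot x u.
Proof.
by rewrite /dot mulr_sumr; apply: eq_bigr => i _; rewrite mxE mulrA.
Qed.

Lemma dotC (x y : 'rV[R]_d) : dot x y = dot y x.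
Proof. by apply: eq_bigr => i _; rewrite mulrC. Qed.

Lemma dotZr c (x u : 'rV[R]_d) : dot x (c *: u) = c * dot x u.
Proof. by rewrite dotC dotZl dotC. Qed.

Lemma dot_eq0 (x : 'rV[R]_d) : (dot x x == 0) = (x == 0).
Proof.
apply/idP/eqP => [|->]; last by rewrite /dot big1// => i _; rewrite mxE mul0r.
rewrite psumr_eq0 => [|i _]; last by rewrite -expr2 sqr_ge0.
move=> /allP h; apply/rowP => i; rewrite mxE.
by have := h i (mem_index_enum i); rewrite /= mulf_eq0 orbb => /eqP.
Qed.

Lemma hyperplane_inj u a v b : u != 0 -> v != 0 ->
  hyperplane u a = hyperplane v b ->
  exists c : R, [/\ c != 0, u = c *: v & a = c * b].
Proof.
move=> u0 v0 E.
have uu : dot u u != 0 by rewrite dot_eq0.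
have vv : dot v v != 0 by rewrite dot_eq0.
have sub x : dot x u = a -> dot x v = b.
  by move=> h; have : hyperplane v b x by rewrite -E.
pose p := (a / dot u u) *: u.
have pu : dot p u = a by rewrite dotZl divfK.
have pv := sub _ pu.
pose c := dot u v / dot v v.
pose w := u - c *: v.
have wv : dot w v = 0.
  by rewrite /w -scaleNr dotDl dotZl mulNr divfK// subrr.
have wu : dot w u = 0.
  have : hyperplane u a (p + w) by rewrite E /hyperplane /= dotDl wv pv addr0.
  by rewrite /hyperplane /= dotDl pu => /eqP; rewrite -subr_eq0 addrAC subrr add0r => /eqP.
have w0 : u = c *: v.
  apply/eqP; rewrite -subr_eq0 -dot_eq0 -/w.
  have -> : dot w w = dot u w - c * dot v w.
    rewrite [X in dot X w](_ : w = u - c *: v)// -scaleNr dotDl dotZl.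
    by rewrite mulNr.
  by rewrite dotC wu dotC wv mulr0 subr0.
exists c; split => //.
  by apply: contra_neq u0 => c0; rewrite w0 c0 scale0r.
by rewrite -pu -pv [in LHS]w0 dotZr.
Qed.

Lemma homogeneous_eq u a v b (u0 : u != 0) (v0 : v != 0) :
  homogeneous a u0 = homogeneous b v0 <-> hyperplane u a = hyperplane v b.
Proof.
rewrite /homogeneous; split.
  move=> /eqmodP/asboolP[c c0].
  rewrite !set_valE /= scale_row_mx => /eq_row_mx[-> /matrixP/(_ 0 0)].
  rewrite !mxE /= !mulr1n => ->.
  apply/seteqP; split => x; rewrite /hyperplane /= dotZr.
    by move/(mulfI c0).
  by move=> ->.
move=> /(hyperplane_inj u0 v0)[c [c0 uE aE]].
apply/eqmodP/asboolP; exists c => //.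
by rewrite !set_valE /= scale_row_mx uE aE scale_scalar_mx.
Qed.

Lemma parametrizationE (H : affine_hyperplane) u a (u0 : u != 0) :
  points H = hyperplane u a -> parametrization H = homogeneous a u0.
Proof.
move=> HE; rewrite /parametrization; case: cid2 => -[v b] /= v0 HE'.
by apply/homogeneous_eq; rewrite -HE' HE.
Qed.

Lemma parametrization_inj : injective parametrization.
Proof.
move=> H H' E; suff : points H = points H'.
  case: H H' {E} => [S hS] [S' hS'] /= e; subst S'.
  by congr AffineHyperplane; exact: Prop_irrelevance.
move: E; rewrite /parametrization.
case: cid2 => -[u a] /= u0 HE; case: cid2 => -[v b] /= v0 HE'.
by move=> /homogeneous_eq E; rewrite HE HE'.
Qed.

End AffineHyperplanes.
Arguments affine_hyperplane : clear implicits.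

(* Main.v *)
(* Write a hyperplane as x = (u, a) with |x| = 1 in R^N, N = d + 1. Lifting K_i to
   {(q, -1) : q in K_i}, the common tangents leaving the family on one side are the
   unit vectors x at which all the lifted support functions h_i vanish, and strong
   separation says that any selection q_i of the lifted bodies is linearly
   independent, uniformly. For linear h_i = <q_i, .> the zeros form a sphere of
   dimension N - m - 1 = d - m. The general case is deformed to this one: h_i is
   regularized at scale r (Moreau envelopes, averaged over many dyadic scales), so
   that the system becomes linear as r grows. Its gradients remain almost in the
   lifted bodies, hence its zero sets at scales r and r/2 are identified by a Newton
   type flow, moving points by O(r). Letting r tend to 0 gives a continuous
   surjection of the sphere onto the zeros of the h_i. Because averaging makes the
   change from r to r/2 small in Lipschitz norm and h_i - h_i^r is asymptotically
   homogeneous in r at each limit point, the flow contracts distances by a factor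
   larger than 1/2 while r is halved, so that two points with the same limit
   coincide. Finally the sphere is compact and the projective space Hausdorff. *)

From HB Require Import structures.
From mathcomp Require Import all_boot all_order all_algebra.
From mathcomp Require Import all_classical all_reals all_analysis.
From mathcomp Require Import ring lra.
Require Import Defs.

Set Implicit Arguments.
Unset Strict Implicit.
Unset Printing Implicit Defensive.

Import Order.TTheory GRing.Theory Num.Theory.
Import numFieldNormedType.Exports.

Local Open Scope classical_set_scope.
Local Open Scope ring_scope.

Section EuclideanNorm.
Context {R : realType}.

Definition nrm n (x : 'rV[R]_n) : R := Num.sqrt (dot x x).

Lemma norm_le_intro (a b : R) : - b <= a -> a <= b -> `|a| <= b.
Proof. by move=> h1 h2; rewrite ler_norml h1. Qed.

Lemma dotDr n (x y z : 'rV[R]_n) : dot x (y + z) = dot x y + dot x z.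
Proof. by rewrite dotC dotDl !(dotC x). Qed.

Lemma dotNl n (x y : 'rV[R]_n) : dot (- x) y = - dot x y.
Proof. by rewrite -scaleN1r dotZl mulN1r. Qed.

Lemma dotNr n (x y : 'rV[R]_n) : dot x (- y) = - dot x y.
Proof. by rewrite dotC dotNl dotC. Qed.

Lemma dotBl n (x y z : 'rV[R]_n) : dot (x - y) z = dot x z - dot y z.
Proof. by rewrite dotDl dotNl. Qed.

Lemma dotBr n (x y z : 'rV[R]_n) : dot x (y - z) = dot x y - dot x z.
Proof. by rewrite dotDr dotNr. Qed.

Lemma dot0l n (x : 'rV[R]_n) : dot 0 x = 0.
Proof. by rewrite -(scale0r x) dotZl mul0r. Qed.

Lemma dot0r n (x : 'rV[R]_n) : dot x 0 = 0.
Proof. by rewrite dotC dot0l. Qed.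

Lemma dot_ge0 n (x : 'rV[R]_n) : 0 <= dot x x.
Proof. by apply: sumr_ge0 => i _; rewrite -expr2 sqr_ge0. Qed.

Lemma dot_mulmx n p (x : 'rV[R]_n) (B : 'M[R]_(n, p)) (y : 'rV[R]_p) :
  dot (x *m B) y = dot x (y *m B^T).
Proof.
have dotE k (u v : 'rV[R]_k) : dot u v = (u *m v^T) 0 0.
  by rewrite mxE; apply: eq_bigr => i _; rewrite mxE.
by rewrite !dotE trmx_mul trmxK mulmxA.
Qed.

Lemma nrm_ge0 n (x : 'rV[R]_n) : 0 <= nrm x.
Proof. exact: sqrtr_ge0. Qed.
Hint Resolve nrm_ge0 : core.

Lemma nrm_sqr n (x : 'rV[R]_n) : nrm x ^+ 2 = dot x x.
Proof. by rewrite sqr_sqrtr// dot_ge0. Qed.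

Lemma nrm0 n : nrm (0 : 'rV[R]_n) = 0.
Proof. by rewrite /nrm dot0l sqrtr0. Qed.

Lemma nrm_eq0 n (x : 'rV[R]_n) : (nrm x == 0) = (x == 0).
Proof. by have := expf_eq0 (nrm x) 2; rewrite nrm_sqr dot_eq0 => ->. Qed.

Lemma nrm_gt0 n (x : 'rV[R]_n) : (0 < nrm x) = (x != 0).
Proof. by rewrite lt_def nrm_ge0 andbT nrm_eq0. Qed.

Lemma nrmZ n c (x : 'rV[R]_n) : nrm (c *: x) = `|c| * nrm x.
Proof.
by rewrite /nrm dotZl dotZr mulrA -expr2 sqrtrM ?sqr_ge0// sqrtr_sqr.
Qed.

Lemma nrmN n (x : 'rV[R]_n) : nrm (- x) = nrm x.
Proof. by rewrite -scaleN1r nrmZ normrN normr1 mul1r. Qed.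

Lemma nrmBC n (x y : 'rV[R]_n) : nrm (x - y) = nrm (y - x).
Proof. by rewrite -nrmN opprB. Qed.

Lemma cauchy_schwarz n (x y : 'rV[R]_n) : `|dot x y| <= nrm x * nrm y.
Proof.
have [->|x0] := eqVneq x 0; first by rewrite dot0l normr0 mulr_ge0.
have [->|y0] := eqVneq y 0; first by rewrite dot0r normr0 mulr_ge0.
move: x0 y0; rewrite -!nrm_gt0 => x0 y0.
have key z w : nrm z = 1 -> nrm w = 1 -> `|dot z w| <= 1 :> R.
  move=> z1 w1; have := dot_ge0 (z - w); have := dot_ge0 (z + w).
  rewrite !dotBl !dotDl !dotBr !dotDr -!nrm_sqr z1 w1 (dotC w z) ler_norml.
  by move=> h1 h2; apply/andP; split; nra.
have e1 n' (z : 'rV[R]_n') : 0 < nrm z -> nrm ((nrm z)^-1 *: z) = 1.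
  by move=> z0; rewrite nrmZ ger0_norm ?invr_ge0 ?ltW// mulVf// gt_eqF.
have := key _ _ _ (e1 _ _ x0) (e1 _ _ y0).
rewrite dotZl dotZr !normrM !normfV (gtr0_norm x0) (gtr0_norm y0) mulrA -invfM.
by rewrite mulrC ler_pdivrMr ?mulr_gt0// mul1r mulrC.
Qed.

Lemma dot_le n (x y : 'rV[R]_n) : dot x y <= nrm x * nrm y.
Proof. exact: le_trans (ler_norm _) (cauchy_schwarz x y). Qed.

Lemma nrmD n (x y : 'rV[R]_n) : nrm (x + y) <= nrm x + nrm y.
Proof.
rewrite -(@ler_pXn2r _ 2) ?nnegrE ?addr_ge0// nrm_sqr dotDl !dotDr (dotC y x).
by rewrite -!nrm_sqr sqrrD; have := dot_le x y; lra.
Qed.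

Lemma nrmB n (x y : 'rV[R]_n) : nrm (x - y) <= nrm x + nrm y.
Proof. by rewrite -(nrmN y); exact: nrmD. Qed.

Lemma nrmBl n (x y : 'rV[R]_n) : nrm x - nrm y <= nrm (x - y).
Proof. by rewrite lerBlDr -{1}(subrK y x) nrmD. Qed.

Lemma nrm_dist n (x y : 'rV[R]_n) : `|nrm x - nrm y| <= nrm (x - y).
Proof.
by rewrite ler_norml nrmBl andbT lerNl opprB nrmBC nrmBl.
Qed.

Lemma nrmBD n (x y z : 'rV[R]_n) : nrm (x - z) <= nrm (x - y) + nrm (y - z).
Proof. by rewrite -{1}(subrK y x) -addrA nrmD. Qed.

Lemma nrm_sum n I (r : seq I) (P : pred I) (F : I -> 'rV[R]_n) :
  nrm (\sum_(i <- r | P i) F i) <= \sum_(i <- r | P i) nrm (F i).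
Proof.
elim/big_rec2: _ => [|i y x _ h]; first by rewrite nrm0.
by apply: le_trans (nrmD _ _) _; rewrite lerD2l.
Qed.

Lemma nrm_coord n (x : 'rV[R]_n) i : `|x 0 i| <= nrm x.
Proof.
rewrite -(@ler_pXn2r _ 2) ?nnegrE// nrm_sqr real_normK ?num_real//.
rewrite /dot (bigD1 i)//= -expr2 lerDl sumr_ge0// => j _.
by rewrite -expr2 sqr_ge0.
Qed.

Lemma nrm_delta n (i : 'I_n) : nrm (delta_mx 0 i : 'rV[R]_n) = 1.
Proof.
rewrite /nrm /dot (bigD1 i)//= !mxE !eqxx mul1r big1 ?addr0 ?sqrtr1// => j ji.
by rewrite !mxE eqxx (negbTE ji) mul0r.
Qed.

Lemma nrm_le_sum n (x : 'rV[R]_n) : nrm x <= \sum_i `|x 0 i|.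
Proof.
rewrite {1}(matrix_sum_delta x) big_ord1; apply: le_trans (nrm_sum _ _ _) _.
by apply: ler_sum => i _; rewrite nrmZ nrm_delta mulr1.
Qed.

Lemma nrm_le_coord n (x : 'rV[R]_n) e :
  (forall i, `|x 0 i| <= e) -> nrm x <= n%:R * e.
Proof.
move=> h; apply: le_trans (nrm_le_sum x) _.
apply: le_trans (_ : \sum_(i < n) e <= _); first exact: ler_sum.
by rewrite sumr_const card_ord -[e *+ n]mulr_natl.
Qed.

Lemma nrm_row_mx n p (x : 'rV[R]_n) (y : 'rV[R]_p) :
  nrm (row_mx x y) ^+ 2 = nrm x ^+ 2 + nrm y ^+ 2.
Proof.
rewrite !nrm_sqr /dot big_split_ord/=; congr (_ + _); apply: eq_bigr => i _.
  by rewrite row_mxEl.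
by rewrite row_mxEr.
Qed.

Lemma dot_row_mx n p (x x' : 'rV[R]_n) (y y' : 'rV[R]_p) :
  dot (row_mx x y) (row_mx x' y') = dot x x' + dot y y'.
Proof.
rewrite /dot big_split_ord/=; congr (_ + _); apply: eq_bigr => i _.
  by rewrite !row_mxEl.
by rewrite !row_mxEr.
Qed.

Lemma nrm_ball n (x y : 'rV[R]_n) e : nrm (x - y) < e -> ball x e y.
Proof.
move=> h; have e0 : 0 < e by apply: le_lt_trans h.
split => // i j; rewrite -ball_normE/= ord1; apply: le_lt_trans h.
by have := nrm_coord (x - y) j; rewrite !mxE.
Qed.

Lemma ball_nrm n (x y : 'rV[R]_n) e : ball x e y -> nrm (x - y) <= n%:R * e.
Proof.
move=> [e0 h]; apply: nrm_le_coord => i; rewrite !mxE.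
by have := h 0 i; rewrite -ball_normE/= => /ltW.
Qed.

Lemma near_nrm n (x : 'rV[R]_n) e : 0 < e -> \forall y \near x, nrm (x - y) < e.
Proof.
move=> e0; apply/nbhs_ballP; exists (e / n.+1%:R) => /=; first exact: divr_gt0.
move=> y /ball_nrm h; apply: le_lt_trans h _.
by rewrite mulrA mulrAC gtr_pMl// ltr_pdivrMr// mul1r ltr_nat.
Qed.

Lemma within_continuous_nrm n p (A : set 'rV[R]_n) (f : 'rV[R]_n -> 'rV[R]_p) :
  (forall x, A x -> forall e, 0 < e -> exists2 d, 0 < d &
    forall y, A y -> nrm (x - y) < d -> nrm (f x - f y) < e) ->
  {within A, continuous f}.
Proof.
move=> h; rewrite continuous_subspace_in => x; rewrite inE => Ax.
apply/cvg_ballP => e e0; have [d d0 hd] := h x Ax e e0.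
rewrite nearE -nbhs_subspace_in//.
change (\forall y \near x, A y -> ball (f x) e (f y)); near=> y => Ay.
apply: nrm_ball; apply: hd => //; near: y.
exact: near_nrm.
Unshelve. all: by end_near. Qed.

Lemma within_continuousR_nrm n (A : set 'rV[R]_n) (f : 'rV[R]_n -> R) :
  (forall x, A x -> forall e, 0 < e -> exists2 d, 0 < d &
    forall y, A y -> nrm (x - y) < d -> `|f x - f y| < e) ->
  {within A, continuous f}.
Proof.
move=> h; rewrite continuous_subspace_in => x; rewrite inE => Ax.
apply/cvg_ballP => e e0; have [d d0 hd] := h x Ax e e0.
rewrite nearE -nbhs_subspace_in//.
change (\forall y \near x, A y -> ball (f x) e (f y)); near=> y => Ay.
rewrite -ball_normE/=; apply: hd => //; near: y.
exact: near_nrm.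
Unshelve. all: by end_near. Qed.

Lemma lipschitz_continuousR n (A : set 'rV[R]_n) (f : 'rV[R]_n -> R) L :
  (forall x y, A x -> A y -> `|f x - f y| <= L * nrm (x - y)) ->
  {within A, continuous f}.
Proof.
move=> h; apply: within_continuousR_nrm => x Ax e e0.
have L0 : 0 < `|L| + 1 by rewrite ltr_pwDr.
exists (e / (`|L| + 1)); first exact: divr_gt0.
move=> y Ay; rewrite ltr_pdivlMr// => hd; apply: le_lt_trans (h _ _ Ax Ay) _.
apply: le_lt_trans hd; rewrite mulrC ler_wpM2l//.
by rewrite (le_trans (ler_norm _))// lerDl.
Qed.

Lemma lipschitz_continuous n (f : 'rV[R]_n -> R) L :
  (forall x y, `|f x - f y| <= L * nrm (x - y)) -> continuous f.
Proof.
move=> h; apply/continuous_subspace_setT.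
by apply: (@lipschitz_continuousR _ _ _ L) => x y _ _; exact: h.
Qed.

Lemma continuous_dot n (u : 'rV[R]_n) : continuous (dot u).
Proof.
apply: (@lipschitz_continuous _ _ (nrm u)) => x y.
by rewrite -dotBr cauchy_schwarz.
Qed.

Lemma continuous_nrm n : continuous (@nrm n).
Proof.
by apply: (@lipschitz_continuous _ _ 1) => x y; rewrite mul1r nrm_dist.
Qed.

Lemma compact_nrm_ball n e : compact [set x : 'rV[R]_n | nrm x <= e].
Proof.
apply: bounded_closed_compact.
  exists e; split; first exact: num_real.
  move=> M eM x /= xe; rewrite [leLHS]/Num.norm/= mx_normrE.
  apply/bigmax_leP; split; first by apply: le_trans (ltW eM); exact: le_trans xe.
  by move=> [i j] _ /=; rewrite ord1 (le_trans (nrm_coord _ _))// (le_trans xe)// ltW.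
rewrite (_ : mkset _ = @nrm n @^-1` [set y | y <= e])//.
apply: preimage_closed; last exact: closed_le.
by move=> x _; exact: continuous_nrm.
Qed.

Lemma compact_unit_sphere n : compact [set x : 'rV[R]_n | nrm x = 1].
Proof.
apply: (subclosed_compact _ (@compact_nrm_ball n 1)) => [|x /= ->]//.
rewrite (_ : mkset _ = @nrm n @^-1` [set 1])//.
apply: preimage_closed; last exact: closed_eq.
by move=> x _; exact: continuous_nrm.
Qed.

End EuclideanNorm.
#[global] Hint Extern 0 (is_true (0 <= nrm _)) => solve [apply: nrm_ge0] : core.

Section Substep.
Context {R : realType}.

Lemma compact_nrm_ballc n (c : 'rV[R]_n) e : compact [set x | nrm (x - c) <= e].
Proof.
apply: (subclosed_compact _ (@compact_nrm_ball R n (e + nrm c))) => [|x /= h].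
  rewrite (_ : mkset _ = (fun x => nrm (x - c)) @^-1` [set y | y <= e])//.
  apply: preimage_closed; last exact: closed_le.
  move=> x _; apply: (@lipschitz_continuous _ _ _ 1) => y z.
  by rewrite mul1r (le_trans (nrm_dist _ _))// opprB addrA subrK.
by rewrite -[x](subrK c) (le_trans (nrmD _ _))// lerD2r.
Qed.

Lemma contraction_fixpoint n (T : 'rV[R]_n -> 'rV[R]_n) c w q :
  0 <= w -> q < 1 ->
  (forall x, nrm (x - c) <= w -> nrm (T x - c) <= w) ->
  (forall x y, nrm (x - c) <= w -> nrm (y - c) <= w ->
    nrm (T x - T y) <= q * nrm (x - y)) ->
  exists2 x, nrm (x - c) <= w & T x = x.
Proof.
move=> w0 q1 Tb Tc.
have [||x] := EVT_min_rV (f := fun x => nrm (T x - x)) _ (@compact_nrm_ballc n c w).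
- by exists c; rewrite /= subrr nrm0.
- apply: (@lipschitz_continuousR _ _ _ _ (q + 1)) => x y /= xw yw.
  apply: le_trans (nrm_dist _ _) _.
  rewrite (_ : T x - x - _ = (T x - T y) - (x - y)); last first.
    by rewrite !opprB addrACA [in RHS]addrACA; congr (_ + _); rewrite addrC.
  by rewrite (le_trans (nrmB _ _))// mulrDl mul1r lerD2r Tc.
rewrite inE /= => xw xmin; exists x => //.
have := xmin (T x); rewrite inE /= => /(_ (Tb _ xw)).
have := Tc _ _ (Tb _ xw) xw.
have := nrm_ge0 (T x - x); rewrite le_eqVlt => /orP[|d0 h1 h2].
  by rewrite eq_sym nrm_eq0 subr_eq0 => /eqP.
by have := le_trans h2 h1; rewrite leNgt gtr_pMl// q1.
Qed.

Lemma nrm_mulmx_tr n p (B : 'M[R]_(n, p)) C : 0 <= C ->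
  (forall w, nrm (w *m B) <= C * nrm w) ->
  forall v, nrm (v *m B^T) <= C * nrm v.
Proof.
move=> C0 hB v; have [->|] := eqVneq (v *m B^T) 0; first by rewrite nrm0 mulr_ge0.
rewrite -nrm_gt0 => d0; rewrite -(ler_pM2r d0) -expr2 nrm_sqr.
rewrite dot_mulmx trmxK (le_trans (dot_le _ _))//.
by rewrite [C * _]mulrC -mulrA ler_wpM2l.
Qed.

(* F is C^{1,1}, with B x the transpose of its derivative at x. *)
Definition c11 (L : R) N M (F : 'rV[R]_N -> 'rV[R]_M)
    (B : 'rV[R]_N -> 'M[R]_(M, N)) :=
  (forall x y, nrm (F y - F x - (y - x) *m (B x)^T) <= L * nrm (y - x) ^+ 2) /\
  (forall x y w, nrm (w *m (B x - B y)) <= L * nrm (x - y) * nrm w).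

Lemma c11_tr L N M F B : 0 <= L -> @c11 L N M F B ->
  forall x y v, nrm (v *m (B x - B y)^T) <= L * nrm (x - y) * nrm v.
Proof.
by move=> L0 [_ h] x y v; apply: nrm_mulmx_tr => [|w]; rewrite ?mulr_ge0 ?h.
Qed.

Lemma c11_second_diff L N M F B : 0 <= L -> @c11 L N M F B ->
  forall x y z,
  nrm (F (x + z) - F x - (F (y + z) - F y)) <= L * nrm z * nrm (x - y).
Proof.
move=> L0 hF x y z; apply/ler_addgt0Pr => e e0.
pose K := 2 * L * nrm z ^+ 2.
have K0 : 0 <= K / e by rewrite divr_ge0 ?(ltW e0)// !mulr_ge0// sqr_ge0.
have [[|n] hn] : exists n : nat, K / e < n%:R.
- by exists (Num.bound (K / e)); exact: archi_boundP.
- by move: K0; rewrite leNgt hn.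
pose t i : R := i%:R / n.+1%:R.
pose D i := F (x + t i *: z) - F (y + t i *: z).
have tS i : t i.+1 = t i + n.+1%:R^-1 by rewrite /t -natr1 mulrDl div1r.
have -> : F (x + z) - F x - (F (y + z) - F y) =
    \sum_(0 <= i < n.+1) (D i.+1 - D i).
  rewrite telescope_sumr// /D /t mul0r !scale0r !addr0 divff ?pnatr_eq0//.
  by rewrite !scale1r !opprB addrACA [RHS]addrACA; congr (_ + _); rewrite addrC.
rewrite (le_trans (nrm_sum _ _ _))//.
pose d : R := n.+1%:R^-1.
have d0 : 0 < d by rewrite invr_gt0.
pose b := d * (L * nrm z * nrm (x - y)) + d * (d * K).
apply: (@le_trans _ _ (\sum_(0 <= i < n.+1) b)).
  apply: ler_sum => i _.
  set xi := x + t i *: z; set yi := y + t i *: z.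
  have step w : w + t i.+1 *: z = (w + t i *: z) + d *: z.
    by rewrite tS scalerDl addrA.
  rewrite /D !step -/xi -/yi.
  have := hF.1 xi (xi + d *: z); have := hF.1 yi (yi + d *: z).
  rewrite ![_ + d *: z - _]addrC !addKr.
  have := c11_tr L0 hF xi yi (d *: z).
  have -> : xi - yi = x - y by rewrite opprD addrACA subrr addr0.
  rewrite !nrmZ (ger0_norm (ltW d0)) linearB/= mulmxBr.
  set u := F (xi + _) - F xi - _; set v := F (yi + _) - F yi - _.
  set p := _ *m _; set p' := _ *m (B yi)^T => h1 h2 h3.
  have -> : F (xi + d *: z) - F (yi + d *: z) - (F xi - F yi) =
      (p - p') + (u - v).
    rewrite /u /v -/p -/p' !opprB; apply/rowP => k; rewrite !mxE; ring.
  rewrite (le_trans (nrmD _ _))//.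
  apply: le_trans (lerD h1 (nrmB _ _)) _.
  rewrite /b exprMn in h2 h3 *.
  have -> : d * (L * nrm z * nrm (x - y)) = L * nrm (x - y) * (d * nrm z) by ring.
  rewrite lerD2l; apply: le_trans (lerD h3 h2) _.
  by rewrite /K le_eqVlt; apply/orP; left; apply/eqP; ring.
rewrite sumr_const_nat subn0 -[b *+ _]mulr_natl /b.
rewrite mulrDr !mulrA divff ?pnatr_eq0// !mul1r -!mulrA lerD2l.
rewrite -[2 * _]/(2 * (L * _)) mulrA -/K.
by rewrite ler_pdivrMl// mulrC -ler_pdivrMl// mulrC ltW.
Qed.

End Substep.

Section SubstepExistence.
Context {R : realType} {N M : nat}.
Variables (L l h c C : R) (F F' : 'rV[R]_N -> 'rV[R]_M).
Variables (B B' : 'rV[R]_N -> 'M[R]_(M, N)).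
Hypotheses (L1 : 1 <= L) (l0 : 0 <= l) (h0 : 0 <= h).
Hypotheses (c0 : 0 < c) (c1 : c <= 1) (C1 : 1 <= C).
Hypotheses (cF : c11 L F B) (cF' : c11 L F' B').
Let H (x : 'rV[R]_N) : 'rV[R]_M := F x - F' x.
Hypothesis HB : forall x w, nrm x <= 2 -> nrm (w *m (B x - B' x)) <= l * nrm w.
Hypothesis Hl : forall x y, nrm x <= 2 -> nrm y <= 2 ->
  nrm (H x - H y) <= l * nrm (x - y).
Hypothesis Hh : forall x, nrm x <= 2 -> nrm (H x) <= h.
Hypothesis BC : forall x, nrm x <= 2 -> forall w, nrm (w *m B x) <= C * nrm w.
Hypothesis BC' : forall x, nrm x <= 2 -> forall w, nrm (w *m B' x) <= C * nrm w.
Hypothesis Lh : 56 * C ^+ 2 * (L * h) <= c ^+ 4.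
Hypothesis ll : 56 * C ^+ 2 * l <= c ^+ 4.

Let w0 := 4 * h / c ^+ 2.
Let C2 := 14 * C ^+ 2 / c ^+ 4.

Let C0 : 0 < C. Proof. exact: lt_le_trans C1. Qed.
Let L0 : 0 < L. Proof. exact: lt_le_trans L1. Qed.
Let k0 : 0 < c ^+ 2. Proof. exact: exprn_gt0. Qed.
Let k1 : c ^+ 2 <= 1. Proof. by rewrite expr_le1// ltW. Qed.
Let w00 : 0 <= w0. Proof. by rewrite divr_ge0 ?mulr_ge0// ltW. Qed.
Let kw0 : c ^+ 2 * w0 = 4 * h.
Proof. by rewrite mulrC divfK// gt_eqF. Qed.
Let CC1 : 1 <= C ^+ 2. Proof. exact: exprn_ege1. Qed.

Let K1 : 14 * C ^+ 2 * L * w0 <= c ^+ 2.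
Proof.
rewrite -(ler_pM2l k0) [leLHS]mulrCA kw0.
have -> : c ^+ 2 * c ^+ 2 = c ^+ 4 by rewrite -exprD.
by apply: le_trans Lh; rewrite le_eqVlt; apply/orP; left; apply/eqP; ring.
Qed.

Let K1' : 14 * (C * w0) <= c ^+ 2.
Proof.
apply: le_trans K1; rewrite -!mulrA !ler_pM2l//.
by rewrite mulrA ler_peMl// mulr_ege1.
Qed.

Let K1CL : 14 * (C * (L * w0)) <= c ^+ 2.
Proof.
apply: le_trans K1; rewrite -!mulrA !ler_pM2l//.
by rewrite ler_peMl// mulr_ge0// ltW.
Qed.

Let kk : c ^+ 4 <= c ^+ 2.
Proof. by rewrite -[4%N]/(2 + 2)%N exprD ler_piMl// ltW. Qed.

Let K2 : 56 * (C * l) <= c ^+ 2.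
Proof.
apply: le_trans kk; apply: le_trans ll; rewrite -!mulrA !ler_pM2l//.
by rewrite ler_peMl.
Qed.

Let K2' : 56 * l <= c ^+ 2.
Proof. by apply: le_trans K2; rewrite ler_pM2l// ler_peMl. Qed.

Definition regular_at (x : 'rV[R]_N) :=
  nrm x <= 3 / 2 /\ forall w, c * nrm w <= nrm (w *m B x).

Let F'lip p q : nrm q <= 2 -> L * nrm (p - q) <= C ->
  nrm (F' p - F' q) <= 2 * C * nrm (p - q).
Proof.
move=> q2 hL; rewrite -[F' p - F' q](subrK ((p - q) *m (B' q)^T)).
apply: le_trans (nrmD _ _) _.
have h1 := cF'.1 q p; have h2 := nrm_mulmx_tr (ltW C0) (BC' q2) (p - q).
have : L * nrm (p - q) ^+ 2 <= C * nrm (p - q) by rewrite expr2 mulrA ler_wpM2r.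
lra.
Qed.

Let near2 (x w : 'rV[R]_N) : nrm x <= 3 / 2 -> nrm w <= C * w0 -> nrm (x + w) <= 2.
Proof. by move=> hx hw; have := nrmD x w; move: K1' k1; lra. Qed.

Let wB (x : 'rV[R]_N) (w : 'rV[R]_M) : nrm x <= 3 / 2 -> nrm w <= w0 -> nrm (w *m B x) <= C * w0.
Proof.
move=> hx hw; apply: le_trans (BC _ _) _; first by move: hx; lra.
by rewrite ler_pM2l.
Qed.

Let mono x w w' : regular_at x -> nrm w <= w0 -> nrm w' <= w0 ->
  c ^+ 2 / 2 * nrm (w - w') ^+ 2
    <= dot (F' (x + w *m B x) - F' (x + w' *m B x)) (w - w').
Proof.
move=> [x2 hx] hw hw'; set y := x + _; set y' := x + _; set d := w - w'.
have yy : y - y' = d *m B x by rewrite opprD addrACA subrr add0r -mulmxBl.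
have y'2 : nrm y' <= 2 by apply: near2 => //; exact: wB.
have dB : nrm (d *m B x) <= C * nrm d by apply: BC; move: x2; lra.
have dw : nrm d <= 2 * w0 by apply: le_trans (nrmB _ _) _; lra.
have d0 : 0 <= nrm d by [].
clearbody d.
rewrite -[F' y - F' y'](subrK ((y - y') *m (B' y')^T)) dotDl.
rewrite dot_mulmx trmxK yy.
have -> : d *m B' y' = d *m B x - d *m (B x - B y') - d *m (B y' - B' y').
  by rewrite !mulmxBr !subKr.
rewrite !dotBr -nrm_sqr.
have e1 : c ^+ 2 * nrm d ^+ 2 <= nrm (d *m B x) ^+ 2.
  by rewrite -exprMn ler_pXn2r ?nnegrE ?mulr_ge0 ?(ltW c0)// hx.
have e2 : dot (d *m B x) (d *m (B x - B y')) <= C * L * (C * w0) * nrm d ^+ 2.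
  apply: le_trans (dot_le _ _) _.
  have -> : C * L * (C * w0) * nrm d ^+ 2
    = (C * nrm d) * (L * (C * w0) * nrm d) by ring.
  apply: ler_pM => //; apply: le_trans (cF.2 _ _ _) _.
  rewrite ler_wpM2r// ler_pM2l// opprD addrA subrr add0r nrmN.
  exact: wB.
have e3 : dot (d *m B x) (d *m (B y' - B' y')) <= C * l * nrm d ^+ 2.
  apply: le_trans (dot_le _ _) _.
  have -> : C * l * nrm d ^+ 2 = (C * nrm d) * (l * nrm d) by ring.
  by apply: ler_pM => //; exact: HB.
have e4 : - (L * C ^+ 2 * (2 * w0) * nrm d ^+ 2) <=
    dot (F' y - F' y' - (y - y') *m (B' y')^T) d.
  rewrite lerNl -dotNl; apply: le_trans (dot_le _ _) _; rewrite nrmN.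
  have -> : L * C ^+ 2 * (2 * w0) * nrm d ^+ 2
    = (L * ((C * nrm d) * (C * (2 * w0)))) * nrm d by ring.
  rewrite ler_wpM2r//; apply: le_trans (cF'.1 _ _) _.
  rewrite ler_pM2l// yy expr2; apply: ler_pM => //.
  by apply: le_trans dB _; rewrite ler_pM2l.
rewrite yy in e4.
have : (3 * (C ^+ 2 * L * w0) + C * l) * nrm d ^+ 2 <= c ^+ 2 / 2 * nrm d ^+ 2.
  rewrite ler_wpM2r ?sqr_ge0//; move: K1 K2 k0; lra.
move: e1 e2 e3 e4.
set X := dot _ d; set Y := dot _ (_ *m (B x - _)); set Z := dot _ _.
set n2 := nrm d ^+ 2; set nb := nrm (d *m _) ^+ 2; lra.
Qed.

Let upper x w w' : regular_at x -> nrm w <= w0 -> nrm w' <= w0 ->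
  nrm (F' (x + w *m B x) - F' (x + w' *m B x)) <= 2 * C ^+ 2 * nrm (w - w').
Proof.
move=> [x2 hx] hw hw'; set y := x + _; set y' := x + _; set d := w - w'.
have yy : y - y' = d *m B x by rewrite opprD addrACA subrr add0r -mulmxBl.
have y'2 : nrm y' <= 2 by apply: near2 => //; exact: wB.
have dB : nrm (d *m B x) <= C * nrm d by apply: BC; move: x2; lra.
have dw : nrm d <= 2 * w0 by apply: le_trans (nrmB _ _) _; lra.
apply: le_trans (F'lip y'2 _) _.
  rewrite yy; apply: (@le_trans _ _ (L * (C * (2 * w0)))).
    by rewrite ler_pM2l// (le_trans dB)// ler_pM2l.
  by move: K1CL k1 C1; lra.
by rewrite yy expr2 -!mulrA !ler_pM2l.
Qed.

Lemma substep_solve x : regular_at x -> exists w,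
  [/\ nrm w <= w0, F' (x + w *m B x) = F x
    & c ^+ 2 * nrm w <= 2 * nrm (H x)].
Proof.
move=> gx; have x2 := gx.1; pose G w := F' (x + w *m B x) - F x.
have x22 : nrm x <= 2 by move: x2; lra.
pose kap := c ^+ 2 / (8 * C ^+ 4).
have C40 : 0 < C ^+ 4 by rewrite exprn_gt0.
have kap0 : 0 < kap by rewrite divr_gt0 ?mulr_gt0.
have kapE : kap * (8 * C ^+ 4) = c ^+ 2 by rewrite divfK// gt_eqF ?mulr_gt0.
pose q := 1 - kap * c ^+ 2 / 4.
have kk1 : kap * c ^+ 2 <= 1.
  have kapl : kap <= 1.
    rewrite /kap ler_pdivrMr ?mulr_gt0// mul1r (le_trans k1)//.
    by have := exprn_ege1 4 C1; lra.
  by apply: mulr_ile1 => //; exact: ltW.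
have q0 : 0 <= q by rewrite /q; move: kk1; lra.
have q1 : q < 1 by rewrite /q ltrBlDr ltrDl divr_gt0// mulr_gt0.
have Tlip w w' : nrm w <= w0 -> nrm w' <= w0 ->
    nrm (w - kap *: G w - (w' - kap *: G w')) <= q * nrm (w - w').
  move=> hw hw'.
  rewrite -(@ler_pXn2r _ 2) ?nnegrE ?mulr_ge0// exprMn.
  have -> : w - kap *: G w - (w' - kap *: G w') =
      (w - w') - kap *: (F' (x + w *m B x) - F' (x + w' *m B x)).
    rewrite /G !scalerBr; apply/rowP => i; rewrite !mxE; ring.
  have m1 := mono gx hw hw'; have u1 := upper gx hw hw'.
  set D := F' _ - F' _ in m1 u1 *; set d := w - w' in m1 u1 *.
  clearbody D d; rewrite nrm_sqr dotBl !dotBr !dotZl !dotZr (dotC d D) -!nrm_sqr.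
  have u2 : nrm D ^+ 2 <= 4 * C ^+ 4 * nrm d ^+ 2.
    have -> : 4 * C ^+ 4 * nrm d ^+ 2 = (2 * C ^+ 2 * nrm d) ^+ 2 by ring.
    by rewrite ler_pXn2r ?nnegrE// !mulr_ge0// ltW.
  have m2 := ler_wpM2l (ltW kap0) m1.
  have u3 : kap * (kap * nrm D ^+ 2) <= kap * (c ^+ 2 / 2 * nrm d ^+ 2).
    rewrite ler_pM2l//; apply: le_trans (ler_wpM2l (ltW kap0) u2) _.
    by rewrite -kapE le_eqVlt; apply/orP; left; apply/eqP; field.
  have : 0 <= (kap * c ^+ 2 / 4) ^+ 2 * nrm d ^+ 2 by rewrite mulr_ge0 ?sqr_ge0.
  rewrite /q; move: m2 u3; lra.
have G0 : nrm (G 0) <= h.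
  rewrite /G mul0mx addr0 nrmBC; exact: Hh.
have [||w hw] := @contraction_fixpoint _ _ (fun w => w - kap *: G w) 0 w0 q w00 q1.
- move=> w; rewrite !subr0 => hw.
  rewrite -[_ - _](subrK (0 - kap *: G 0)); apply: le_trans (nrmD _ _) _.
  have := Tlip w 0 hw; rewrite nrm0 => /(_ w00).
  rewrite sub0r nrmN nrmZ (gtr0_norm kap0) subr0.
  have : q * nrm w <= q * w0 by rewrite ler_wpM2l.
  have : kap * nrm (G 0) <= kap * h by rewrite ler_pM2l.
  have : kap * (c ^+ 2 * w0) = kap * (4 * h) by rewrite kw0.
  rewrite /q; lra.
- by move=> w w'; rewrite !subr0; exact: Tlip.
rewrite subr0 in hw => ew.
have /eqP : w - (w - kap *: G w) = 0 by rewrite ew subrr.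
rewrite subKr scaler_eq0 gt_eqF//= subr_eq0 => /eqP Gw.
exists w; split => //.
have := mono gx hw (_ : nrm (0 : 'rV[R]_M) <= w0); rewrite nrm0 => /(_ w00).
rewrite mul0mx addr0 subr0 Gw => h1.
have h2 : c ^+ 2 / 2 * nrm w ^+ 2 <= nrm (H x) * nrm w.
  exact: le_trans h1 (dot_le _ _).
have [->|] := eqVneq w 0; first by rewrite nrm0 mulr0 mulr_ge0.
by rewrite -nrm_gt0 => wp; move: h2; rewrite expr2 mulrA ler_pM2r//; lra.
Qed.

Let lip x y w w' : regular_at x -> regular_at y ->
  nrm w <= w0 -> F' (x + w *m B x) = F x -> c ^+ 2 * nrm w <= 2 * nrm (H x) ->
  nrm w' <= w0 -> F' (y + w' *m B y) = F y ->
  nrm (w *m B x - w' *m B y) <= C2 * (L * nrm (H x) + l) * nrm (x - y).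
Proof.
move=> gx gy hw ew bw hw' ew'; set n := nrm (x - y).
have n0 : 0 <= n by exact: nrm_ge0.
have y22 : nrm y <= 2 by move: gy.1; lra.
set z := w *m B x; set z' := w' *m B y; pose z2 := w *m B y.
have zz2 : nrm (z2 - z) <= L * n * nrm w.
  by rewrite /z /z2 -mulmxBr /n nrmBC; exact: cF.2.
have s1 : nrm (F' (y + z2) - F' (y + z)) <= 2 * C * nrm (z2 - z).
  have e : z2 - z = (y + z2) - (y + z) by rewrite opprD addrACA subrr add0r.
  rewrite e; apply: F'lip; first by apply: near2 gy.1 _; exact: wB gx.1 hw.
  rewrite -e; have := nrmB z2 z.
  have := wB gx.1 hw; have := wB gy.1 hw; rewrite -/z -/z2 => a1 a2 a3.
  apply: (@le_trans _ _ (L * (2 * (C * w0)))).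
    by rewrite ler_pM2l//; move: a1 a2 a3; lra.
  by move: K1CL k1 C1; lra.
have s2 : nrm (F' (y + z) - F' (y + z')) <= (L * nrm z + l) * n.
  have := c11_second_diff (ltW L0) cF' y x z; rewrite (nrmBC y x) -/n.
  have x22 : nrm x <= 2 by move: gx.1; lra.
  have := Hl x22 y22; rewrite -/n.
  have -> : F' (y + z) - F' (y + z') =
    (F' (y + z) - F' y - (F' (x + z) - F' x)) + (H x - H y).
    by rewrite /H ew ew'; apply/rowP => i; rewrite !mxE; ring.
  by move=> a1 a2; rewrite mulrDl (le_trans (nrmD _ _))// lerD.
have zw : nrm z <= C * nrm w by apply: BC; move: gx.1; lra.
have s3 : c ^+ 2 / 2 * nrm (w - w') <= (3 * (C * L * nrm w) + l) * n.
  have [->|] := eqVneq (w - w') 0.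
    rewrite nrm0 mulr0; apply: mulr_ge0; last exact: nrm_ge0.
    apply: addr_ge0 => //.
    by rewrite !mulr_ge0// ltW.
  rewrite -nrm_gt0 => wp; rewrite -(ler_pM2r wp).
  have -> : c ^+ 2 / 2 * nrm (w - w') * nrm (w - w') = c ^+ 2 / 2 * nrm (w - w') ^+ 2 by ring.
  apply: le_trans (mono gy hw hw') _; apply: le_trans (dot_le _ _) _.
  rewrite ler_wpM2r// -/z2 -/z' -[F' _ - _](subrKA (F' (y + z))).
  apply: le_trans (nrmD _ _) _; apply: le_trans (lerD s1 s2) _.
  have : C * nrm (z2 - z) <= C * (L * n * nrm w) by rewrite ler_pM2l.
  have : L * nrm z * n <= L * (C * nrm w) * n by rewrite ler_wpM2r// ler_pM2l.
  lra.
have s4 : nrm (z - z') <= L * n * nrm w + C * nrm (w - w').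
  rewrite -[z - z'](subrKA z2); apply: le_trans (nrmD _ _) _.
  by apply: lerD; [rewrite nrmBC|rewrite /z2 /z' -mulmxBl; exact: BC].
apply: le_trans s4 _; rewrite -(ler_pM2l (_ : 0 < c ^+ 4)); last exact: exprn_gt0.
have -> : c ^+ 4 * (C2 * (L * nrm (H x) + l) * n) =
    14 * C ^+ 2 * (L * nrm (H x) + l) * n.
  by rewrite /C2; field; rewrite gt_eqF.
have t1 : C * c ^+ 2 * (c ^+ 2 / 2 * nrm (w - w'))
   <= C * c ^+ 2 * ((3 * (C * L * nrm w) + l) * n).
  by rewrite ler_pM2l// mulr_gt0.
have Ln : 0 <= L * n by rewrite mulr_ge0// ltW.
have t2 : L * n * (c ^+ 2 * nrm w) <= L * n * (2 * nrm (H x)) by rewrite ler_wpM2l.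
have t3 : c ^+ 2 * (L * n * (2 * nrm (H x))) <= C ^+ 2 * (L * n * (2 * nrm (H x))).
  apply: ler_wpM2r; last exact: le_trans k1 CC1.
  by rewrite mulr_ge0// mulr_ge0.
have t4 : c ^+ 2 * (C * (l * n)) <= C ^+ 2 * (l * n).
  have : c ^+ 2 * (C * (l * n)) <= 1 * (C * (l * n)).
    by rewrite ler_wpM2r// !mulr_ge0// ltW.
  have : C * (l * n) <= C * (C * (l * n)).
    by rewrite ler_pM2l// ler_peMl// mulr_ge0.
  rewrite expr2; lra.
have t5 : C ^+ 2 * (L * n * (c ^+ 2 * nrm w)) <= C ^+ 2 * (L * n * (2 * nrm (H x))).
  by rewrite ler_wpM2l// ltW// exprn_gt0.
have t6 : c ^+ 2 * (L * n * (c ^+ 2 * nrm w)) <= c ^+ 2 * (L * n * (2 * nrm (H x))).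
  by rewrite ler_wpM2l// ltW.
have -> : c ^+ 4 * (L * n * nrm w + C * nrm (w - w')) =
  c ^+ 2 * (L * n * (c ^+ 2 * nrm w)) +
    2 * (C * c ^+ 2 * (c ^+ 2 / 2 * nrm (w - w'))) by field.
have t7 : C * c ^+ 2 * ((3 * (C * L * nrm w) + l) * n) =
  3 * (C ^+ 2 * (L * n * (c ^+ 2 * nrm w))) + c ^+ 2 * (C * (l * n)) by ring.
have t8 : 0 <= C ^+ 2 * (l * n) by rewrite !mulr_ge0// ltW.
have -> : 14 * C ^+ 2 * (L * nrm (H x) + l) * n =
  7 * (C ^+ 2 * (L * n * (2 * nrm (H x)))) + 14 * (C ^+ 2 * (l * n)) by ring.
lra.
Qed.

Hypothesis ZF1 : forall x, F x = 0 -> nrm x = 1.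
Hypothesis ZF'1 : forall x, F' x = 0 -> nrm x = 1.
Hypothesis ZFr : forall x (w : 'rV[R]_M), F x = 0 -> 2 * c * nrm w <= nrm (w *m B x).
Hypothesis ZF'r : forall x (w : 'rV[R]_M), F' x = 0 -> 2 * c * nrm w <= nrm (w *m B' x).

(* th x = x + w *m B x, with w the small solution of F' (x + w *m B x) = F x
   given by the contraction principle. *)
Lemma substep : exists th : 'rV[R]_N -> 'rV[R]_N,
  [/\ forall x, F x = 0 -> F' (th x) = 0,
      forall y, F' y = 0 -> exists2 x, F x = 0 & th x = y,
      forall x, F x = 0 -> nrm (th x - x) <= 2 * C / c ^+ 2 * nrm (H x)
    & forall x y, F x = 0 -> F y = 0 ->
      nrm (th x - th y - (x - y)) <= C2 * (L * nrm (H x) + l) * nrm (x - y)].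
Proof.
have ex x : exists w, regular_at x -> [/\ nrm w <= w0,
    F' (x + w *m B x) = F x & c ^+ 2 * nrm w <= 2 * nrm (H x)].
  have [/substep_solve[w hw]|nr] := pselect (regular_at x); first by exists w.
  by exists 0.
have [om hom] := choice ex.
have Zreg x : F x = 0 -> regular_at x.
  move=> Fx; split; first by rewrite ZF1//; lra.
  move=> w; apply: le_trans (ZFr w Fx); rewrite ler_wpM2r//; move: c0; lra.
have disp x : regular_at x -> nrm (om x *m B x) <= 2 * C / c ^+ 2 * nrm (H x).
  move=> gx; have [hw _ bw] := hom x gx.
  apply: le_trans (BC _ _) _; first by move: gx.1; lra.
  rewrite -(ler_pM2l k0) !mulrA.
  have -> : c ^+ 2 * 2 * C / c ^+ 2 * nrm (H x) = C * (2 * nrm (H x)).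
    by field; rewrite gt_eqF.
  by rewrite [_ * C]mulrC -mulrA ler_pM2l.
have lipd x y : regular_at x -> regular_at y ->
    nrm (om x *m B x - om y *m B y) <= C2 * (L * nrm (H x) + l) * nrm (x - y).
  move=> gx gy; have [hw ew bw] := hom x gx; have [hw' ew' _] := hom y gy.
  exact: lip.
exists (fun x => x + om x *m B x); split => [x Fx|y F'y|x Fx|x y Fx Fy].
- by have [_ -> _] := hom _ (Zreg _ Fx).
- pose rho := C * w0 / 2.
  have y1 := ZF'1 F'y.
  have rho0 : 0 <= rho by rewrite /rho divr_ge0// mulr_ge0// ltW.
  have rho2 : rho <= 1 / 2 by rewrite /rho; move: K1' k1; lra.
  have reg x : nrm (x - y) <= rho -> regular_at x.
    move=> xy; split; first by have := nrmBl x y; rewrite y1; lra.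
    move=> w; have a1 := ZF'r w F'y.
    have y2 : nrm y <= 2 by rewrite y1 ler1n.
    have a2 := HB w y2; have a3 := cF.2 x y w.
    have : nrm (w *m B' y) <=
        nrm (w *m B x) + nrm (w *m (B x - B y)) + nrm (w *m (B y - B' y)).
      have -> : w *m B' y =
          w *m B x - w *m (B x - B y) - w *m (B y - B' y).
        by rewrite !mulmxBr !subKr.
      by apply: le_trans (nrmB _ _) _; rewrite lerD2r nrmB.
    have a4 : L * nrm (x - y) * nrm w <= L * rho * nrm w.
      by rewrite ler_wpM2r// ler_pM2l.
    have a5 : (l + L * rho) * nrm w <= c * nrm w.
      rewrite ler_wpM2r// /rho.
      have : c ^+ 2 <= c by rewrite expr2 ler_piMl// ltW.
      by move: K2' K1CL k0 c0; lra.
    by move: a1 a2 a3 a4 a5; lra.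
  have hd x : nrm (x - y) <= rho -> nrm (om x *m B x) <= rho.
    move=> /reg gx; apply: le_trans (disp x gx) _.
    apply: le_trans (_ : 2 * C / c ^+ 2 * h <= _).
      apply: ler_wpM2l; last by apply: Hh; move: gx.1; lra.
      by apply: divr_ge0; [apply: mulr_ge0 => //; exact: ltW|exact: ltW].
    rewrite /rho /w0 le_eqVlt; apply/orP; left; apply/eqP; field.
    by rewrite gt_eqF.
  have [|||x xy fx] := @contraction_fixpoint _ _ (fun x => y - om x *m B x)
      y rho (1 / 2) rho0 (_ : 1 / 2 < 1).
  - by lra.
  - by move=> x /hd; rewrite addrAC subrr sub0r nrmN.
  - move=> x x' hx hx'; rewrite opprB addrC addrA subrK nrmBC.
    apply: le_trans (lipd _ _ (reg _ hx) (reg _ hx')) _.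
    rewrite ler_wpM2r//.
    have Hx : nrm (H x) <= h by apply: Hh; have := (reg _ hx).1; lra.
    rewrite /C2 mulrAC ler_pdivrMr ?exprn_gt0//.
    have : 56 * C ^+ 2 * (L * nrm (H x)) <= 56 * C ^+ 2 * (L * h).
      by rewrite ler_pM2l ?mulr_gt0 ?exprn_gt0// ler_pM2l.
    by move: Lh ll; lra.
  exists x; last by rewrite -{1}fx subrK.
  have [_ <- _] := hom _ (reg _ xy).
  by rewrite -{1}fx subrK.
- by rewrite addrAC subrr add0r; exact/disp/Zreg.
- have := lipd _ _ (Zreg _ Fx) (Zreg _ Fy).
  set a := om x *m B x; set b := om y *m B y.
  by have -> : x + a - (y + b) - (x - y) = a - b
    by apply/rowP => i; rewrite !mxE; ring.
Qed.

End SubstepExistence.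

Section Chain.
Context {R : realType} {N M : nat}.

Definition interp {V : lmodType R} (f g : 'rV[R]_N -> V) (t : R) x :=
  (1 - t) *: f x + t *: g x.

Lemma interp0 (V : lmodType R) (f g : 'rV[R]_N -> V) : interp f g 0 = f.
Proof. by apply/funext => x; rewrite /interp subr0 scale1r scale0r addr0. Qed.

Lemma interp1 (V : lmodType R) (f g : 'rV[R]_N -> V) : interp f g 1 = g.
Proof. by apply/funext => x; rewrite /interp subrr scale1r scale0r add0r. Qed.

Lemma interpB (V : lmodType R) (f g : 'rV[R]_N -> V) s t x :
  interp f g s x - interp f g t x = (t - s) *: (f x - g x).
Proof.
rewrite /interp opprD addrACA -!scalerBl scalerBr.
rewrite (_ : 1 - s - (1 - t) = t - s); last by ring.
by rewrite -[s - t]opprB scaleNr.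
Qed.

Lemma c11_interp (L : R) (F0 F1 : 'rV[R]_N -> 'rV[R]_M) B0 B1 t :
  0 <= t <= 1 -> c11 L F0 B0 -> c11 L F1 B1 ->
  c11 L (interp F0 F1 t) (interp B0 B1 t).
Proof.
move=> /andP[t0 t1] [h0 k0] [h1 k1].
have t1' : 0 <= 1 - t by rewrite subr_ge0.
have nD (u v : 'rV[R]_M) : nrm ((1 - t) *: u + t *: v) <= (1 - t) * nrm u + t * nrm v.
  by apply: le_trans (nrmD _ _) _; rewrite !nrmZ !ger0_norm.
have nD' (u v : 'rV[R]_N) : nrm ((1 - t) *: u + t *: v) <= (1 - t) * nrm u + t * nrm v.
  by apply: le_trans (nrmD _ _) _; rewrite !nrmZ !ger0_norm.
split=> [x y|x y w].
  have -> : interp F0 F1 t y - interp F0 F1 t x - (y - x) *m (interp B0 B1 t x)^T =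
      (1 - t) *: (F0 y - F0 x - (y - x) *m (B0 x)^T) +
      t *: (F1 y - F1 x - (y - x) *m (B1 x)^T).
    have -> : (interp B0 B1 t x)^T = (1 - t) *: (B0 x)^T + t *: (B1 x)^T.
      by rewrite /interp linearD/= !linearZ.
    rewrite /interp mulmxDr -!scalemxAr.
    by apply/rowP => i; rewrite !mxE; ring.
  apply: le_trans (nD _ _) _.
  have := ler_wpM2l t1' (h0 x y); have := ler_wpM2l t0 (h1 x y); lra.
have -> : w *m (interp B0 B1 t x - interp B0 B1 t y) =
    (1 - t) *: (w *m (B0 x - B0 y)) + t *: (w *m (B1 x - B1 y)).
  by rewrite /interp opprD addrACA -!scalerBr mulmxDr -!scalemxAr.
apply: le_trans (nD' _ _) _.
have := ler_wpM2l t1' (k0 x y w); have := ler_wpM2l t0 (k1 x y w); lra.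
Qed.

Variables (L lE h c C : R) (F0 F1 : 'rV[R]_N -> 'rV[R]_M).
Variables (B0 B1 : 'rV[R]_N -> 'M[R]_(M, N)).
Hypotheses (L1 : 1 <= L) (l0 : 0 <= lE) (h0 : 0 <= h).
Hypotheses (c0 : 0 < c) (c1 : c <= 1) (C1 : 1 <= C).
Hypotheses (cF0 : c11 L F0 B0) (cF1 : c11 L F1 B1).
Let E (x : 'rV[R]_N) : 'rV[R]_M := F0 x - F1 x.
Hypothesis HB : forall x w, nrm x <= 2 ->
  nrm (w *m (B0 x - B1 x)) <= lE * nrm w.
Hypothesis Hl : forall x y, nrm x <= 2 -> nrm y <= 2 ->
  nrm (E x - E y) <= lE * nrm (x - y).
Hypothesis Hh : forall x, nrm x <= 2 -> nrm (E x) <= h.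
Hypothesis BC0 : forall x, nrm x <= 2 -> forall w, nrm (w *m B0 x) <= C * nrm w.
Hypothesis BC1 : forall x, nrm x <= 2 -> forall w, nrm (w *m B1 x) <= C * nrm w.
Hypothesis ZF1 : forall t x, 0 <= t <= 1 -> interp F0 F1 t x = 0 -> nrm x = 1.
Hypothesis ZFr : forall t x (w : 'rV[R]_M), 0 <= t <= 1 ->
  interp F0 F1 t x = 0 -> 2 * c * nrm w <= nrm (w *m interp B0 B1 t x).
Hypothesis lsmall : 4 * C / c ^+ 2 * lE <= 1.

Let K1 := 2 * C / c ^+ 2.
Let C2 := 14 * C ^+ 2 / c ^+ 4.

Let BC t x : 0 <= t <= 1 -> nrm x <= 2 ->
  forall w, nrm (w *m interp B0 B1 t x) <= C * nrm w.
Proof.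
move=> /andP[t0 t1] x2 w; rewrite /interp mulmxDr -!scalemxAr.
have t1' : 0 <= 1 - t by rewrite subr_ge0.
apply: le_trans (nrmD _ _) _; rewrite !nrmZ !ger0_norm//.
have := ler_wpM2l t1' (BC0 x2 w); have := ler_wpM2l t0 (BC1 x2 w); lra.
Qed.

(* Composition of many substeps along the interpolation from F0 to F1: their
   number makes each of them small, and the bounds do not depend on it. *)
Lemma chain : exists th : 'rV[R]_N -> 'rV[R]_N,
  [/\ (forall x, F0 x = 0 -> F1 (th x) = 0) /\
      (forall y, F1 y = 0 -> exists2 x, F0 x = 0 & th x = y) /\
      (forall x y, F0 x = 0 -> F0 y = 0 -> th x = th y -> x = y),
      exists Lam, forall x y, F0 x = 0 -> F0 y = 0 ->
        nrm (th x - th y) <= Lam * nrm (x - y),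
      forall x, F0 x = 0 -> nrm (th x - x) <= 4 * C / c ^+ 2 * nrm (E x)
    & forall x y, F0 x = 0 -> F0 y = 0 ->
      (1 - C2 * (lE + 2 * L * nrm (E x))) * nrm (x - y) <= nrm (th x - th y)].
Proof.
have C0 : 0 < C by exact: lt_le_trans C1.
have L0 : 0 < L by exact: lt_le_trans L1.
have c20 : 0 < c ^+ 2 by rewrite exprn_gt0.
have c40 : 0 < c ^+ 4 by rewrite exprn_gt0.
have K10 : 0 <= K1 by rewrite /K1 divr_ge0 ?mulr_ge0 ?ltW.
have C20 : 0 <= C2.
  by rewrite /C2 divr_ge0// ?mulr_ge0 ?sqr_ge0// ltW.
have K1l : 2 * K1 * lE <= 1 by move: lsmall; rewrite /K1; lra.
have Lh0 : 0 <= L * h by rewrite mulr_ge0// ltW.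
have P0 : 0 <= 56 * C ^+ 2 by rewrite mulr_ge0 ?sqr_ge0.
have [n0 hn0] : exists n : nat, 56 * C ^+ 2 * (L * h + lE) / c ^+ 4 < n%:R.
  eexists; apply: archi_boundP; apply: divr_ge0; last exact: ltW.
  by rewrite mulr_ge0// addr_ge0.
pose n := n0.+1; pose d : R := n%:R^-1.
have d0 : 0 < d by rewrite /d invr_gt0 ltr0n.
have d1 : d <= 1 by rewrite /d invf_le1 ?ltr0n// ler1n.
have dn : d * n%:R = 1 by rewrite /d mulVf// pnatr_eq0.
have hn : 56 * C ^+ 2 * (L * h + lE) * d <= c ^+ 4.
  rewrite ler_pdivrMr// -ler_pdivrMl// mulrC (le_trans (ltW hn0))//.
  by rewrite ler_nat.
have hn1 : 56 * C ^+ 2 * (L * (h * d)) <= c ^+ 4.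
  have -> : 56 * C ^+ 2 * (L * (h * d)) = 56 * C ^+ 2 * (L * h) * d by ring.
  by apply: le_trans hn; rewrite ler_pM2r// ler_wpM2l// lerDl.
have hn2 : 56 * C ^+ 2 * (lE * d) <= c ^+ 4.
  by apply: le_trans hn; rewrite mulrA ler_pM2r// ler_wpM2l// lerDr.
have main i : (i <= n)%N -> exists th : 'rV[R]_N -> 'rV[R]_N,
  [/\ (forall x, F0 x = 0 -> interp F0 F1 (i%:R * d) (th x) = 0) /\
      (forall y, interp F0 F1 (i%:R * d) y = 0 -> exists2 x, F0 x = 0 & th x = y) /\
      (forall x y, F0 x = 0 -> F0 y = 0 -> th x = th y -> x = y),
      exists Lam, 0 <= Lam /\ forall x y, F0 x = 0 -> F0 y = 0 ->
        nrm (th x - th y) <= Lam * nrm (x - y),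
      forall x, F0 x = 0 -> nrm (th x - x) <= 2 * K1 * (i%:R * d) * nrm (E x)
    & forall x y, F0 x = 0 -> F0 y = 0 ->
      (1 - i%:R * d * (C2 * (lE + 2 * L * nrm (E x)))) * nrm (x - y)
        <= nrm (th x - th y)].
  elim: i => [_|i IH ni].
    exists id; rewrite !mul0r interp0; split => //.
    - by split => //; split => // y Fy; exists y.
    - by exists 1; split => // x y _ _; rewrite mul1r.
    - by move=> x _; rewrite subrr nrm0 mulr0 mul0r.
    - by move=> x y _ _; rewrite mul0r subr0 mul1r.
  have [th [[th1 [th2 thI]] [Lam [Lam0 thL]] th3 th4]] := IH (ltnW ni).
  have iE : i.+1%:R * d = i%:R * d + d by rewrite -natr1 mulrDl mul1r.
  have i01 j : (j <= n)%N -> 0 <= j%:R * d <= 1.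
    by move=> jn; rewrite mulr_ge0 ?(ltW d0)//= -[leRHS]dn mulrC ler_pM2l// ler_nat.
  have iI := i01 i (ltnW ni); have iI1 := i01 i.+1 ni.
  have dI x : interp F0 F1 (i%:R * d) x - interp F0 F1 (i.+1%:R * d) x = d *: E x.
    by rewrite interpB iE addrAC subrr add0r.
  have nZ (p : nat) (v : 'rV[R]_p) : nrm (d *: v) = nrm v * d.
    by rewrite nrmZ gtr0_norm// mulrC.
  have [|||||||||ph [ph1 ph2 ph3 ph4]] := @substep R N M L (lE * d) (h * d) c C
    (interp F0 F1 (i%:R * d)) (interp F0 F1 (i.+1%:R * d))
    (interp B0 B1 (i%:R * d)) (interp B0 B1 (i.+1%:R * d))
    L1 (mulr_ge0 l0 (ltW d0)) (mulr_ge0 h0 (ltW d0)) c0 c1 C1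
    (c11_interp iI cF0 cF1) (c11_interp iI1 cF0 cF1) _ _ _ _ _ hn1 hn2.
  - move=> x w x2; rewrite interpB iE addrAC subrr add0r -scalemxAr nZ mulrAC.
    by rewrite ler_pM2r// HB.
  - by move=> x y x2 y2; rewrite !dI -scalerBr nZ mulrAC ler_pM2r// Hl.
  - by move=> x x2; rewrite dI nZ ler_pM2r// Hh.
  - by move=> x; exact: BC.
  - by move=> x; exact: BC.
  - by move=> x; exact: ZF1.
  - by move=> x; exact: ZF1.
  - by move=> x w; exact: ZFr.
  - by move=> x w; exact: ZFr.
  have Eth x : F0 x = 0 -> nrm (E (th x)) <= 2 * nrm (E x).
    move=> Fx; rewrite -[E (th x)](subrK (E x)).
    apply: le_trans (nrmD _ _) _; rewrite mulr_natl mulr2n lerD2r.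
    have x1 : nrm x = 1 by apply: (ZF1 (t := 0)); rewrite ?interp0 ?lexx ?ler01.
    have u1 := ZF1 iI (th1 x Fx).
    apply: le_trans (Hl _ _) _; rewrite ?x1 ?u1 ?ler1n//.
    apply: le_trans (ler_wpM2l l0 (th3 x Fx)) _.
    have -> : lE * (2 * K1 * (i%:R * d) * nrm (E x)) =
      lE * (2 * K1 * (i%:R * d)) * nrm (E x) by ring.
    rewrite ler_piMl//; apply: le_trans K1l.
    have -> : lE * (2 * K1 * (i%:R * d)) = 2 * K1 * lE * (i%:R * d) by ring.
    apply: ler_piMr; last by case/andP: iI.
    by apply: mulr_ge0 => //; apply: mulr_ge0.
  exists (ph \o th); split.
  - split=> [x Fx /=|]; first exact/ph1/th1.
    split=> [y Fy|x y Fx Fy /= e].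
      have [u Fu <-] := ph2 y Fy; have [x Fx <-] := th2 u Fu.
      by exists x.
    apply: thI => //; apply/eqP; rewrite -subr_eq0 -nrm_eq0.
    have := ph4 _ _ (th1 x Fx) (th1 y Fy); rewrite e subrr sub0r nrmN dI nZ.
    set w := nrm (th x - th y) => h4.
    have w0 : 0 <= w by exact: nrm_ge0.
    have Eh : nrm (E (th x)) <= h.
      by apply: Hh; rewrite (ZF1 iI (th1 x Fx)) ler1n.
    have : 14 * C ^+ 2 / c ^+ 4 * (L * (nrm (E (th x)) * d) + lE * d) <= 1 / 2.
      rewrite mulrAC ler_pdivrMr//.
      have : 56 * C ^+ 2 * (L * (nrm (E (th x)) * d)) <= 56 * C ^+ 2 * (L * (h * d)).
        by rewrite ler_wpM2l// ler_pM2l// ler_pM2r.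
      move: hn1 hn2; lra.
    move=> h5; have h6 := le_trans h4 (ler_wpM2r w0 h5).
    by rewrite eq_le w0 andbT; lra.
  - exists ((1 + C2 * (L * (2 * h) + lE)) * Lam); split.
      by rewrite mulr_ge0// addr_ge0// mulr_ge0// addr_ge0// !mulr_ge0// ltW.
    move=> x y Fx Fy /=; set u := th x; set v := th y.
    have Fu := th1 x Fx; have Fv := th1 y Fy.
    have := ph4 u v Fu Fv; rewrite dI nZ => h4.
    have h5 : nrm (ph u - ph v) <= nrm (ph u - ph v - (u - v)) + nrm (u - v).
      by rewrite -{1}[ph u - ph v](subrK (u - v)) nrmD.
    apply: le_trans h5 _; rewrite mulrDl mul1r mulrDl.
    rewrite addrC; apply: lerD; first exact: thL.
    apply: le_trans h4 _.
    have e1 : nrm (E u) <= 2 * h.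
      by rewrite (le_trans (Eth x Fx))// ler_pM2l// Hh// (ZF1 (t := 0)) ?interp0 ?lexx ?ler01 ?ler1n.
    have Lnn : 0 <= L * (nrm (E u) * d) by rewrite !mulr_ge0// ltW.
    have lnn : 0 <= lE * d by rewrite mulr_ge0// ltW.
    rewrite -[leRHS]mulrA; apply: ler_pM; [|by []| |exact: thL].
      by apply: mulr_ge0 => //; exact: addr_ge0.
    apply: ler_wpM2l => //; apply: lerD; last by rewrite ler_piMr.
    by rewrite ler_pM2l//; apply: le_trans e1; rewrite ler_piMr.
  - move=> x Fx /=; rewrite iE.
    rewrite -[ph (th x) - x](subrKA (th x)); apply: le_trans (nrmD _ _) _.
    have := ph3 _ (th1 x Fx); rewrite dI nZ -/K1 => h3.
    have : K1 * (nrm (E (th x)) * d) <= K1 * (2 * nrm (E x) * d).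
      by rewrite ler_wpM2l// ler_pM2r// Eth.
    by have := th3 x Fx; lra.
  - move=> x y Fx Fy /=; set u := th x; set v := th y.
    have Fu := th1 x Fx; have Fv := th1 y Fy.
    pose a := C2 * (lE + 2 * L * nrm (E x)).
    have a0 : 0 <= a by rewrite /a mulr_ge0// addr_ge0// !mulr_ge0// ltW.
    have h4 : nrm (ph u - ph v - (u - v)) <= a * d * nrm (u - v).
      apply: le_trans (ph4 u v Fu Fv) _; rewrite dI nZ ler_wpM2r//.
      rewrite -/C2 /a -mulrA ler_wpM2l// mulrDl [leLHS]addrC lerD2l.
      have -> : 2 * L * nrm (E x) * d = L * (2 * nrm (E x) * d) by ring.
      by rewrite ler_pM2l// ler_pM2r// Eth.
    have h5 : (1 - a * d) * nrm (u - v) <= nrm (ph u - ph v).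
      have := nrmBl (u - v) (u - v - (ph u - ph v)).
      rewrite subKr (nrmBC (u - v)); lra.
    have h6 := th4 x y Fx Fy; rewrite -/a -/u -/v in h6.
    rewrite iE -/a.
    have ad0 : 0 <= a * d by rewrite mulr_ge0// ltW.
    have iad0 : 0 <= i%:R * d * a by apply: mulr_ge0 => //; case/andP: iI.
    have [q1|q1] := leP (a * d) 1; last first.
      apply: le_trans (nrm_ge0 _); apply: mulr_le0_ge0 => //.
      by rewrite mulrDl; move: q1 iad0; lra.
    apply: le_trans h5.
    have q2 : (1 - a * d) * ((1 - i%:R * d * a) * nrm (x - y)) <=
        (1 - a * d) * nrm (u - v) by rewrite ler_wpM2l// subr_ge0.
    apply: le_trans q2; rewrite mulrA ler_wpM2r//.
    have : 0 <= (a * d) * (i%:R * d * a) by rewrite mulr_ge0.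
    lra.
have [th [th12 [Lam [_ thL]] th3 th4]] := main n (leqnn _).
have nd1 : n%:R * d = 1 by rewrite mulrC.
rewrite nd1 interp1 in th12 th3 th4.
exists th; split => //.
- by exists Lam.
- move=> x Fx; apply: le_trans (th3 x Fx) _; rewrite /K1 le_eqVlt.
  by apply/orP; left; apply/eqP; ring.
- by move=> x y Fx Fy; have := th4 x y Fx Fy; rewrite mul1r.
Qed.

End Chain.

Section SmoothedSupport.
Context {R : realType} {N : nat}.
Implicit Types (K : set 'rV[R]_N) (s : R) (x y p q : 'rV[R]_N).

(* Smoothing at scale s of the support function of K: hsup K s is the supremum
   over q in K of <q, x> - s |q|^2 / 2, a convex function with gradient pmax K s
   (a nearest point of K to x / s), and gsup K s is normalized to vanish at 0. *)
Definition pmax K s x : 'rV[R]_N := xget 0 [set p | K p /\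
  forall q, K q -> dot q x - s / 2 * dot q q <= dot p x - s / 2 * dot p p].

Definition hsup K s x : R := dot (pmax K s x) x - s / 2 * dot (pmax K s x) (pmax K s x).

Definition gsup K s x : R := hsup K s x - s * hsup K 1 0.

Variables (K : set 'rV[R]_N) (D : R).
Hypotheses (cK : compact K) (K0 : K !=set0).
Hypothesis convK : forall p q (t : R), K p -> K q -> 0 <= t <= 1 -> K (p + t *: (q - p)).
Hypothesis KD : forall q, K q -> nrm q <= D.

Let D0 : 0 <= D.
Proof. by have [q Kq] := K0; apply: le_trans (KD Kq). Qed.

Lemma pmaxP s x : K (pmax K s x) /\
  forall q, K q -> dot q x - s / 2 * dot q q <= hsup K s x.
Proof.
rewrite /hsup /pmax; case: xgetP => [p _ //|nex].
have [||p] := EVT_max_rV (f := fun q => dot q x - s / 2 * dot q q) _ cK.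
- exact: K0.
- apply: (@lipschitz_continuousR _ _ _ _ (nrm x + `|s / 2| * (2 * D))).
  move=> p q Kp Kq.
  have -> : dot p x - s / 2 * dot p p - (dot q x - s / 2 * dot q q) =
      dot (p - q) x - s / 2 * dot (p - q) (p + q).
    by rewrite !dotBl !dotDr (dotC q p); ring.
  apply: le_trans (ler_normB _ _) _; rewrite mulrDl; apply: lerD.
    by rewrite mulrC; exact: cauchy_schwarz.
  rewrite normrM -mulrA ler_wpM2l//; apply: le_trans (cauchy_schwarz _ _) _.
  rewrite mulrC ler_wpM2r//; apply: le_trans (nrmD _ _) _.
  by rewrite mulr_natl mulr2n lerD// KD.
rewrite inE => Kp pmx; case: (nex p); split=> // q Kq.
by apply: pmx; rewrite inE.
Qed.

Lemma pmax_mem s x : K (pmax K s x). Proof. exact: (pmaxP s x).1. Qed.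

Lemma hsup_ge s x q : K q -> dot q x - s / 2 * dot q q <= hsup K s x.
Proof. exact: (pmaxP s x).2. Qed.

Lemma nrm_pmax s x : nrm (pmax K s x) <= D.
Proof. exact/KD/pmax_mem. Qed.

Lemma pmax_var s x q : 0 <= s -> K q ->
  dot (q - pmax K s x) (x - s *: pmax K s x) <= 0.
Proof.
move=> s0 Kq; set p := pmax K s x; set d := q - p.
apply/ler_addgt0Pr => e e0; rewrite add0r.
pose a := s / 2 * dot d d.
have a0 : 0 <= a by rewrite /a !mulr_ge0// dot_ge0.
pose t := Num.min 1 (e / (a + 1)).
have a1 : 0 < a + 1 by rewrite ltr_wpDl.
have t0 : 0 < t by rewrite /t lt_min ltr01 divr_gt0.
have t1 : t <= 1 by rewrite /t ge_min lexx.
have te : t * a <= e.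
  have : t <= e / (a + 1) by rewrite /t ge_min lexx orbT.
  rewrite ler_pdivlMr// mulrDr mulr1; lra.
have t01 : 0 <= t <= 1 by rewrite ltW.
have h := hsup_ge s x (convK (pmax_mem s x) Kq t01).
rewrite -/p -/d /hsup -/p !dotDl !dotDr !dotZl !dotZr (dotC d p) in h.
have h2 : t * dot d (x - s *: p) <= t * (t * a).
  by rewrite dotBr dotZr /a (dotC d p); lra.
move: h2; rewrite ler_pM2l// => h2; apply: le_trans h2 te.
Qed.

Lemma pmax_lip s x y : 0 <= s -> s * nrm (pmax K s x - pmax K s y) <= nrm (x - y).
Proof.
move=> s0; set p := pmax K s x; set q := pmax K s y.
have h1 := pmax_var x s0 (pmax_mem s y); have h2 := pmax_var y s0 (pmax_mem s x).
rewrite -/p -/q in h1 h2.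
have h : s * nrm (p - q) ^+ 2 <= nrm (x - y) * nrm (p - q).
  apply: le_trans (dot_le _ _).
  have : dot (q - p) (x - s *: p) = - dot (p - q) (x - s *: p).
    by rewrite -dotNl opprB.
  move: h1 h2; rewrite nrm_sqr => h1 h2 h3; rewrite h3 in h1.
  rewrite !dotBl !dotBr !dotZr in h1 h2 *; rewrite !(dotC x) !(dotC y) (dotC q p) in h1 h2 *.
  lra.
have [->|] := eqVneq (p - q) 0; first by rewrite nrm0 mulr0.
by rewrite -nrm_gt0 => pq; rewrite -(ler_pM2r pq) -mulrA.
Qed.

Lemma hsup_grad s x y : hsup K s x + dot (pmax K s x) (y - x) <= hsup K s y.
Proof.
apply: le_trans (hsup_ge s y (pmax_mem s x)).
by rewrite /hsup dotBr; lra.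
Qed.

Lemma hsup_scale s k x : 0 < k -> hsup K s (k *: x) = k * hsup K (s / k) x.
Proof.
move=> k0; apply/eqP; rewrite eq_le; apply/andP; split.
  have := hsup_ge (s / k) x (pmax_mem s (k *: x)).
  rewrite -(ler_pM2l k0); apply: le_trans.
  rewrite /hsup dotZr; set p := pmax _ _ _; rewrite le_eqVlt; apply/orP; left.
  by apply/eqP; field; rewrite gt_eqF.
have := hsup_ge s (k *: x) (pmax_mem (s / k) x).
apply: le_trans; rewrite /hsup dotZr; set p := pmax _ _ _.
by rewrite le_eqVlt; apply/orP; left; apply/eqP; field; rewrite gt_eqF.
Qed.

Lemma hsup_at0 s : 0 < s -> hsup K s 0 = s * hsup K 1 0.
Proof.
by move=> s0; rewrite -[in LHS](scaler0 _ s) hsup_scale// divff// gt_eqF.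
Qed.

Lemma gsup_at0 s : 0 <= s -> gsup K s 0 = 0.
Proof.
rewrite le_eqVlt => /predU1P[<-|s0]; last by rewrite /gsup hsup_at0// subrr.
by rewrite /gsup /hsup mul0r dot0r !mul0r !subr0.
Qed.

Lemma gsup0 x : gsup K 0 x = hsup K 0 x.
Proof. by rewrite /gsup mul0r subr0. Qed.

Lemma gsup_grad s x y : gsup K s x + dot (pmax K s x) (y - x) <= gsup K s y.
Proof. by have := hsup_grad s x y; rewrite /gsup; lra. Qed.

Lemma gsup_c11 s x y : 0 < s ->
  `|gsup K s y - gsup K s x - dot (pmax K s x) (y - x)| <= nrm (y - x) ^+ 2 / s.
Proof.
move=> s0; have h1 := gsup_grad s x y; have h2 := gsup_grad s y x.
have h3 : dot (pmax K s y - pmax K s x) (y - x) <= nrm (y - x) ^+ 2 / s.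
  rewrite ler_pdivlMr// mulrC.
  apply: le_trans (ler_wpM2l (ltW s0) (dot_le _ _)) _; rewrite mulrA expr2.
  by rewrite ler_wpM2r// pmax_lip// ltW.
move: h2 h3; rewrite -[x - y]opprB dotNr dotBl => h2 h3.
have B0 := divr_ge0 (sqr_ge0 (nrm (y - x))) (ltW s0).
by apply: norm_le_intro; lra.
Qed.

Lemma gsup_lip s x y : `|gsup K s x - gsup K s y| <= D * nrm (x - y).
Proof.
have b s' x' z : dot (pmax K s' x') z <= D * nrm z.
  by apply: le_trans (dot_le _ _) _; rewrite ler_wpM2r// nrm_pmax.
have h1 := gsup_grad s x y; have h2 := gsup_grad s y x.
have b1 := b s x (x - y); have b2 := b s y (y - x).
have e1 := dotNr (pmax K s x) (x - y); have e2 := dotNr (pmax K s y) (y - x).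
rewrite opprB in e1; rewrite opprB in e2; rewrite (nrmBC y x) in b2.
rewrite e1 in h1; rewrite e2 in h2.
by apply: norm_le_intro; lra.
Qed.

Lemma gsup_bound s x : 0 <= s -> `|gsup K s x| <= D * nrm x.
Proof. by move=> s0; have := gsup_lip s x 0; rewrite gsup_at0// !subr0. Qed.

Lemma gsup_scale s k x : 0 < k -> gsup K s (k *: x) = k * gsup K (s / k) x.
Proof.
by move=> k0; rewrite /gsup hsup_scale//; field; rewrite gt_eqF.
Qed.

Lemma gsup_radial_le s x :
  dot (pmax K s x) x - gsup K s x <= 2 * (gsup K (s / 2) x - gsup K s x).
Proof.
have := gsup_grad s x (2 *: x); rewrite gsup_scale//.
rewrite (_ : 2 *: x - x = x); last by rewrite scaler_nat mulr2n addrK.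
lra.
Qed.

Lemma gsup_radial_ge s x :
  gsup K s x - gsup K (s * 2) x <= dot (pmax K s x) x - gsup K s x.
Proof.
have := gsup_grad s x (2^-1 *: x); rewrite gsup_scale ?invr_gt0// invrK.
rewrite (_ : 2^-1 *: x - x = (- 2^-1) *: x); last first.
  by rewrite -{2}[x]scale1r -scalerBl; congr (_ *: _); field.
by rewrite dotZr; lra.
Qed.

Lemma gsup_s_bound s x : 0 <= s -> `|gsup K 0 x - gsup K s x| <= s * D ^+ 2.
Proof.
move=> s0; rewrite /gsup mul0r subr0.
have dD q : K q -> 0 <= dot q q <= D ^+ 2.
  by move=> Kq; rewrite dot_ge0 -nrm_sqr ler_pXn2r ?nnegrE// KD.
have h1 := hsup_ge 0 x (pmax_mem s x); have h2 := hsup_ge s x (pmax_mem 0 x).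
have /andP[p1 p2] := dD _ (pmax_mem s x).
have /andP[q1 q2] := dD _ (pmax_mem 0 x).
have /andP[r1 r2] := dD _ (pmax_mem 1 0).
have e : hsup K 1 0 = - (1 / 2 * dot (pmax K 1 0) (pmax K 1 0)).
  by rewrite /hsup dot0r sub0r.
have a1 := ler_wpM2l s0 p1; have a2 := ler_wpM2l s0 p2.
have b1 := ler_wpM2l s0 q1; have b2 := ler_wpM2l s0 q2.
have c1 := ler_wpM2l s0 r1; have c2 := ler_wpM2l s0 r2.
rewrite e; move: h1 h2; rewrite mul0r mul0r subr0 /hsup !mul0r subr0.
by move=> h1 h2; apply: norm_le_intro; lra.
Qed.

Lemma gsup_s_mono s s' x : 0 < s' -> s' <= s ->
  (gsup K 0 x - gsup K s x) / s <= (gsup K 0 x - gsup K s' x) / s'.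
Proof.
move=> s'0 ss'; have s0 : 0 < s by exact: lt_le_trans ss'.
rewrite ler_pdivrMr// mulrAC ler_pdivlMr// /gsup mul0r subr0.
have h1 := hsup_ge s x (pmax_mem s' x); have h2 := hsup_ge 0 x (pmax_mem s' x).
have h3 : hsup K s' x = dot (pmax K s' x) x - s' / 2 * dot (pmax K s' x) (pmax K s' x) by [].
rewrite mul0r mul0r subr0 in h2.
set p := dot (pmax K s' x) x in h1 h2 h3; set n := dot _ _ in h1 h3.
have a1 := ler_wpM2l (ltW s'0) h1.
have a2 : (s - s') * p <= (s - s') * hsup K 0 x by rewrite ler_wpM2l// subr_ge0.
rewrite h3; lra.
Qed.

Lemma gsup_blowup x e : 0 < e -> exists k0 : nat, forall k, (k0 <= k)%N ->
  `|gsup K (2^-1 ^+ k) x - 2 * gsup K (2^-1 ^+ k / 2) x + gsup K 0 x|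
    <= e * 2^-1 ^+ k.
Proof.
move=> e0; pose s k : R := 2^-1 ^+ k.
have s0 k : 0 < s k by rewrite /s exprn_gt0.
pose u k := (gsup K 0 x - gsup K (s k) x) / s k.
have sS k : s k.+1 = s k / 2 by rewrite /s exprSr.
have u_nd : nondecreasing_seq u.
  apply/nondecreasing_seqP => k; apply: gsup_s_mono => //.
  by rewrite sS; have := s0 k; lra.
have ub : has_ubound (range u).
  exists (D ^+ 2) => _ [k _ <-]; rewrite /u ler_pdivrMr// mulrC.
  by apply: le_trans (ler_norm _) _; apply: gsup_s_bound; exact: ltW.
have cu := nondecreasing_cvgn u_nd ub.
have /cvgrPdist_lt/(_ _ (divr_gt0 e0 (ltr0Sn R 1))) [k0 _ hk0] := cu.
exists k0 => k k0k.
have h1 := hk0 k k0k; have h2 := hk0 k.+1 (leqW k0k).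
rewrite /= in h1 h2; set l := sup _ in h1 h2.
have -> : gsup K (2^-1 ^+ k) x - 2 * gsup K (2^-1 ^+ k / 2) x + gsup K 0 x =
    (u k.+1 - u k) * s k.
  rewrite /u sS -/(s k); field; rewrite gt_eqF//.
rewrite normrM (gtr0_norm (s0 k)) ler_pM2r//.
rewrite (_ : u k.+1 - u k = (l - u k) - (l - u k.+1)); last by ring.
apply: le_trans (ler_normB _ _) _; lra.
Qed.

End SmoothedSupport.

Section ScaleAverage.
Context {R : realType} {N : nat}.

(* J^-1 times this is an average over the J dyadic scales 2^j r, up to two
   boundary terms which are chosen so that halving r only changes the average by
   (e r - e (2^J r)) / J, where e s = gsup K s - 2 gsup K (s / 2). *)
Definition savg (V : zmodType) (J : nat) (r : R) (phi : R -> V) : V :=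
  phi r - phi (2 ^+ J * r) + \sum_(0 <= j < J) phi (2 ^+ j * r).

Definition fsm (K : set 'rV[R]_N) (J : nat) (r : R) x : R :=
  J%:R^-1 * savg J r (fun s => gsup K s x).

Definition asm (K : set 'rV[R]_N) (J : nat) (r : R) x : 'rV[R]_N :=
  J%:R^-1 *: savg J r (fun s => pmax K s x).

Lemma savgB (V : zmodType) J r (phi psi : R -> V) :
  savg J r (fun s => phi s - psi s) = savg J r phi - savg J r psi.
Proof.
rewrite /savg sumrB [in RHS]opprD [RHS]addrACA; congr (_ + _).
by rewrite !opprB addrACA [RHS]addrACA; congr (_ + _); rewrite addrC.
Qed.

Lemma dot_suml n (I : Type) (s : seq I) (P : pred I) (F : I -> 'rV[R]_n) x :
  dot (\sum_(i <- s | P i) F i) x = \sum_(i <- s | P i) dot (F i) x.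
Proof.
by elim/big_rec2: _ => [|i y z _ <-]; rewrite ?dot0l// dotDl.
Qed.

Lemma savg_dot J r (phi : R -> 'rV[R]_N) x :
  savg J r (fun s => dot (phi s) x) = dot (savg J r phi) x.
Proof. by rewrite /savg !dotDl dotNl dot_suml. Qed.

Lemma sum_pow2 J : \sum_(0 <= j < J) 2 ^+ j = 2 ^+ J - 1 :> R.
Proof.
elim: J => [|J IH]; first by rewrite big_geq// expr0 subrr.
by rewrite big_nat_recr//= IH exprS; ring.
Qed.

Lemma sum_pow2V J : \sum_(0 <= j < J) (2 ^+ j)^-1 <= 2 :> R.
Proof.
suff -> : \sum_(0 <= j < J) (2 ^+ j)^-1 = 2 - 2 * (2 ^+ J)^-1 :> R.
  by rewrite lerBlDr lerDl mulr_ge0// invr_ge0 exprn_ge0.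
elim: J => [|J IH]; first by rewrite big_geq// expr0 invr1 mulr1 subrr.
rewrite big_nat_recr//= IH exprS; field.
by rewrite expf_neq0.
Qed.

Lemma savg_cst (V : lmodType R) J r (v : V) : savg J r (fun=> v) = J%:R *: v.
Proof.
by rewrite /savg subrr add0r big_const_nat subn0 iter_addr_0 scaler_nat.
Qed.

Lemma nrm_savg J r n (phi : R -> 'rV[R]_N) : 0 < r -> 0 <= n ->
  (forall s, 0 < s -> nrm (phi s) <= n / s) -> nrm (savg J r phi) <= 4 * n / r.
Proof.
move=> r0 n0 ub; have p20 j : 0 < 2 ^+ j * r by rewrite mulr_gt0// exprn_gt0.
have -> : 4 * n / r = n / r + n / r + n / r * 2 by field; rewrite gt_eqF.
apply: le_trans (nrmD _ _) _; apply: lerD.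
  apply: le_trans (nrmB _ _) _; apply: lerD; first exact: ub.
  apply: le_trans (ub _ _) _ => //.
  by rewrite ler_wpM2l// lef_pV2 ?posrE// ler_peMl ?exprn_ege1 ?ler1n// ltW.
apply: le_trans (nrm_sum _ _ _) _.
apply: (@le_trans _ _ (\sum_(0 <= j < J) n / r * (2 ^+ j)^-1)).
  apply: ler_sum => j _; apply: le_trans (ub _ _) _ => //.
  by rewrite invfM -mulrA [r^-1 * _]mulrC.
by rewrite -mulr_sumr ler_wpM2l ?sum_pow2V// divr_ge0// ltW.
Qed.

Lemma norm_savg J r n (phi : R -> R) : 0 < r -> 0 <= n ->
  (forall s, 0 < s -> `|phi s| <= n / s) -> `|savg J r phi| <= 4 * n / r.
Proof.
move=> r0 n0 ub; have p20 j : 0 < 2 ^+ j * r by rewrite mulr_gt0// exprn_gt0.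
have -> : 4 * n / r = n / r + n / r + n / r * 2 by field; rewrite gt_eqF.
apply: le_trans (ler_normD _ _) _; apply: lerD.
  apply: le_trans (ler_normB _ _) _; apply: lerD; first exact: ub.
  apply: le_trans (ub _ _) _ => //.
  by rewrite ler_wpM2l// lef_pV2 ?posrE// ler_peMl ?exprn_ege1 ?ler1n// ltW.
apply: le_trans (ler_norm_sum _ _ _) _.
apply: (@le_trans _ _ (\sum_(0 <= j < J) n / r * (2 ^+ j)^-1)).
  apply: ler_sum => j _; apply: le_trans (ub _ _) _ => //.
  by rewrite invfM -mulrA [r^-1 * _]mulrC.
by rewrite -mulr_sumr ler_wpM2l ?sum_pow2V// divr_ge0// ltW.
Qed.

Variables (K : set 'rV[R]_N) (D : R).
Hypotheses (cK : compact K) (K0 : K !=set0).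
Hypothesis convK : forall p q (t : R), K p -> K q -> 0 <= t <= 1 -> K (p + t *: (q - p)).
Hypothesis KD : forall q, K q -> nrm q <= D.
Variable (J : nat).
Hypothesis J0 : (0 < J)%N.

Let D0 : 0 <= D.
Proof. by have [q Kq] := K0; apply: le_trans (KD Kq). Qed.

Let T0 : 0 < J%:R :> R. Proof. by rewrite ltr0n. Qed.

Let p20 j : 0 < 2 ^+ j :> R. Proof. by rewrite exprn_gt0. Qed.

Let V0 : 0 < J%:R^-1 :> R. Proof. by rewrite invr_gt0 ltr0n. Qed.

Lemma fsm_c11 r x y : 0 < r ->
  `|fsm K J r y - fsm K J r x - dot (asm K J r x) (y - x)|
     <= 4 / (J%:R * r) * nrm (y - x) ^+ 2.
Proof.
move=> r0; rewrite /fsm /asm dotZl -savg_dot -!mulrBr -!savgB.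
rewrite normrM (gtr0_norm V0).
have -> : 4 / (J%:R * r) * nrm (y - x) ^+ 2 =
    J%:R^-1 * (4 * nrm (y - x) ^+ 2 / r) by field; rewrite !gt_eqF.
rewrite ler_pM2l//; apply: norm_savg => //; first exact: sqr_ge0.
by move=> s s0; exact: (gsup_c11 cK K0 convK KD).
Qed.

Lemma asm_lip r x y : 0 < r ->
  nrm (asm K J r x - asm K J r y) <= 4 / (J%:R * r) * nrm (x - y).
Proof.
move=> r0; rewrite /asm -scalerBr -savgB nrmZ (gtr0_norm V0).
have -> : 4 / (J%:R * r) * nrm (x - y) =
    J%:R^-1 * (4 * nrm (x - y) / r) by field; rewrite !gt_eqF.
rewrite ler_pM2l//; apply: nrm_savg => // s s0.
by rewrite ler_pdivlMr// mulrC (pmax_lip cK K0 convK KD)// ltW.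
Qed.

Lemma convex_average (p : nat -> 'rV[R]_N) n : (forall j, K (p j)) ->
  K (n.+1%:R^-1 *: \sum_(0 <= j < n.+1) p j).
Proof.
move=> Kp; elim: n => [|n IH].
  by rewrite big_nat1 invr1 scale1r.
rewrite big_nat_recr//=.
have n12 : n.+2%:R = n.+1%:R + 1 :> R by rewrite -natr1.
have := convK IH (Kp n.+1) (_ : 0 <= n.+2%:R^-1 <= 1).
set S := \sum_(0 <= j < n.+1) p j.
have -> : n.+1%:R^-1 *: S + n.+2%:R^-1 *: (p n.+1 - n.+1%:R^-1 *: S) =
    n.+2%:R^-1 *: (S + p n.+1).
  apply/rowP => i; rewrite !mxE n12; field.
  by rewrite nat1r natr1 !pnatr_eq0.
by apply; rewrite invr_ge0 ler0n invf_le1 ?ltr0n// ler1n.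
Qed.

Lemma asm_near r x : exists2 q, K q & nrm (asm K J r x - q) <= 2 * D / J%:R.
Proof.
have [n Jn] : exists n, J = n.+1 by exists J.-1; rewrite prednK.
exists (J%:R^-1 *: \sum_(0 <= j < J) pmax K (2 ^+ j * r) x).
  rewrite Jn; apply: (@convex_average (fun j => pmax K (2 ^+ j * r) x)) => j.
  exact: (pmax_mem cK K0 KD).
rewrite /asm /savg -scalerBr addrK nrmZ ger0_norm ?invr_ge0 ?ler0n// mulrC.
rewrite ler_pM2r ?invr_gt0//; apply: le_trans (nrmB _ _) _.
by rewrite mulr_natl mulr2n lerD// (nrm_pmax cK K0 KD).
Qed.

Lemma nrm_asm r x : nrm (asm K J r x) <= 3 * D.
Proof.
have [q Kq] := asm_near r x; rewrite -{2}[asm K J r x](subrK q) => h.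
apply: le_trans (nrmD _ _) _; have := KD Kq.
have : 2 * D / J%:R <= 2 * D.
  by rewrite ler_piMr ?mulr_ge0// invf_le1// ler1n.
lra.
Qed.

Lemma asm_radial r x : 0 < r ->
  `|dot (asm K J r x) x - fsm K J r x| <= 8 * D / J%:R * nrm x.
Proof.
move=> r0; set n := nrm x.
pose k s := dot (pmax K s x) x - gsup K s x.
have -> : dot (asm K J r x) x - fsm K J r x = J%:R^-1 * savg J r k.
  by rewrite /fsm /asm dotZl -savg_dot -mulrBr -savgB.
rewrite /savg normrM (gtr0_norm (_ : 0 < J%:R^-1)) ?invr_gt0//.
have -> : 8 * D / J%:R * n = J%:R^-1 * (8 * (D * n)) by ring.
rewrite ler_pM2l ?invr_gt0//.
have gb s : 0 <= s -> - (D * n) <= gsup K s x <= D * n.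
  by move=> s0; rewrite -ler_norml (gsup_bound cK K0 KD).
have db s : - (D * n) <= dot (pmax K s x) x <= D * n.
  rewrite -ler_norml; apply: le_trans (cauchy_schwarz _ _) _.
  by rewrite ler_wpM2r// (nrm_pmax cK K0 KD).
have Dn : 0 <= D * n by rewrite mulr_ge0 ?nrm_ge0.
have kb s : 0 <= s -> - (2 * (D * n)) <= k s /\ k s <= 2 * (D * n).
  move=> s0; have /andP[h1 h2] := gb s s0; have /andP[h3 h4] := db s.
  by rewrite /k; split; lra.
have r00 := ltW r0; have pr0 j : 0 <= 2 ^+ j * r by rewrite mulr_ge0// ltW.
have up : \sum_(0 <= j < J) k (2 ^+ j * r) <= 4 * (D * n).
  pose G j := - (2 * gsup K (2 ^+ j * r / 2) x).
  apply: (@le_trans _ _ (\sum_(0 <= j < J) (G j.+1 - G j))).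
    apply: ler_sum => j _; rewrite /G /k exprS.
    have -> : 2 * 2 ^+ j * r / 2 = 2 ^+ j * r by field.
    by have := gsup_radial_le cK K0 KD (2 ^+ j * r) x; lra.
  rewrite telescope_sumr// /G.
  have /andP[h1 h2] := gb _ (divr_ge0 (pr0 0) (ler0n R 2)).
  have /andP[h3 h4] := gb _ (divr_ge0 (pr0 J) (ler0n R 2)).
  lra.
have lo : - (2 * (D * n)) <= \sum_(0 <= j < J) k (2 ^+ j * r).
  pose G j := - gsup K (2 ^+ j * r) x.
  apply: (@le_trans _ _ (\sum_(0 <= j < J) (G j.+1 - G j))).
    rewrite telescope_sumr// /G.
    have /andP[h1 h2] := gb _ (pr0 0); have /andP[h3 h4] := gb _ (pr0 J).
    lra.
  apply: ler_sum => j _; rewrite /G /k exprS.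
  have -> : 2 * 2 ^+ j * r = 2 ^+ j * r * 2 by ring.
  by have := gsup_radial_ge cK K0 KD (2 ^+ j * r) x; lra.
have [a1 a2] := kb r r00; have [b1 b2] := kb _ (pr0 J).
by apply: norm_le_intro; lra.
Qed.

Definition esm (s : R) (x : 'rV[R]_N) : R := gsup K s x - 2 * gsup K (s / 2) x.

Lemma fsm_half r x :
  fsm K J r x - fsm K J (r / 2) x = J%:R^-1 * (esm r x - esm (2 ^+ J * r) x).
Proof.
have [n Jn] : exists n, J = n.+1 by exists J.-1; rewrite prednK.
rewrite /fsm /esm /savg -mulrBr Jn; congr (_ * _).
rewrite big_nat_recr//= [X in _ - (_ + X)]big_nat_recl//= expr0 mul1r.
have -> : \sum_(0 <= i < n) gsup K (2 ^+ i.+1 * (r / 2)) x =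
    \sum_(0 <= i < n) gsup K (2 ^+ i * r) x.
  by apply: eq_bigr => i _; congr (gsup K _ x); rewrite exprS; field.
have -> : 2 ^+ n.+1 * (r / 2) = 2 ^+ n * r by rewrite exprS; field.
have -> : 2 ^+ n.+1 * r / 2 = 2 ^+ n * r by rewrite exprS; field.
ring.
Qed.

Lemma asm_half r x :
  nrm (asm K J r x - asm K J (r / 2) x) <= 6 * D / J%:R.
Proof.
have [n Jn] : exists n, J = n.+1 by exists J.-1; rewrite prednK.
pose v s := pmax K s x - 2 *: pmax K (s / 2) x.
have -> : asm K J r x - asm K J (r / 2) x =
    J%:R^-1 *: (v r - v (2 ^+ J * r)).
  rewrite /asm /v /savg -scalerBr Jn; congr (_ *: _).
  rewrite big_nat_recr//= [X in _ - (_ + X)]big_nat_recl//= expr0 mul1r.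
  have -> : \sum_(0 <= i < n) pmax K (2 ^+ i.+1 * (r / 2)) x =
      \sum_(0 <= i < n) pmax K (2 ^+ i * r) x.
    by apply: eq_bigr => i _; congr (pmax K _ x); rewrite exprS; field.
  have -> : 2 ^+ n.+1 * (r / 2) = 2 ^+ n * r by rewrite exprS; field.
  have -> : 2 ^+ n.+1 * r / 2 = 2 ^+ n * r by rewrite exprS; field.
  by apply/rowP => i; rewrite !mxE; ring.
rewrite nrmZ ger0_norm ?invr_ge0 ?ler0n// mulrC ler_pM2r ?invr_gt0//.
have vb s : nrm (v s) <= 3 * D.
  apply: le_trans (nrmB _ _) _; rewrite nrmZ ger0_norm//.
  have := nrm_pmax cK K0 KD s x; have := nrm_pmax cK K0 KD (s / 2) x; lra.
by apply: le_trans (nrmB _ _) _; have := vb r; have := vb (2 ^+ J * r); lra.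
Qed.

Let esm_lip s x y : `|esm s x - esm s y| <= 3 * D * nrm (x - y).
Proof.
have -> : esm s x - esm s y = (gsup K s x - gsup K s y)
    - 2 * (gsup K (s / 2) x - gsup K (s / 2) y) by rewrite /esm; ring.
apply: le_trans (ler_normB _ _) _; rewrite normrM ger0_norm//.
have := gsup_lip cK K0 KD s x y; have := gsup_lip cK K0 KD (s / 2) x y; lra.
Qed.

Lemma fsm_half_lip r x y :
  `|(fsm K J r x - fsm K J (r / 2) x) - (fsm K J r y - fsm K J (r / 2) y)|
   <= 6 * D / J%:R * nrm (x - y).
Proof.
rewrite !fsm_half -mulrBr normrM (gtr0_norm (_ : 0 < J%:R^-1)) ?invr_gt0//.
have -> : 6 * D / J%:R * nrm (x - y) = J%:R^-1 * (6 * D * nrm (x - y)) by ring.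
rewrite ler_pM2l ?invr_gt0//.
have -> : esm r x - esm (2 ^+ J * r) x - (esm r y - esm (2 ^+ J * r) y) =
  (esm r x - esm r y) - (esm (2 ^+ J * r) x - esm (2 ^+ J * r) y) by ring.
apply: le_trans (ler_normB _ _) _.
have := esm_lip r x y; have := esm_lip (2 ^+ J * r) x y; lra.
Qed.

Let pJ (r : R) : 0 < r -> r <= 2 ^+ J * r.
Proof. by move=> r0; rewrite ler_peMl ?exprn_ege1 ?ler1n// ltW. Qed.

Lemma fsm_half_bound r x : 0 < r ->
  `|fsm K J r x - fsm K J (r / 2) x| <= 4 * 2 ^+ J * D ^+ 2 * r.
Proof.
move=> r0; rewrite fsm_half normrM (gtr0_norm (_ : 0 < J%:R^-1)) ?invr_gt0//.
have eb s : 0 < s -> `|esm s x + gsup K 0 x| <= 2 * s * D ^+ 2.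
  move=> s0; have -> : esm s x + gsup K 0 x = 2 * (gsup K 0 x - gsup K (s / 2) x)
      - (gsup K 0 x - gsup K s x) by rewrite /esm; ring.
  apply: le_trans (ler_normB _ _) _; rewrite normrM ger0_norm//.
  have := gsup_s_bound cK K0 KD x (ltW s0).
  have s2 : 0 <= s / 2 by rewrite divr_ge0// ltW.
  have := gsup_s_bound cK K0 KD x s2; lra.
apply: (@le_trans _ _ (1 * `|esm r x - esm (2 ^+ J * r) x|)).
  by rewrite ler_wpM2r// invf_le1// ler1n.
rewrite mul1r; have -> : esm r x - esm (2 ^+ J * r) x = (esm r x + gsup K 0 x)
    - (esm (2 ^+ J * r) x + gsup K 0 x) by ring.
apply: le_trans (ler_normB _ _) _.
have := eb r r0; have := eb (2 ^+ J * r) (mulr_gt0 (p20 J) r0).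
have : r * D ^+ 2 <= 2 ^+ J * r * D ^+ 2 by rewrite ler_wpM2r ?sqr_ge0// pJ.
lra.
Qed.

Lemma fsm_limit_bound r x : 0 < r ->
  `|fsm K J r x - hsup K 0 x| <= 3 * 2 ^+ J * D ^+ 2 * r.
Proof.
move=> r0; rewrite -gsup0.
pose u s := gsup K s x - gsup K 0 x.
have -> : fsm K J r x - gsup K 0 x = J%:R^-1 * savg J r u.
  rewrite /fsm [savg J r u]savgB (@savg_cst R^o).
  by rewrite mulrBr -[_ *: _]/(J%:R * _) mulKf// gt_eqF.
rewrite /savg.
have ub s : 0 < s -> `|u s| <= s * D ^+ 2.
  by move=> s0; rewrite distrC (gsup_s_bound cK K0 KD)// ltW.
rewrite normrM (gtr0_norm (_ : 0 < J%:R^-1)) ?invr_gt0//.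
set X := _ + _.
apply: (@le_trans _ _ (1 * `|X|)); first by rewrite ler_wpM2r// invf_le1// ler1n.
rewrite mul1r /X; apply: le_trans (ler_normD _ _) _.
have h1 : `|u r - u (2 ^+ J * r)| <= 2 * (2 ^+ J * D ^+ 2 * r).
  apply: le_trans (ler_normB _ _) _.
  have := ub r r0; have := ub (2 ^+ J * r) (mulr_gt0 (p20 J) r0).
  have : r * D ^+ 2 <= 2 ^+ J * r * D ^+ 2 by rewrite ler_wpM2r ?sqr_ge0// pJ.
  lra.
have h2 : `|\sum_(0 <= j < J) u (2 ^+ j * r)| <= 2 ^+ J * D ^+ 2 * r.
  apply: le_trans (ler_norm_sum _ _ _) _.
  apply: (@le_trans _ _ (\sum_(0 <= j < J) 2 ^+ j * (D ^+ 2 * r))).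
    apply: ler_sum => j _; rewrite mulrA mulrAC; apply: ub; exact: mulr_gt0.
  rewrite -mulr_suml sum_pow2 -mulrA; apply: ler_wpM2r.
    by rewrite mulr_ge0 ?sqr_ge0// ltW.
  by rewrite gerBl.
lra.
Qed.

Lemma fsm_blowup x e : 0 < e -> exists k0 : nat, forall k, (k0 <= k)%N ->
  `|fsm K J (2^-1 ^+ k) x - fsm K J (2^-1 ^+ k / 2) x| <= e * 2^-1 ^+ k.
Proof.
move=> e0; pose e' := e / (2 ^+ J + 1).
have q0 : 0 < 2 ^+ J + 1 :> R by rewrite ltr_wpDl// ltW.
have e'0 : 0 < e' by rewrite divr_gt0.
have [k0 hk0] := gsup_blowup cK K0 KD x e'0.
exists (k0 + J)%N => k hk.
have kk : (k0 <= k)%N by apply: leq_trans hk; rewrite leq_addr.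
have Jk : (J <= k)%N by apply: leq_trans hk; rewrite leq_addl.
have kJ : (k0 <= k - J)%N by rewrite -(leq_add2r J) subnK.
have pJk : 2 ^+ J * 2^-1 ^+ k = 2^-1 ^+ (k - J) :> R.
  rewrite -{1}(subnK Jk) exprD mulrCA -exprMn divff ?expr1n ?mulr1//.
rewrite fsm_half pJk normrM (gtr0_norm (_ : 0 < J%:R^-1)) ?invr_gt0//.
set r := 2^-1 ^+ k; set s := 2^-1 ^+ (k - J).
have h1 := hk0 k kk; have h2 := hk0 _ kJ; rewrite -/r -/s in h1 h2.
apply: (@le_trans _ _ (1 * `|esm r x - esm s x|)).
  by rewrite ler_wpM2r// invf_le1// ler1n.
rewrite mul1r; have -> : esm r x - esm s x = (esm r x + gsup K 0 x)
    - (esm s x + gsup K 0 x) by ring.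
apply: le_trans (ler_normB _ _) _; apply: le_trans (lerD h1 h2) _.
rewrite -mulrDr /s -pJk -/r /e' le_eqVlt; apply/orP; left; apply/eqP.
by field; rewrite gt_eqF.
Qed.

Lemma pmax_at0 s : 0 < s -> pmax K s 0 = pmax K 1 0.
Proof.
move=> s0; apply/eqP; rewrite -subr_eq0 -nrm_eq0 -[_ == _]andTb.
have h1 := pmax_var cK K0 convK KD 0 (ltW s0) (pmax_mem cK K0 KD 1 0).
have h2 := pmax_var cK K0 convK KD 0 (ler01 : 0 <= 1 :> R) (pmax_mem cK K0 KD s 0).
move: h1 h2; set p := pmax K s 0; set q := pmax K 1 0.
rewrite scale1r !sub0r !dotNr !dotZr -mulrN pmulr_rle0// -dotNr.
rewrite -(sqrf_eq0 (nrm _)) nrm_sqr => h1 h2.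
rewrite eq_le dot_ge0 andbT !dotBl !dotBr in h1 h2 *.
by move: h1 h2; rewrite !dotNr (dotC q p); lra.
Qed.

Lemma asm_linear x : nrm x <= 2 -> nrm (asm K J 1 x - pmax K 1 0) <= 8 / J%:R.
Proof.
move=> x2; have -> : asm K J 1 x - pmax K 1 0 =
    J%:R^-1 *: savg J 1 (fun s => pmax K s x - pmax K 1 0).
  by rewrite savgB savg_cst scalerBr scalerA mulVf ?scale1r// gt_eqF.
rewrite nrmZ (gtr0_norm V0) mulrC ler_pM2r//.
have -> : 8 = 4 * 2 / 1 :> R by field.
apply: nrm_savg => // s s0; rewrite ler_pdivlMr// mulrC -(pmax_at0 s0).
by apply: le_trans (pmax_lip cK K0 convK KD _ _ (ltW s0)) _; rewrite subr0.
Qed.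

Lemma fsm_linear_lip x y : nrm x <= 2 -> nrm y <= 2 ->
  `|(fsm K J 1 x - dot (pmax K 1 0) x) - (fsm K J 1 y - dot (pmax K 1 0) y)|
   <= 8 / J%:R * nrm (x - y).
Proof.
move=> x2 y2; set q := pmax K 1 0; set n := nrm (x - y).
have n0 : 0 <= n by exact: nrm_ge0.
have -> : fsm K J 1 x - dot q x - (fsm K J 1 y - dot q y) =
    J%:R^-1 * savg J 1 (fun s => gsup K s x - gsup K s y - dot q (x - y)).
  rewrite savgB (@savg_cst R^o) savgB !mulrBr -[_ *: _]/(J%:R * _) mulKf ?gt_eqF//.
  by rewrite dotBr /fsm; ring.
rewrite normrM (gtr0_norm V0).
have -> : 8 / J%:R * n = J%:R^-1 * (4 * (2 * n) / 1) by field; rewrite gt_eqF.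
rewrite ler_pM2l//; apply: norm_savg => //; first by rewrite mulr_ge0.
move=> s s0; have h1 := gsup_grad cK K0 KD s x y.
have h2 := gsup_grad cK K0 KD s y x.
have b z w : nrm z <= 2 -> nrm w = n -> dot (pmax K s z - q) w <= 2 * n / s.
  move=> z2 wn; rewrite ler_pdivlMr// mulrC.
  apply: le_trans (ler_wpM2l (ltW s0) (dot_le _ _)) _; rewrite mulrA wn.
  rewrite ler_wpM2r// /q -(pmax_at0 s0).
  by apply: le_trans (pmax_lip cK K0 convK KD _ _ (ltW s0)) _; rewrite subr0.
have b1 := b x (x - y) x2 erefl.
have b2 := b y (y - x) y2 (nrmBC _ _).
rewrite dotBl in b1; rewrite dotBl in b2.
have e p : dot p (y - x) = - dot p (x - y) by rewrite -dotNr opprB.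
rewrite e in h1; rewrite !e in b2.
by apply: norm_le_intro; lra.
Qed.

Lemma fsm_at0 r : 0 < r -> fsm K J r 0 = 0.
Proof.
move=> r0; rewrite /fsm /savg big1 => [|j _].
  by rewrite !(gsup_at0 cK K0 KD)// ?subrr ?addr0 ?mulr0// ?mulr_ge0// ltW.
by rewrite (gsup_at0 cK K0 KD)// mulr_ge0// ltW.
Qed.

End ScaleAverage.

Section Assembly.
Context {R : realType} {N m : nat}.
Implicit Types (f g : 'I_m -> 'rV[R]_N -> R) (a b : 'I_m -> 'rV[R]_N -> 'rV[R]_N).

Definition system f (x : 'rV[R]_N) : 'rV[R]_(1 + m) :=
  row_mx ((dot x x - 1) / 2)%:M (\row_i f i x).

Definition jacobian a (x : 'rV[R]_N) : 'M[R]_(1 + m, N) :=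
  col_mx x (\matrix_i a i x).

Lemma system_eq0 f x : system f x = 0 <-> nrm x = 1 /\ forall i, f i x = 0.
Proof.
split=> [e|[x1 fx]].
  have e1 : (dot x x - 1) / 2 = 0.
    have := congr1 (fun v : 'rV_(1 + m) => v 0 (lshift m 0)) e.
    by rewrite /system row_mxEl !mxE eqxx mulr1n.
  split.
    have : nrm x ^+ 2 = 1 by rewrite nrm_sqr; lra.
    by move/eqP; rewrite sqrf_eq1 => /orP[/eqP//|/eqP h]; have := nrm_ge0 x; rewrite h; lra.
  move=> i; have := congr1 (fun v : 'rV_(1 + m) => v 0 (rshift 1 i)) e.
  by rewrite /system row_mxEr !mxE.
rewrite /system -nrm_sqr x1 expr1n subrr mul0r raddf0.
by rewrite (_ : \row_i _ = 0) ?row_mx0//; apply/rowP => i; rewrite !mxE.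
Qed.

Lemma interp_system f g t :
  interp (system f) (system g) t = system (fun i => interp (f i : _ -> R^o) (g i) t).
Proof.
apply/funext => x; rewrite /interp /system !scale_row_mx add_row_mx; congr row_mx.
  by apply/rowP => i; rewrite !mxE; ring.
by apply/rowP => i; rewrite !mxE.
Qed.

Lemma interp_jacobian a b t :
  interp (jacobian a) (jacobian b) t = jacobian (fun i => interp (a i) (b i) t).
Proof.
apply/funext => x; rewrite /interp /jacobian !scale_col_mx add_col_mx; congr col_mx.
  by rewrite -scalerDl subrK scale1r.
by apply/matrixP => i j; rewrite !mxE.
Qed.

Lemma mul_row_jacobian (beta : 'rV[R]_1) (z : 'rV[R]_m) a x :
  row_mx beta z *m jacobian a x = beta 0 0 *: x + \sum_i z 0 i *: a i x.
Proof.
rewrite /jacobian mul_row_col; congr (_ + _).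
  by rewrite [beta]mx11_scalar mul_scalar_mx !mxE eqxx mulr1n.
by rewrite mulmx_sum_row; apply: eq_bigr => i _; rewrite rowK.
Qed.

Lemma nrm_row1 (beta : 'rV[R]_1) : nrm beta = `|beta 0 0|.
Proof. by rewrite /nrm /dot big_ord1 -expr2 sqrtr_sqr. Qed.

Lemma nrm_lsub_le (w : 'rV[R]_(1 + m)) : `|lsubmx w 0 0| <= nrm w.
Proof. by rewrite mxE nrm_coord. Qed.

Lemma nrm_rsub_le (w : 'rV[R]_(1 + m)) i : `|rsubmx w 0 i| <= nrm w.
Proof. by rewrite mxE nrm_coord. Qed.

Lemma nrm_row_le (u : 'rV[R]_1) (v : 'rV[R]_m) : nrm (row_mx u v) <= nrm u + nrm v.
Proof.
rewrite -(@ler_pXn2r _ 2) ?nnegrE ?addr_ge0// nrm_row_mx sqrrD.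
have : 0 <= nrm u * nrm v by rewrite mulr_ge0.
lra.
Qed.

Lemma system_diff_le f g x e : (forall i, `|f i x - g i x| <= e) ->
  nrm (system f x - system g x) <= m%:R * e.
Proof.
move=> h; rewrite /system opp_row_mx add_row_mx.
apply: le_trans (nrm_row_le _ _) _; rewrite subrr nrm0 add0r.
by apply: nrm_le_coord => i; rewrite !mxE.
Qed.

Lemma system_diff_lip f g x y e :
  (forall i, `|(f i x - g i x) - (f i y - g i y)| <= e) ->
  nrm (system f x - system g x - (system f y - system g y)) <= m%:R * e.
Proof.
move=> h; rewrite /system !opp_row_mx !add_row_mx !opp_row_mx add_row_mx.
apply: le_trans (nrm_row_le _ _) _; rewrite !subrr nrm0 add0r.
by apply: nrm_le_coord => i; rewrite !mxE.
Qed.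

Lemma jacobian_diff_le a b x e : 0 <= e -> (forall i, nrm (a i x - b i x) <= e) ->
  forall w, nrm (w *m (jacobian a x - jacobian b x)) <= m%:R * e * nrm w.
Proof.
move=> e0 h w; rewrite -[w]hsubmxK mulmxBr !mul_row_jacobian.
rewrite opprD addrACA subrr add0r -sumrB hsubmxK.
apply: le_trans (nrm_sum _ _ _) _.
apply: (@le_trans _ _ (\sum_(i < m) e * nrm w)).
  apply: ler_sum => i _; rewrite -scalerBr nrmZ mulrC.
  by apply: ler_pM => //; exact: nrm_rsub_le.
by rewrite sumr_const card_ord -[_ *+ m]mulr_natl mulrA.
Qed.

Lemma jacobian_le a x A : 0 <= A -> nrm x <= 2 -> (forall i, nrm (a i x) <= A) ->
  forall w, nrm (w *m jacobian a x) <= (2 + m%:R * A) * nrm w.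
Proof.
move=> A0 x2 h w; rewrite -{1}[w]hsubmxK mul_row_jacobian mulrDl.
apply: le_trans (nrmD _ _) _; apply: lerD.
  by rewrite nrmZ mulrC; apply: ler_pM => //; exact: nrm_lsub_le.
apply: le_trans (nrm_sum _ _ _) _.
apply: (@le_trans _ _ (\sum_(i < m) A * nrm w)).
  apply: ler_sum => i _; rewrite nrmZ mulrC.
  by apply: ler_pM => //; exact: nrm_rsub_le.
by rewrite sumr_const card_ord -[_ *+ m]mulr_natl mulrA.
Qed.

Lemma system_c11 f a lam : 0 <= lam ->
  (forall i x y, `|f i y - f i x - dot (a i x) (y - x)| <= lam * nrm (y - x) ^+ 2) ->
  (forall i x y, nrm (a i x - a i y) <= lam * nrm (x - y)) ->
  c11 (1 + m%:R * lam) (system f) (jacobian a).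
Proof.
move=> lam0 hf ha; split=> [x y|x y w].
  set n2 := nrm (y - x) ^+ 2.
  rewrite /system /jacobian tr_col_mx mul_mx_row opp_row_mx add_row_mx.
  rewrite opp_row_mx add_row_mx; apply: le_trans (nrm_row_le _ _) _.
  rewrite [leRHS]mulrDl; apply: lerD.
    rewrite nrm_row1 !mxE eqxx !mulr1n.
    have -> : \sum_j (y - x) 0 j * x^T j 0 = dot (y - x) x.
      by apply: eq_bigr => j _; rewrite [x^T _ _]mxE.
    have -> : (dot y y - 1) / 2 - (dot x x - 1) / 2 - dot (y - x) x = n2 / 2.
      by rewrite /n2 nrm_sqr !dotBl !dotBr (dotC x y); field.
    have n20 : 0 <= n2 by exact: sqr_ge0.
    by rewrite ger0_norm ?divr_ge0//; lra.
  rewrite -mulrA; apply: nrm_le_coord => i; rewrite !mxE.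
  have -> : \sum_j (y - x) 0 j * (\matrix_i0 a i0 x)^T j i = dot (a i x) (y - x).
    by apply: eq_bigr => j _; rewrite !mxE mulrC.
  exact: hf.
rewrite -[w]hsubmxK mulmxBr !mul_row_jacobian hsubmxK opprD addrACA -scalerBr -sumrB.
rewrite -[leRHS]mulrA [leRHS]mulrDl mul1r -!mulrA; apply: le_trans (nrmD _ _) _; apply: lerD.
  by rewrite nrmZ mulrC ler_wpM2l// nrm_lsub_le.
apply: le_trans (nrm_sum _ _ _) _.
apply: (@le_trans _ _ (\sum_(i < m) lam * nrm (x - y) * nrm w)).
  apply: ler_sum => i _; rewrite -scalerBr nrmZ mulrC.
  by apply: ler_pM => //; exact: nrm_rsub_le.
by rewrite sumr_const card_ord -[_ *+ m]mulr_natl !mulrA.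
Qed.

Variables (K : 'I_m -> set 'rV[R]_N) (c0 : R).
Hypotheses (c00 : 0 < c0) (c01 : c0 <= 1).
Hypothesis indep : forall q : 'I_m -> 'rV[R]_N, (forall i, K i (q i)) ->
  forall z : 'rV[R]_m, c0 * nrm z <= nrm (\sum_i z 0 i *: q i).

(* At a zero of the system, the gradients are nearly selections of the bodies
   and nearly orthogonal to x, so they are independent modulo x. *)
Lemma jacobian_regular a x d : nrm x = 1 -> m%:R * d <= c0 / 4 ->
  (forall i, exists2 q, K i q & nrm (a i x - q) <= d) ->
  (forall i, `|dot (a i x) x| <= d) ->
  forall w, 2 * (c0 / 6) * nrm w <= nrm (w *m jacobian a x).
Proof.
move=> x1 md near orth w; rewrite -{2}[w]hsubmxK mul_row_jacobian.
set beta := lsubmx w 0 0; set z := rsubmx w; set A := \sum_i _.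
have [q hq] := choice (fun i => let: ex_intro2 q h1 h2 := near i in
  ex_intro (fun q => K i q /\ nrm (a i x - q) <= d) q (conj h1 h2)).
have zi i : `|z 0 i| <= nrm z by exact: nrm_coord.
have sumd (u : 'I_m -> R) : (forall i, u i <= nrm z * d) ->
    \sum_i u i <= c0 / 4 * nrm z.
  move=> hu; apply: (@le_trans _ _ (\sum_(i < m) nrm z * d)); first exact: ler_sum.
  by rewrite sumr_const card_ord -[_ *+ m]mulr_natl mulrCA mulrC ler_wpM2r.
have A1 : c0 / 2 * nrm z <= nrm A.
  have h1 := indep (fun i => (hq i).1) z.
  have h2 : nrm (\sum_i z 0 i *: q i - A) <= c0 / 4 * nrm z.
    rewrite /A -sumrB; apply: le_trans (nrm_sum _ _ _) _; apply: sumd => i.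
    rewrite -scalerBr nrmZ nrmBC; apply: ler_pM => //.
    exact: (hq i).2.
  have := nrmBl (\sum_i z 0 i *: q i) A.
  have : 0 <= c0 * nrm z by rewrite mulr_ge0// ltW.
  lra.
have A2 : `|dot A x| <= c0 / 4 * nrm z.
  rewrite /A dot_suml; apply: le_trans (ler_norm_sum _ _ _) _; apply: sumd => i.
  by rewrite dotZl normrM; apply: ler_pM.
have w2 : nrm w ^+ 2 = beta ^+ 2 + nrm z ^+ 2.
  rewrite -[w]hsubmxK nrm_row_mx nrm_row1 -/z -/beta.
  by rewrite real_normK ?num_real.
have k0 : 0 <= 2 * (c0 / 6) by rewrite mulr_ge0// divr_ge0// ltW.
rewrite -(@ler_pXn2r _ 2) ?nnegrE//; last exact: mulr_ge0.
rewrite exprMn w2.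
rewrite [leRHS]nrm_sqr dotDl !dotDr !dotZl !dotZr -!nrm_sqr x1 expr1n mulr1.
rewrite (dotC x A).
have z0 : 0 <= nrm z by [].
have A3 : (c0 / 2 * nrm z) ^+ 2 <= nrm A ^+ 2.
  rewrite ler_pXn2r ?nnegrE//; apply: mulr_ge0 => //.
  by rewrite divr_ge0// ltW.
have A4 : `|beta * dot A x| <= `|beta| * (c0 / 4 * nrm z).
  by rewrite normrM ler_wpM2l.
have A5 : 0 <= (`|beta| - c0 / 2 * nrm z) ^+ 2 by exact: sqr_ge0.
have nb : `|beta| ^+ 2 = beta ^+ 2 by rewrite real_normK ?num_real.
have A6 : - (`|beta| * (c0 / 4 * nrm z)) <= beta * dot A x.
  by move: A4; rewrite ler_norml => /andP[].
have c02 : c0 ^+ 2 <= 1 by rewrite expr_le1// ltW.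
have A7 : c0 ^+ 2 * beta ^+ 2 <= beta ^+ 2 by rewrite ler_piMl ?sqr_ge0.
have A8 : 0 <= c0 ^+ 2 * nrm z ^+ 2 by rewrite mulr_ge0 ?sqr_ge0.
have A9 : 0 <= beta ^+ 2 by exact: sqr_ge0.
rewrite sqrrB nb in A5.
move: A3 A5 A6 A7 A8 A9; move: (beta * dot A x) => X.
move: (nrm A ^+ 2) => Y; rewrite !exprMn; move: `|beta| => ab.
by move=> A3 A5 A6 A7 A8 A9; lra.
Qed.

End Assembly.

Section Deformation.
Context {R : realType} {N m : nat}.
Variables (K : 'I_m -> set 'rV[R]_N) (D c0 : R).
Hypotheses (c00 : 0 < c0) (c01 : c0 <= 1) (D0 : 0 <= D).
Hypothesis indep : forall q : 'I_m -> 'rV[R]_N, (forall i, K i (q i)) ->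
  forall z : 'rV[R]_m, c0 * nrm z <= nrm (\sum_i z 0 i *: q i).
Hypothesis convK : forall i p q (t : R), K i p -> K i q -> 0 <= t <= 1 ->
  K i (p + t *: (q - p)).

Let c := c0 / 6.
Let C := 2 + m%:R * (3 * D).

Lemma deform (f0 f1 : 'I_m -> 'rV[R]_N -> R) (a0 a1 : 'I_m -> 'rV[R]_N -> 'rV[R]_N)
    lam d e h :
  0 <= lam -> 0 <= e -> 0 <= h -> m%:R * d <= c0 / 4 ->
  4 * C / c ^+ 2 * (m%:R * e) <= 1 ->
  (forall i x y, `|f0 i y - f0 i x - dot (a0 i x) (y - x)| <= lam * nrm (y - x) ^+ 2) ->
  (forall i x y, nrm (a0 i x - a0 i y) <= lam * nrm (x - y)) ->
  (forall i x y, `|f1 i y - f1 i x - dot (a1 i x) (y - x)| <= lam * nrm (y - x) ^+ 2) ->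
  (forall i x y, nrm (a1 i x - a1 i y) <= lam * nrm (x - y)) ->
  (forall i x, nrm (a0 i x) <= 3 * D) -> (forall i x, nrm (a1 i x) <= 3 * D) ->
  (forall i x, exists2 q, K i q & nrm (a0 i x - q) <= d) ->
  (forall i x, exists2 q, K i q & nrm (a1 i x - q) <= d) ->
  (forall i x, nrm x = 1 -> `|dot (a0 i x) x - f0 i x| <= d) ->
  (forall i x, nrm x = 1 -> `|dot (a1 i x) x - f1 i x| <= d) ->
  (forall i x, nrm x <= 2 -> nrm (a0 i x - a1 i x) <= e) ->
  (forall i x y, nrm x <= 2 -> nrm y <= 2 ->
    `|(f0 i x - f1 i x) - (f0 i y - f1 i y)| <= e * nrm (x - y)) ->
  (forall i x, nrm x <= 2 -> `|f0 i x - f1 i x| <= h) ->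
  let F0 := system f0 in let F1 := system f1 in
  exists th : 'rV[R]_N -> 'rV[R]_N,
  [/\ (forall x, F0 x = 0 -> F1 (th x) = 0) /\
      (forall y, F1 y = 0 -> exists2 x, F0 x = 0 & th x = y) /\
      (forall x y, F0 x = 0 -> F0 y = 0 -> th x = th y -> x = y),
      exists Lam, forall x y, F0 x = 0 -> F0 y = 0 ->
        nrm (th x - th y) <= Lam * nrm (x - y),
      forall x, F0 x = 0 -> nrm (th x - x) <= 4 * C / c ^+ 2 * nrm (F0 x - F1 x)
    & forall x y, F0 x = 0 -> F0 y = 0 ->
      (1 - 14 * C ^+ 2 / c ^+ 4 *
        (m%:R * e + 2 * (1 + m%:R * lam) * nrm (F0 x - F1 x))) * nrm (x - y)
      <= nrm (th x - th y)].
Proof.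
move=> lam0 e0 h0 md small f0c a0c f1c a1c a0b a1b a0n a1n a0r a1r ae fe fh F0 F1.
have m0 : 0 <= m%:R :> R by [].
have cc0 : 0 < c by rewrite /c divr_gt0.
have c1 : c <= 1 by move: c00 c01; rewrite /c; lra.
have mD : 0 <= m%:R * (3 * D) by rewrite !mulr_ge0.
have C1 : 1 <= C by rewrite /C; lra.
have L1 : 1 <= 1 + m%:R * lam by rewrite lerDl mulr_ge0.
have D3 : 0 <= 3 * D by rewrite mulr_ge0.
have Z t x : interp F0 F1 t x = 0 ->
    nrm x = 1 /\ forall i, (1 - t) * f0 i x + t * f1 i x = 0.
  by rewrite interp_system => /system_eq0.
apply: (@chain R N (1 + m) (1 + m%:R * lam) (m%:R * e) (m%:R * h) c C F0 F1
  (jacobian a0) (jacobian a1) L1 (mulr_ge0 m0 e0) (mulr_ge0 m0 h0) cc0 c1 C1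
  (system_c11 lam0 f0c a0c) (system_c11 lam0 f1c a1c)).
- by move=> x w x2; apply: jacobian_diff_le => // i; exact: ae.
- move=> x y x2 y2; rewrite -mulrA; apply: system_diff_lip => i; exact: fe.
- by move=> x x2; apply: system_diff_le => i; exact: fh.
- by move=> x x2; apply: jacobian_le.
- by move=> x x2; apply: jacobian_le.
- by move=> t x _ /Z[].
- move=> t x w /andP[t0 t1] /Z[x1 fx]; rewrite interp_jacobian.
  have t1' : 0 <= 1 - t by rewrite subr_ge0.
  apply: (jacobian_regular c00 c01 indep (d := d)) => // i.
    have [q0 Kq0 hq0] := a0n i x; have [q1 Kq1 hq1] := a1n i x.
    exists (q0 + t *: (q1 - q0)); first by apply: convK => //; rewrite t0.
    have -> : interp (a0 i) (a1 i) t x - (q0 + t *: (q1 - q0)) =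
        (1 - t) *: (a0 i x - q0) + t *: (a1 i x - q1).
      by apply/rowP => j; rewrite /interp !mxE; ring.
    apply: le_trans (nrmD _ _) _; rewrite !nrmZ !ger0_norm//.
    have := ler_wpM2l t1' hq0; have := ler_wpM2l t0 hq1; lra.
  have -> : dot (interp (a0 i) (a1 i) t x) x =
      (1 - t) * (dot (a0 i x) x - f0 i x) + t * (dot (a1 i x) x - f1 i x).
    by rewrite /interp dotDl !dotZl -[LHS]subr0 -(fx i); ring.
  apply: le_trans (ler_normD _ _) _; rewrite !normrM (ger0_norm t0) (ger0_norm t1').
  have := ler_wpM2l t1' (a0r i x x1); have := ler_wpM2l t0 (a1r i x x1); lra.
- exact: small.
Qed.

End Deformation.

Section Sequences.
Context {R : realType}.

Lemma geometric_unbounded (b : nat -> R) B : 0 < b 0%N ->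
  (forall j, 3 / 2 * b j <= b j.+1) -> (forall j, b j <= B) -> False.
Proof.
move=> b0 hb hB.
have grow j : (1 + j%:R / 2) * b 0%N <= b j.
  elim: j => [|j IH]; first by rewrite mul0r addr0 mul1r.
  apply: le_trans (hb j); rewrite -natr1.
  have : 0 <= j%:R * b 0%N by rewrite mulr_ge0// ltW.
  move: IH; set x := j%:R * b 0%N.
  have -> : (1 + j%:R / 2) * b 0%N = b 0%N + x / 2 by rewrite /x; field.
  have -> : (1 + (j%:R + 1) / 2) * b 0%N = b 0%N + x / 2 + b 0%N / 2.
    by rewrite /x; field.
  lra.
have B0 : 0 <= B by apply: le_trans (ltW b0) (hB 0%N).
have B2 : 0 <= 2 * B / b 0%N by rewrite divr_ge0 ?mulr_ge0// ltW.
have := archi_boundP B2; set j := Num.bound _ => hj.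
have := le_trans (grow j) (hB j).
by move: hj; rewrite ltr_pdivrMr//; lra.
Qed.

Lemma le0_geometric (a M : R) n0 :
  (forall n, (n0 <= n)%N -> a <= M * 2^-1 ^+ n) -> a <= 0.
Proof.
move=> h; rewrite leNgt; apply/negP => a0.
apply: (@geometric_unbounded (fun j => a * 2 ^+ (n0 + j)) M).
- by rewrite mulr_gt0// exprn_gt0.
- move=> j; rewrite addnS exprS.
  have : 0 < a * 2 ^+ (n0 + j) by rewrite mulr_gt0// exprn_gt0.
  have -> : a * (2 * 2 ^+ (n0 + j)) = 2 * (a * 2 ^+ (n0 + j)) by ring.
  lra.
- move=> j; have := h (n0 + j)%N (leq_addr _ _).
  rewrite exprVn ler_pdivlMr ?exprn_gt0//.
Qed.

Lemma geometric_small (a M : R) : 0 < a -> exists n, M * 2^-1 ^+ n <= a.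
Proof.
move=> a0; apply: contrapT => h.
have := @le0_geometric a M 0; rewrite leNgt a0/= => /(_ _)/negP; case=> // n _.
by rewrite leNgt; apply/negP => /ltW hn; apply: h; exists n.
Qed.

Lemma geometric_cvgR (u : nat -> R) A :
  (forall n, `|u n.+1 - u n| <= A * 2^-1 ^+ n) ->
  exists l, forall n, `|l - u n| <= 2 * A * 2^-1 ^+ n.
Proof.
move=> h; pose e n : R := 2 * A * 2^-1 ^+ n.
have eS n : e n.+1 = e n / 2 by rewrite /e exprSr; field.
have hn n : `|u n.+1 - u n| <= e n / 2.
  by apply: le_trans (h n) _; rewrite /e le_eqVlt; apply/orP; left; apply/eqP; field.
have ai n k : u n - e n <= u (n + k)%N - e (n + k)%N.
  elim: k => [|k IH]; first by rewrite addn0.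
  apply: le_trans IH _; rewrite addnS eS.
  by have := hn (n + k)%N; rewrite ler_norml => /andP[]; lra.
have bi n k : u (n + k)%N + e (n + k)%N <= u n + e n.
  elim: k => [|k IH]; first by rewrite addn0.
  apply: le_trans _ IH; rewrite addnS eS.
  by have := hn (n + k)%N; rewrite ler_norml => /andP[]; lra.
have e0 n : 0 <= e n by have := le_trans (normr_ge0 _) (hn n); lra.
have ab n k : u n - e n <= u k + e k.
  have h1 := ai n k; have h2 := bi k n; rewrite addnC in h2.
  by have := e0 (n + k)%N; lra.
pose S := range (fun n => u n - e n).
have S0 : S !=set0 by exists (u 0%N - e 0%N); exists 0%N.
exists (sup S) => n; rewrite -/(e n).
have le1 : u n - e n <= sup S.
  apply: ub_le_sup; last by exists n.
  by exists (u 0%N + e 0%N) => _ [k _ <-].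
have le2 : sup S <= u n + e n by apply: ge_sup => // _ [k _ <-].
by apply: norm_le_intro; lra.
Qed.

Lemma geometric_cvg N (u : nat -> 'rV[R]_N) A :
  (forall n, nrm (u n.+1 - u n) <= A * 2^-1 ^+ n) ->
  exists l, forall n, nrm (l - u n) <= N%:R * (2 * A) * 2^-1 ^+ n.
Proof.
move=> h.
have ex i : exists l, forall n, `|l - u n 0 i| <= 2 * A * 2^-1 ^+ n.
  apply: geometric_cvgR => n; apply: le_trans (h n).
  by have := nrm_coord (u n.+1 - u n) i; rewrite !mxE.
have [l hl] := choice ex.
exists (\row_i l i) => n; rewrite -mulrA; apply: nrm_le_coord => i.
by rewrite !mxE.
Qed.

End Sequences.

Definition nrm_continuous_on {R : realType} n p (A : set 'rV[R]_n)
    (f : 'rV[R]_n -> 'rV[R]_p) :=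
  forall x, A x -> forall e, 0 < e -> exists2 d, 0 < d &
    forall y, A y -> nrm (x - y) < d -> nrm (f x - f y) < e.

Section LimitMap.
Context {R : realType} {N m : nat}.
Variables (K : 'I_m -> set 'rV[R]_N) (D c0 : R).
Hypotheses (c00 : 0 < c0) (c01 : c0 <= 1) (D0 : 0 <= D).
Hypothesis indep : forall q : 'I_m -> 'rV[R]_N, (forall i, K i (q i)) ->
  forall z : 'rV[R]_m, c0 * nrm z <= nrm (\sum_i z 0 i *: q i).
Hypothesis convK : forall i p q (t : R), K i p -> K i q -> 0 <= t <= 1 ->
  K i (p + t *: (q - p)).
Hypothesis cK : forall i, compact (K i).
Hypothesis K0 : forall i, K i !=set0.
Hypothesis KD : forall i q, K i q -> nrm q <= D.

Let c := c0 / 6.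
Let C := 2 + m%:R * (3 * D).
Let k1 := 4 * C / c ^+ 2.
Let k2 := 14 * C ^+ 2 / c ^+ 4.

Variable J : nat.
Let d := (8 * D + 1) / J%:R.
Let e1 := m%:R * ((6 * D + 1) / J%:R).
Hypothesis J0 : (0 < J)%N.
Hypothesis H1 : m%:R * d <= c0 / 4.
Hypothesis H2 : k1 * e1 <= 1 / 8.
Hypothesis H3 : k1 * (m%:R * (8 / J%:R)) <= 1.
Hypothesis H4 : k2 * (2 * (1 + m%:R * (8 / J%:R)) * e1) <= 1 / 8.

Let r n : R := 2^-1 ^+ n.
Let lin i x := dot (pmax (K i) 1 0) x.
Let f n i x := fsm (K i) J (r n) x.
Let a n i x := asm (K i) J (r n) x.

Definition lin_zeros : set 'rV[R]_N :=
  [set x | nrm x = 1 /\ forall i, dot (pmax (K i) 1 0) x = 0].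

Definition support_zeros : set 'rV[R]_N :=
  [set x | nrm x = 1 /\ forall i, hsup (K i) 0 x = 0].

Let T0 : 0 < J%:R :> R. Proof. by rewrite ltr0n. Qed.
Let r0 n : 0 < r n. Proof. by rewrite /r exprn_gt0. Qed.
Let rS n : r n.+1 = r n / 2. Proof. by rewrite /r exprSr. Qed.
Let r1 n : r n <= 1. Proof. by rewrite /r exprn_ile1// invf_le1// ler1n. Qed.
Let cc0 : 0 < c. Proof. by rewrite /c divr_gt0. Qed.
Let C0 : 0 < C.
Proof.
have : 0 <= m%:R * (3 * D) by rewrite !mulr_ge0.
by rewrite /C; lra.
Qed.
Let k10 : 0 <= k1.
Proof. by rewrite /k1 divr_ge0 ?exprn_ge0 ?(ltW cc0)// mulr_ge0// ltW. Qed.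
Let k20 : 0 <= k2.
Proof.
by rewrite /k2 divr_ge0 ?exprn_ge0 ?(ltW cc0)// mulr_ge0// exprn_ge0// ltW.
Qed.
Let m0 : 0 <= m%:R :> R. Proof. by []. Qed.
Let dd : 8 * D / J%:R <= d.
Proof. by rewrite /d ler_pM2r ?invr_gt0//; lra. Qed.
Let d2 : 2 * D / J%:R <= d.
Proof. by apply: le_trans dd; rewrite ler_pM2r ?invr_gt0//; move: D0; lra. Qed.
Let e6 : 6 * D / J%:R <= (6 * D + 1) / J%:R.
Proof. by rewrite ler_pM2r ?invr_gt0//; lra. Qed.
Let e60 : 0 <= 6 * D / J%:R.
Proof. by rewrite divr_ge0 ?mulr_ge0// ltW. Qed.
Let me6 : m%:R * (6 * D / J%:R) <= e1.
Proof. by rewrite /e1 ler_wpM2l. Qed.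
Let e10 : 0 <= e1.
Proof. by apply: le_trans me6; rewrite mulr_ge0. Qed.

Let lam n := 4 / (J%:R * r n).
Let lam0 n : 0 <= lam n.
Proof. by rewrite /lam divr_ge0// mulr_ge0// ltW. Qed.
Let lamS n : lam n <= lam n.+1.
Proof.
rewrite /lam ler_pM2l// lef_pV2 ?posrE ?mulr_gt0// ler_pM2l// rS.
by have := r0 n; lra.
Qed.

Let V := 3 * 2 ^+ J * D ^+ 2.
Let V0 : 0 <= V. Proof. by rewrite /V !mulr_ge0 ?exprn_ge0. Qed.
Let W := 4 * 2 ^+ J * D ^+ 2.
Let W0 : 0 <= W. Proof. by rewrite /W !mulr_ge0 ?exprn_ge0. Qed.

Let fc n i x y : `|f n i y - f n i x - dot (a n i x) (y - x)| <= lam n * nrm (y - x) ^+ 2.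
Proof. exact: (fsm_c11 (@cK i) (K0 i) (@convK i) (@KD i) J0 x y (r0 n)). Qed.

Let ac n i x y : nrm (a n i x - a n i y) <= lam n * nrm (x - y).
Proof. exact: (asm_lip (@cK i) (K0 i) (@convK i) (@KD i) J0 x y (r0 n)). Qed.

Let ab n i x : nrm (a n i x) <= 3 * D.
Proof. exact: (nrm_asm (@cK i) (K0 i) (@convK i) (@KD i) J0 (r n) x). Qed.

Let an n i x : exists2 q, K i q & nrm (a n i x - q) <= d.
Proof.
have [q Kq h] := asm_near (@cK i) (K0 i) (@convK i) (@KD i) J0 (r n) x.
by exists q => //; apply: le_trans d2.
Qed.

Let ar n i x : nrm x = 1 -> `|dot (a n i x) x - f n i x| <= 8 * D / J%:R.
Proof.
move=> x1; have := asm_radial (@cK i) (K0 i) (@KD i) J0 x (r0 n).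
by rewrite x1 mulr1.
Qed.

Let zeros n x := system (f n) x = 0.

Let step n : exists th : 'rV[R]_N -> 'rV[R]_N,
  [/\ (forall x, zeros n x -> zeros n.+1 (th x)) /\
      (forall y, zeros n.+1 y -> exists2 x, zeros n x & th x = y) /\
      (forall x y, zeros n x -> zeros n y -> th x = th y -> x = y),
      exists Lam, forall x y, zeros n x -> zeros n y ->
        nrm (th x - th y) <= Lam * nrm (x - y),
      forall x, zeros n x ->
        nrm (th x - x) <= k1 * nrm (system (f n) x - system (f n.+1) x)
    & forall x y, zeros n x -> zeros n y ->
      (1 - k2 * (m%:R * (6 * D / J%:R) + 2 * (1 + m%:R * lam n.+1) *
        nrm (system (f n) x - system (f n.+1) x))) * nrm (x - y)
      <= nrm (th x - th y)].
Proof.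
apply: (@deform R N m K D c0 c00 c01 D0 indep convK (f n) (f n.+1) (a n) (a n.+1)
  (lam n.+1) d (6 * D / J%:R) W).
- exact: lam0.
- exact: e60.
- exact: W0.
- exact: H1.
- apply: le_trans (ler_wpM2l k10 me6) _; move: H2; lra.
- by move=> i x y; apply: le_trans (fc n i x y) _; rewrite ler_wpM2r ?sqr_ge0.
- by move=> i x y; apply: le_trans (ac n i x y) _; rewrite ler_wpM2r.
- by move=> i x y; exact: fc.
- by move=> i x y; exact: ac.
- by move=> i x; exact: ab.
- by move=> i x; exact: ab.
- by move=> i x; exact: an.
- by move=> i x; exact: an.
- by move=> i x x1; apply: le_trans dd; exact: ar.
- by move=> i x x1; apply: le_trans dd; exact: ar.
- move=> i x _; rewrite /a rS.
  exact: (asm_half (@cK i) (K0 i) (@KD i) J0 (r n) x).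
- move=> i x y _ _; rewrite /f rS.
  exact: (fsm_half_lip (@cK i) (K0 i) (@KD i) J0 (r n) x y).
- move=> i x _; rewrite /f rS.
  apply: le_trans (fsm_half_bound (@cK i) (K0 i) (@KD i) J0 x (r0 n)) _.
  by rewrite -/W ler_piMr.
Qed.

Let init : exists th : 'rV[R]_N -> 'rV[R]_N,
  [/\ (forall x, lin_zeros x -> zeros 0 (th x)) ,
      (forall y, zeros 0 y -> exists2 x, lin_zeros x & th x = y) ,
      (forall x y, lin_zeros x -> lin_zeros y -> th x = th y -> x = y)
    & exists Lam, forall x y, lin_zeros x -> lin_zeros y ->
        nrm (th x - th y) <= Lam * nrm (x - y)].
Proof.
have linE x : lin_zeros x <-> system lin x = 0 by exact: iff_sym (system_eq0 lin x).
have r01 : r 0 = 1 by rewrite /r expr0.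
have mq i : K i (pmax (K i) 1 0) by exact: (pmax_mem (@cK i) (K0 i) (@KD i)).
have [] := @deform R N m K D c0 c00 c01 D0 indep convK lin (f 0)
  (fun i _ => pmax (K i) 1 0) (a 0)
  (lam 0) d (8 / J%:R) (8 / J%:R * 2).
- exact: lam0.
- by rewrite divr_ge0// ltW.
- by rewrite !mulr_ge0// invr_ge0 ltW.
- exact: H1.
- exact: H3.
- move=> i x y; rewrite /lin -dotBr subrr normr0 mulr_ge0//; exact: sqr_ge0.
- by move=> i x y; rewrite subrr nrm0 mulr_ge0.
- by move=> i x y; exact: fc.
- by move=> i x y; exact: ac.
- by move=> i x; have := KD (mq i); move: D0; lra.
- by move=> i x; exact: ab.
- move=> i x; exists (pmax (K i) 1 0) => //; rewrite subrr nrm0.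
  by rewrite /d divr_ge0 ?(ltW T0)//; move: D0; lra.
- by move=> i x; exact: an.
- move=> i x x1; rewrite /lin subrr normr0.
  by rewrite /d divr_ge0 ?(ltW T0)//; move: D0; lra.
- by move=> i x x1; apply: le_trans dd; exact: ar.
- move=> i x x2; rewrite nrmBC /a r01.
  exact: (asm_linear (@cK i) (K0 i) (@convK i) (@KD i) J0 x2).
- move=> i x y x2 y2; rewrite /lin /f r01.
  have := fsm_linear_lip (@cK i) (K0 i) (@convK i) (@KD i) J0 x2 y2.
  by rewrite -normrN; congr (`|_| <= _); ring.
- move=> i x x2; rewrite /lin /f r01.
  have z2 : nrm (0 : 'rV[R]_N) <= 2 by rewrite nrm0.
  have := fsm_linear_lip (@cK i) (K0 i) (@convK i) (@KD i) J0 x2 z2.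
  rewrite dot0r (fsm_at0 (@cK i) (K0 i) (@KD i))// !subr0 -normrN opprB => h.
  by apply: le_trans h _; rewrite ler_wpM2l// divr_ge0// ltW.
move=> th [[t1 [t2 t3]] [Lam tL] _ _].
exists th; split.
- by move=> x /linE /t1.
- by move=> y /t2[x /linE zx <-]; exists x.
- by move=> x y /linE zx /linE zy; exact: t3.
- by exists Lam => x y /linE zx /linE zy; exact: tL.
Qed.

Let E n x := system (f n) x - system (f n.+1) x.

Let E_le n x : nrm (E n x) <= m%:R * W * r n.
Proof.
rewrite -mulrA; apply: system_diff_le => i; rewrite /f rS.
exact: (fsm_half_bound (@cK i) (K0 i) (@KD i) J0 x (r0 n)).
Qed.

Let chain_maps : exists X : nat -> 'rV[R]_N -> 'rV[R]_N,
  [/\ forall n x, lin_zeros x -> zeros n (X n x),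
      forall n y, zeros n y -> exists2 x, lin_zeros x & X n x = y,
      forall n x y, lin_zeros x -> lin_zeros y -> X n x = X n y -> x = y
    & forall n, exists Lam, forall x y, lin_zeros x -> lin_zeros y ->
        nrm (X n x - X n y) <= Lam * nrm (x - y)] /\
  [/\ forall n x, lin_zeros x -> nrm (X n.+1 x - X n x) <= k1 * nrm (E n (X n x))
    & forall n x y, lin_zeros x -> lin_zeros y ->
      (1 - k2 * (m%:R * (6 * D / J%:R) + 2 * (1 + m%:R * lam n.+1) *
        nrm (E n (X n x)))) * nrm (X n x - X n y)
      <= nrm (X n.+1 x - X n.+1 y)].
Proof.
have [tau htau] := choice step; have [th0 [i1 i2 i3 i4]] := init.
pose X := fix X n := if n is n'.+1 then tau n' \o X n' else th0.
have X1 n x : lin_zeros x -> zeros n (X n x).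
  elim: n => [|n IH] zx /=; first exact: i1.
  by have [[t1 _] _ _ _] := htau n; exact/t1/IH.
exists X; split; split => //.
- elim=> [|n IH] y zy /=; first exact: i2.
  have [[_ [t2 _]] _ _ _] := htau n; have [w zw <-] := t2 _ zy.
  by have [x zx <-] := IH _ zw; exists x.
- elim=> [|n IH] x y zx zy /=; first exact: i3.
  have [[_ [_ t3]] _ _ _] := htau n => e; apply: IH => //.
  by apply: t3 => //; exact: X1.
- elim=> [|n [Lam IH]] /=; first exact: i4.
  have [_ [Lam' t4] _ _] := htau n; exists (`|Lam'| * Lam) => x y zx zy.
  apply: le_trans (t4 _ _ (X1 _ _ zx) (X1 _ _ zy)) _.
  rewrite -mulrA; apply: le_trans (ler_wpM2l _ (IH _ _ zx zy)) => //.
  by apply: ler_wpM2r => //; exact: ler_norm.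
- by move=> n x zx; have [_ _ t5 _] := htau n; exact/t5/X1.
- by move=> n x y zx zy; have [_ _ _ t6] := htau n; apply: t6; exact: X1.
Qed.

Let E_blowup z : exists n0, forall n, (n0 <= n)%N -> forall u,
  nrm (E n u) <= m%:R * (6 * D / J%:R * nrm (u - z) + r n / J%:R).
Proof.
have Ji : 0 < J%:R^-1 :> R by rewrite invr_gt0.
have ex i := fsm_blowup (@cK i) (K0 i) (@KD i) J0 z Ji.
have [k hk] := choice ex.
exists (\max_i k i) => n hn u; apply: system_diff_le => i.
have := fsm_half_lip (@cK i) (K0 i) (@KD i) J0 (r n) u z.
have := hk i n (leq_trans (leq_bigmax i) hn); rewrite -/(r n) -rS -!/(f _ _ _).
rewrite [J%:R^-1 * _]mulrC; set A := f n i u - _; set B := f n i z - _ => hB hA.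
by rewrite -(subrK B A); apply: le_trans (ler_normD _ _) _; exact: lerD.
Qed.

Let E_ray z n u : r n <= nrm (u - z) ->
  nrm (E n u) <= m%:R * (6 * D / J%:R * nrm (u - z) + r n / J%:R) ->
  nrm (E n u) <= e1 * nrm (u - z).
Proof.
move=> h /le_trans; apply; rewrite /e1 -[leRHS]mulrA; apply: ler_wpM2l => //.
have : r n / J%:R <= nrm (u - z) / J%:R by rewrite ler_pM2r ?invr_gt0.
have -> : (6 * D + 1) / J%:R * nrm (u - z) =
    6 * D / J%:R * nrm (u - z) + nrm (u - z) / J%:R by field; rewrite gt_eqF.
lra.
Qed.

Let E_core z n u : nrm (u - z) <= r n ->
  nrm (E n u) <= m%:R * (6 * D / J%:R * nrm (u - z) + r n / J%:R) ->
  nrm (E n u) <= e1 * r n.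
Proof.
move=> h /le_trans; apply; rewrite /e1 -[leRHS]mulrA; apply: ler_wpM2l => //.
have : 6 * D / J%:R * nrm (u - z) <= 6 * D / J%:R * r n by apply: ler_wpM2l.
have -> : (6 * D + 1) / J%:R * r n = 6 * D / J%:R * r n + r n / J%:R.
  by field; rewrite gt_eqF.
lra.
Qed.

Lemma compact_lin_zeros : compact lin_zeros.
Proof.
rewrite (_ : lin_zeros = [set x | nrm x = 1] `&`
    \bigcap_i [set x | dot (pmax (K i) 1 0) x = 0]); last first.
  by apply/seteqP; split=> x [x1 h]; split=> // i; [move=> _|]; exact: h.
apply: compact_closedI; first exact: compact_unit_sphere.
apply: closed_bigI => i _; rewrite (_ : mkset _ = dot (pmax (K i) 1 0) @^-1` [set 0])//.
by apply: preimage_closed; [move=> x _; exact: continuous_dot|exact: closed_eq].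
Qed.

(* Psi is the limit of the maps X n obtained by deforming the zeros of the linear
   system to those at scale 1, then successively at scales 2^-1, 2^-2, etc. *)
Lemma limit_map : exists Psi : 'rV[R]_N -> 'rV[R]_N,
  [/\ forall x, lin_zeros x -> support_zeros (Psi x),
      forall y, support_zeros y -> exists2 x, lin_zeros x & Psi x = y,
      forall x y, lin_zeros x -> lin_zeros y -> Psi x = Psi y -> x = y
    & nrm_continuous_on lin_zeros Psi].
Proof.
have [X [[X1 X2 X3 X4] [X5 X6]]] := chain_maps.
pose A := k1 * (m%:R * W).
have A0 : 0 <= A by exact: mulr_ge0 k10 (mulr_ge0 m0 W0).
pose B := N%:R * (2 * A).
have B0 : 0 <= B by rewrite /B mulr_ge0// mulr_ge0.
have ex x : exists l, lin_zeros x -> forall n, nrm (l - X n x) <= B * r n.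
  have [zx|] := pselect (lin_zeros x); last by exists 0.
  have [n|l hl] := @geometric_cvg R N (fun n => X n x) A; last by exists l.
  apply: le_trans (X5 n x zx) _; rewrite /A -[leRHS]mulrA; apply: (ler_wpM2l k10).
  exact: E_le.
have [Psi hPsi] := choice ex.
have norm1 n x : lin_zeros x -> nrm (X n x) = 1.
  by move=> /(X1 n)/system_eq0[].
have cont x : lin_zeros x -> forall e, 0 < e -> exists2 del, 0 < del &
    forall y, lin_zeros y -> nrm (x - y) < del -> nrm (Psi x - Psi y) < e.
  move=> zx e e0; have e3 : 0 < e / 3 by rewrite divr_gt0.
  have [n hn] := geometric_small B e3; have [Lam hL] := X4 n.
  have L1 : 0 < 3 * (`|Lam| + 1) by rewrite mulr_gt0// ltr_pwDr.
  exists (e / (3 * (`|Lam| + 1))); first exact: divr_gt0.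
  move=> y zy; rewrite ltr_pdivlMr// => hxy.
  have h1 := le_trans (hPsi x zx n) hn; have h2 := le_trans (hPsi y zy n) hn.
  have h3 : nrm (X n x - X n y) < e / 3.
    apply: le_lt_trans (hL _ _ zx zy) _.
    have : Lam * nrm (x - y) <= `|Lam| * nrm (x - y).
      by apply: ler_wpM2r => //; exact: ler_norm.
    by have := nrm_ge0 (x - y); move: hxy; lra.
  have -> : Psi x - Psi y = Psi x - X n x + (X n x - X n y) - (Psi y - X n y).
    by rewrite opprB addrA addrA subrK subrK.
  apply: le_lt_trans (nrmB _ _) _.
  by have := nrmD (Psi x - X n x) (X n x - X n y); move: h1 h2 h3; lra.
exists Psi; split.
- move=> x zx; split.
    have n1 : nrm (Psi x) <= 1.
      rewrite -subr_le0; apply: (@le0_geometric R _ B 0%N) => n _.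
      apply: le_trans (hPsi x zx n); rewrite -(norm1 n x zx).
      by have := nrm_dist (Psi x) (X n x); exact: le_trans (ler_norm _).
    apply/eqP; rewrite eq_le n1/= -subr_le0.
    apply: (@le0_geometric R _ B 0%N) => n _.
    apply: le_trans (hPsi x zx n); rewrite -(norm1 n x zx) nrmBC.
    by have := nrm_dist (X n x) (Psi x); exact: le_trans (ler_norm _).
  move=> i; apply/normr0_eq0/eqP; rewrite eq_le normr_ge0 andbT.
  apply: (@le0_geometric R _ (D * B + V) 0%N) => n _; rewrite -/(r n).
  have := X1 n x zx => /system_eq0[_ /(_ i) fx].
  have := fsm_limit_bound (@cK i) (K0 i) (@KD i) J0 (X n x) (r0 n).
  rewrite -/(f n i _) fx sub0r normrN -!gsup0 => h1.
  have := gsup_lip (@cK i) (K0 i) (@KD i) 0 (Psi x) (X n x) => h2.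
  have h3 := ler_wpM2l D0 (hPsi x zx n).
  rewrite -(subrK (gsup (K i) 0 (X n x)) (gsup (K i) 0 (Psi x))).
  apply: le_trans (ler_normD _ _) _; rewrite mulrDl -mulrA.
  by apply: lerD => //; exact: le_trans h2 h3.
- move=> z [z1 hz].
  have Ji : 0 < J%:R^-1 :> R by rewrite invr_gt0.
  have [n1 hn1] := geometric_small V Ji.
  have near n : (n1 <= n)%N -> exists2 x, lin_zeros x &
      nrm (Psi x - z) <= (B + k1 * (m%:R * V)) * r n.
    move=> hn.
    have Vr : V * r n <= J%:R^-1.
      apply: le_trans hn1; apply: ler_wpM2l => //.
      by apply: ler_wiXn2l; rewrite ?invr_ge0// invf_le1// ler1n.
    have fz i : `|f n i z| <= V * r n.
      have := fsm_limit_bound (@cK i) (K0 i) (@KD i) J0 z (r0 n).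
      by rewrite hz subr0.
    have dV : 8 * D / J%:R + V * r n <= d by rewrite /d [leRHS]mulrDl mul1r lerD2l.
    (* Shifted by its value at z, the system at scale r n vanishes at z. *)
    have [] := @deform R N m K D c0 c00 c01 D0 indep convK
      (fun i x => f n i x - f n i z) (f n) (a n) (a n) (lam n) d 0 (V * r n).
    + exact: lam0.
    + by [].
    + by rewrite mulr_ge0// ltW.
    + exact: H1.
    + by rewrite !mulr0.
    + move=> i x y; have -> : f n i y - f n i z - (f n i x - f n i z) =
        f n i y - f n i x by ring.
      exact: fc.
    + by move=> i x y; exact: ac.
    + by move=> i x y; exact: fc.
    + by move=> i x y; exact: ac.
    + by move=> i x; exact: ab.
    + by move=> i x; exact: ab.
    + by move=> i x; exact: an.
    + by move=> i x; exact: an.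
    + move=> i x x1; apply: le_trans dV.
      have -> : dot (a n i x) x - (f n i x - f n i z) =
          dot (a n i x) x - f n i x + f n i z by ring.
      by apply: le_trans (ler_normD _ _) _; apply: lerD => //; exact: ar.
    + by move=> i x x1; apply: le_trans dd; exact: ar.
    + by move=> i x _; rewrite subrr nrm0.
    + move=> i x y _ _; rewrite mul0r.
      have -> : f n i x - f n i z - f n i x - (f n i y - f n i z - f n i y) = 0 by ring.
      by rewrite normr0.
    + by move=> i x _; rewrite addrAC subrr sub0r normrN.
    move=> th [[t1 _] _ t2 _].
    have zz : system (fun i x => f n i x - f n i z) z = 0.
      by apply/system_eq0; split=> // i; rewrite subrr.
    have [x zx Xx] := X2 n _ (t1 _ zz).
    exists x => //; have := t2 _ zz; rewrite -Xx => h1.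
    have h2 : nrm (system (fun i x => f n i x - f n i z) z - system (f n) z)
        <= m%:R * (V * r n).
      by apply: system_diff_le => i; rewrite subrr sub0r normrN.
    have h3 := ler_wpM2l k10 h2; have h4 := hPsi x zx n.
    rewrite -(subrK (X n x) (Psi x)) -addrA.
    apply: le_trans (nrmD _ _) _; rewrite mulrDl; apply: lerD => //.
    have -> : k1 * (m%:R * V) * r n = k1 * (m%:R * (V * r n)) by ring.
    exact: le_trans h1 h3.
  have [x0 zx0 _] := near n1 (leqnn _).
  have [||x] := EVT_min_rV (f := fun x => nrm (Psi x - z)) _ compact_lin_zeros.
  + by exists x0.
  + apply: within_continuousR_nrm => x zx e e0.
    have [del del0 hdel] := cont x zx e e0; exists del => // y zy xy.
    apply: le_lt_trans (hdel y zy xy); apply: le_trans (nrm_dist _ _) _.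
    by have -> : Psi x - z - (Psi y - z) = Psi x - Psi y by rewrite opprB addrA subrK.
  rewrite inE => zx xmin; exists x => //.
  apply/eqP; rewrite -subr_eq0 -nrm_eq0 eq_le nrm_ge0 andbT.
  apply: (@le0_geometric R _ (B + k1 * (m%:R * V)) n1) => n hn.
  by have [y zy] := near n hn; apply: le_trans; apply: xmin; rewrite inE.
- move=> x y zx zy exy; have [n0 hn0] := E_blowup (Psi x).
  (* Seen from z = Psi x, the systems are asymptotically homogeneous at scale r n:
     X n w cannot be farther than r n from z, for the ratio would then grow
     geometrically whereas it is bounded by B. The same growth applies to the
     distance between X n x and X n y. *)
  have close w : lin_zeros w -> Psi w = Psi x -> forall n, (n0 <= n)%N ->
      nrm (X n w - Psi x) <= r n.
    move=> zw ew n hn; rewrite leNgt; apply/negP => big.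
    pose xi j := nrm (X (n + j)%N w - Psi x).
    have nn j : (n0 <= n + j)%N by rewrite (leq_trans hn)// leq_addr.
    have grow j : r (n + j)%N < xi j -> 7 / 8 * xi j <= xi j.+1.
      move=> bigj; have h1 := X5 (n + j)%N w zw.
      have h2 := ler_wpM2l k10 (E_ray (ltW bigj) (hn0 _ (nn j) _)).
      have h3 : k1 * (e1 * xi j) <= 1 / 8 * xi j.
        by rewrite mulrA; apply: ler_wpM2r => //; exact: nrm_ge0.
      have h4 : xi j <= nrm (X (n + j).+1 w - X (n + j)%N w) + xi j.+1.
        rewrite /xi addnS [X in _ <= X + _]nrmBC; exact: nrmBD.
      by move: h1 h2 h3 h4; rewrite -/(xi j); lra.
    have always j : r (n + j)%N < xi j.
      elim: j => [|j IH]; first by rewrite /xi addn0.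
      have := grow j IH; rewrite addnS rS; have := r0 (n + j)%N; lra.
    apply: (@geometric_unbounded R (fun j => xi j / r (n + j)%N) B).
    + by rewrite divr_gt0// (lt_trans _ (always _)).
    + move=> j; have := grow j (always j); rewrite addnS rS.
      have rj := r0 (n + j)%N; have := always j; set q := r _ in rj *.
      move=> hq hg; rewrite invf_div !mulrA ler_pM2r ?invr_gt0//; lra.
    + move=> j; rewrite ler_pdivrMr// /xi -ew nrmBC; exact: hPsi.
  pose del n := nrm (X n x - X n y).
  have grow n : (n0 <= n)%N -> 3 / 4 * del n <= del n.+1.
    move=> hn; apply: le_trans (X6 n x y zx zy); apply: ler_wpM2r; first exact: nrm_ge0.
    have h1 := E_core (close x zx erefl n hn) (hn0 n hn _).
    pose P : R := m%:R * (8 / J%:R).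
    have P0 : 0 <= P by rewrite mulr_ge0// divr_ge0// ltW.
    have h2 : 2 * (1 + m%:R * lam n.+1) * nrm (E n (X n x)) <= 2 * (1 + P) * e1.
      have -> : 1 + m%:R * lam n.+1 = 1 + P / r n.
        by rewrite /lam /P rS; field; rewrite !gt_eqF.
      have h0 : 0 <= 2 * (1 + P / r n).
        by rewrite mulr_ge0// addr_ge0// divr_ge0// ltW.
      apply: le_trans (ler_wpM2l h0 h1) _.
      have -> : 2 * (1 + P / r n) * (e1 * r n) = 2 * (r n + P) * e1.
        by field; rewrite gt_eqF.
      by apply: ler_wpM2r => //; rewrite ler_pM2l// lerD2r.
    have h3 : m%:R * (6 * D / J%:R) <= 2 * (1 + P) * e1.
      by apply: le_trans me6 _; rewrite ler_peMl//; move: P0; clearbody P; lra.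
    have h4 := ler_wpM2l k20 (lerD h3 h2); rewrite [leRHS]mulrDr in h4.
    rewrite (_ : 3 / 4 = 1 - 1 / 4); last by field.
    rewrite lerD2l lerN2; apply: le_trans h4 _.
    by apply: le_trans (lerD H4 H4) _; lra.
  apply: (X3 n0) => //; apply/eqP; rewrite -subr_eq0 -nrm_eq0 eq_le nrm_ge0 andbT.
  rewrite leNgt; apply/negP => big.
  apply: (@geometric_unbounded R (fun j => del (n0 + j)%N / r (n0 + j)%N) 2).
  + by rewrite addn0 divr_gt0.
  + move=> j; have := grow (n0 + j)%N (leq_addr _ _); rewrite addnS rS.
    have rj := r0 (n0 + j)%N; set q := r _ in rj *; set u := del _; set v := del _.
    by move=> hg; rewrite invf_div !mulrA ler_pM2r ?invr_gt0//; lra.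
  + move=> j; rewrite ler_pdivrMr//.
    have h1 := close x zx erefl (n0 + j)%N (leq_addr _ _).
    have h2 := close y zy (esym exy) (n0 + j)%N (leq_addr _ _).
    have := nrmBD (X (n0 + j)%N x) (Psi x) (X (n0 + j)%N y).
    by rewrite /del [nrm (Psi x - _)]nrmBC; lra.
- exact: cont.
Qed.

End LimitMap.

Section Parametrization.
Context {R : realType} {N m : nat}.
Variables (K : 'I_m -> set 'rV[R]_N) (D c0 : R).
Hypotheses (c00 : 0 < c0) (c01 : c0 <= 1) (D0 : 0 <= D).
Hypothesis indep : forall q : 'I_m -> 'rV[R]_N, (forall i, K i (q i)) ->
  forall z : 'rV[R]_m, c0 * nrm z <= nrm (\sum_i z 0 i *: q i).
Hypothesis convK : forall i p q (t : R), K i p -> K i q -> 0 <= t <= 1 ->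
  K i (p + t *: (q - p)).
Hypothesis cK : forall i, compact (K i).
Hypothesis K0 : forall i, K i !=set0.
Hypothesis KD : forall i q, K i q -> nrm q <= D.

Lemma support_zeros_param : exists Psi : 'rV[R]_N -> 'rV[R]_N,
  [/\ forall x, lin_zeros K x -> support_zeros K (Psi x),
      forall y, support_zeros K y -> exists2 x, lin_zeros K x & Psi x = y,
      forall x y, lin_zeros K x -> lin_zeros K y -> Psi x = Psi y -> x = y
    & nrm_continuous_on (lin_zeros K) Psi].
Proof.
pose M : R := m%:R; have M0 : 0 <= M by [].
pose c := c0 / 6; pose C := 2 + M * (3 * D).
pose k1 := 4 * C / c ^+ 2; pose k2 := 14 * C ^+ 2 / c ^+ 4.
have cc0 : 0 < c by rewrite divr_gt0.
have C0 : 0 <= C by rewrite addr_ge0// !mulr_ge0.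
have k10 : 0 <= k1 by rewrite divr_ge0 ?exprn_ge0 ?(ltW cc0)// mulr_ge0.
have k20 : 0 <= k2 by rewrite divr_ge0 ?exprn_ge0 ?(ltW cc0)// mulr_ge0// exprn_ge0.
have D8 : 0 <= 8 * D + 1 by rewrite addr_ge0// mulr_ge0.
have D6 : 0 <= 6 * D + 1 by rewrite addr_ge0// mulr_ge0.
pose s1 := M * (8 * D + 1) * 4 / c0; pose s2 := 8 * k1 * M * (6 * D + 1).
pose s3 := 8 * M * k1; pose s4 := 8 * M; pose s5 := 32 * k2 * M * (6 * D + 1).
have s10 : 0 <= s1 by rewrite divr_ge0 ?(ltW c00)// !mulr_ge0.
have s20 : 0 <= s2 by rewrite (mulr_ge0 (mulr_ge0 (mulr_ge0 _ k10) M0) D6).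
have s30 : 0 <= s3 by rewrite (mulr_ge0 (mulr_ge0 _ M0) k10).
have s40 : 0 <= s4 by rewrite !mulr_ge0.
have s50 : 0 <= s5 by rewrite (mulr_ge0 (mulr_ge0 (mulr_ge0 _ k20) M0) D6).
pose s := s1 + s2 + s3 + s4 + s5.
have s0 : 0 <= s by rewrite !addr_ge0.
have sJ := archi_boundP s0; set J := Num.bound s in sJ.
have J0 : 0 < J%:R :> R by apply: le_lt_trans sJ.
have small a : a <= s -> a / J%:R <= 1.
  by move=> h; rewrite ler_pdivrMr// mul1r; apply: le_trans h (ltW sJ).
have q1 : s1 / J%:R <= 1 by apply: small; rewrite /s; lra.
have q2 : s2 / J%:R <= 1 by apply: small; rewrite /s; lra.
have q3 : s3 / J%:R <= 1 by apply: small; rewrite /s; lra.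
have q4 : s4 / J%:R <= 1 by apply: small; rewrite /s; lra.
have q5 : s5 / J%:R <= 1 by apply: small; rewrite /s; lra.
have Jn : J%:R != 0 :> R by rewrite gt_eqF.
have cn : c0 != 0 by rewrite gt_eqF.
apply: (@limit_map R N m K D c0 c00 c01 D0 indep convK cK K0 KD J).
- by move: J0; rewrite ltr0n.
- rewrite -/M (_ : _ * _ = s1 / J%:R * (c0 / 4)); last by rewrite /s1; field; rewrite cn Jn.
  by rewrite ler_piMl// divr_ge0// ltW.
- rewrite -/M -/c -/C -/k1 (_ : _ * _ = s2 / J%:R / 8); first by lra.
  by rewrite /s2; field.
- rewrite -/M -/c -/C -/k1 (_ : _ * _ = s3 / J%:R)//.
  by rewrite /s3; field.
- rewrite -/M -/c -/C -/k2.
  have q6 : M * (8 / J%:R) <= 1 by rewrite (_ : _ * _ = s4 / J%:R)// /s4; field.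
  have e0 : 0 <= k2 * (M * ((6 * D + 1) / J%:R)).
    by rewrite (mulr_ge0 k20)// mulr_ge0// divr_ge0// ltW.
  have -> : k2 * (2 * (1 + M * (8 / J%:R)) * (M * ((6 * D + 1) / J%:R))) =
    (1 + M * (8 / J%:R)) * (2 * (k2 * (M * ((6 * D + 1) / J%:R)))) by ring.
  apply: le_trans (_ : 2 * (2 * (k2 * (M * ((6 * D + 1) / J%:R)))) <= _).
    by apply: ler_wpM2r; [rewrite mulr_ge0|move: q6; lra].
  rewrite (_ : 2 * _ = s5 / J%:R / 8); first by lra.
  by rewrite /s5; field.
Qed.

End Parametrization.

Section LinearSphere.
Context {R : realType}.

Lemma nrm_mulmx k n (v : 'rV[R]_k) (M : 'M[R]_(k, n)) :
  nrm (v *m M) <= (\sum_i nrm (row i M)) * nrm v.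
Proof.
rewrite mulmx_sum_row mulr_suml; apply: le_trans (nrm_sum _ _ _) _.
apply: ler_sum => i _; rewrite nrmZ mulrC.
by apply: ler_wpM2l => //; exact: nrm_coord.
Qed.

Lemma nrm_normalize n (x y : 'rV[R]_n) : x != 0 -> y != 0 ->
  nrm ((nrm x)^-1 *: x - (nrm y)^-1 *: y) <= 2 / nrm x * nrm (x - y).
Proof.
move=> x0 y0; have nx : 0 < nrm x by rewrite nrm_gt0.
have ny : 0 < nrm y by rewrite nrm_gt0.
have -> : (nrm x)^-1 *: x - (nrm y)^-1 *: y =
    (nrm x)^-1 *: (x - y) + ((nrm x)^-1 - (nrm y)^-1) *: y.
  by rewrite scalerBr scalerBl addrA subrK.
apply: le_trans (nrmD _ _) _; rewrite !nrmZ (gtr0_norm (_ : 0 < (nrm x)^-1)) ?invr_gt0//.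
have -> : `|(nrm x)^-1 - (nrm y)^-1| * nrm y = `|nrm y - nrm x| / nrm x.
  have -> : (nrm x)^-1 - (nrm y)^-1 = (nrm y - nrm x) / nrm x / nrm y.
    by field; rewrite !gt_eqF.
  rewrite !normrM (gtr0_norm (_ : 0 < (nrm x)^-1)) ?invr_gt0//.
  by rewrite (gtr0_norm (_ : 0 < (nrm y)^-1)) ?invr_gt0// divfK// gt_eqF.
have -> : 2 / nrm x * nrm (x - y) =
  (nrm x)^-1 * nrm (x - y) + nrm (x - y) / nrm x by ring.
by rewrite lerD2l ler_pM2r ?invr_gt0// nrmBC nrm_dist.
Qed.

Lemma kernel_basis m N k (P : 'M[R]_(m, N)) : N = (m + k)%N -> row_free P ->
  exists M : 'M[R]_(k, N), row_free M /\
    forall x : 'rV[R]_N, P *m x^T = 0 <-> exists w, x = w *m M.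
Proof.
move=> Nmk fP; pose B := kermx P^T.
have : \rank B = k.
  by rewrite mxrank_ker mxrank_tr (eqP fP) Nmk addKn.
move: (k) => r <-; exists (row_base B); split; first exact: row_base_free.
move=> x; have -> : (P *m x^T = 0) <-> (x <= B)%MS.
  rewrite -[P]trmxK -trmx_mul; split => [/(congr1 trmx)|/sub_kermxP ->].
    by rewrite trmxK trmx0 => /sub_kermxP.
  by rewrite trmx0.
by rewrite -(eq_row_base B); split => [/submxP|h]; last exact/submxP.
Qed.

Lemma linear_sphere m N k (p : 'I_m -> 'rV[R]_N) c0 : N = (m + k.+1)%N -> 0 < c0 ->
  (forall z : 'rV[R]_m, c0 * nrm z <= nrm (\sum_i z 0 i *: p i)) ->
  let Z := [set x | nrm x = 1 /\ forall i, dot (p i) x = 0] in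
  exists phi : 'rV[R]_k.+1 -> 'rV[R]_N,
  [/\ forall v, nrm v = 1 -> Z (phi v),
      forall x, Z x -> exists2 v, nrm v = 1 & phi v = x,
      forall v w, nrm v = 1 -> nrm w = 1 -> phi v = phi w -> v = w
    & nrm_continuous_on [set v | nrm v = 1] phi].
Proof.
move=> Nmk c00 hc Z; pose P := \matrix_i p i.
have fP : row_free P.
  apply/inj_row_free => z zP; apply/eqP; rewrite -nrm_eq0 eq_le nrm_ge0 andbT.
  rewrite -(pmulr_rle0 _ c00); apply: le_trans (hc z) _.
  have -> : \sum_i z 0 i *: p i = 0.
    by rewrite -[RHS]zP mulmx_sum_row; apply: eq_bigr => i _; rewrite rowK.
  by rewrite nrm0.
have [M [fM kM]] := kernel_basis Nmk fP.
have PE (x : 'rV[R]_N) : (forall i, dot (p i) x = 0) <-> exists w, x = w *m M.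
  rewrite -kM; split => [h|h i].
    apply/colP => i; rewrite !mxE -[RHS](h i).
    by apply: eq_bigr => j _; rewrite !mxE.
  have := congr1 (fun A : 'cV_m => A i 0) h; rewrite !mxE => <-.
  by apply: eq_bigr => j _; rewrite !mxE.
have M0 w : (w *m M == 0) = (w == 0).
  by apply/eqP/eqP => [|->]; rewrite ?mul0mx// -(mul0mx _ M) => /(row_free_inj fM).
have unit0 n (v : 'rV[R]_n) : nrm v = 1 -> v != 0.
  by move=> v1; rewrite -nrm_eq0 v1 oner_eq0.
exists (fun v => (nrm (v *m M))^-1 *: (v *m M)); split.
- move=> v v1; have vM : 0 < nrm (v *m M) by rewrite nrm_gt0 M0 unit0.
  split; first by rewrite nrmZ gtr0_norm ?invr_gt0// mulVf// gt_eqF.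
  by apply/PE; exists ((nrm (v *m M))^-1 *: v); rewrite scalemxAl.
- move=> x [x1 /PE[w xw]].
  have w0 : w != 0 by rewrite -M0 -xw unit0.
  have nw : 0 < nrm w by rewrite nrm_gt0.
  exists ((nrm w)^-1 *: w).
    by rewrite nrmZ gtr0_norm ?invr_gt0// mulVf// gt_eqF.
  rewrite -scalemxAl -xw nrmZ x1 mulr1 gtr0_norm ?invr_gt0// invrK.
  by rewrite scalerA divff ?scale1r// gt_eqF.
- move=> v w v1 w1; rewrite !scalemxAl => /(row_free_inj fM) e.
  have nv : 0 < (nrm (v *m M))^-1 by rewrite invr_gt0 nrm_gt0 M0 unit0.
  have nw : 0 < (nrm (w *m M))^-1 by rewrite invr_gt0 nrm_gt0 M0 unit0.
  have := congr1 (@nrm R _) e; rewrite !nrmZ v1 w1 !mulr1 !gtr0_norm// => en.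
  by move: e; rewrite en => /scalerI; apply; rewrite gt_eqF.
- move=> v v1 e e0; pose L := \sum_i nrm (row i M).
  have L0 : 0 <= L by apply: sumr_ge0 => i _; exact: nrm_ge0.
  have vM : 0 < nrm (v *m M) by rewrite nrm_gt0 M0 unit0.
  have B0 : 0 < 2 / nrm (v *m M) * (L + 1).
    by rewrite mulr_gt0 ?divr_gt0// ltr_wpDl.
  exists (e / (2 / nrm (v *m M) * (L + 1))); first exact: divr_gt0.
  move=> w w1; rewrite ltr_pdivlMr// => h.
  apply: le_lt_trans (nrm_normalize _ _) _; rewrite ?M0 ?unit0//.
  rewrite -mulmxBl; apply: le_lt_trans h.
  rewrite [leRHS]mulrC -[leRHS]mulrA ler_pM2l ?divr_gt0//.
  apply: le_trans (nrm_mulmx _ _) _; rewrite -/L.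
  by apply: ler_wpM2r; [exact: nrm_ge0|rewrite lerDl].
Qed.

End LinearSphere.

Lemma finite_uniform (R : realFieldType) (T : finType) (P : T -> R -> Prop) :
  (forall t, exists2 c, 0 < c & P t c) ->
  (forall t c c', 0 < c' -> c' <= c -> P t c -> P t c') ->
  exists2 c, 0 < c <= 1 & forall t, P t c.
Proof.
move=> ex mono.
have ex' t : exists c, 0 < c /\ P t c by have [c] := ex t; exists c.
have [c hc] := choice ex'.
have s0 : 0 <= \sum_t (c t)^-1.
  by apply: sumr_ge0 => t _; rewrite invr_ge0 ltW// (hc t).1.
have s1 : 0 < 1 + \sum_t (c t)^-1 by rewrite ltr_pwDl.
exists (1 + \sum_t (c t)^-1)^-1.
  by rewrite invr_gt0 s1/= invf_le1// lerDl.
move=> t; apply: (mono t (c t)); [by rewrite invr_gt0| |exact: (hc t).2].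
rewrite -[leRHS]invrK lef_pV2 ?posrE ?invr_gt0 ?(hc t).1//.
rewrite (bigD1 t)//= addrCA lerDl addr_ge0//.
by apply: sumr_ge0 => i _; rewrite invr_ge0 ltW// (hc i).1.
Qed.

Section Lift.
Context {R : realType} {d : nat}.
Implicit Types (K : set 'rV[R]_d) (q u : 'rV[R]_d).

(* At (u, a), the support function of the lifted body is h_K(u) - a. *)
Definition lift K : set 'rV[R]_(d + 1) := [set row_mx q (-1)%:M | q in K].

Lemma dot_lift q u a : dot (row_mx q (-1)%:M) (row_mx u a%:M) = dot q u - a.
Proof. by rewrite dot_row_mx /dot big_ord1 !mxE !mulr1n mulN1r. Qed.

Lemma row_mxE (x : 'rV[R]_(d + 1)) : x = row_mx (lsubmx x) (rsubmx x 0 0)%:M.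
Proof. by rewrite -mx11_scalar hsubmxK. Qed.

Lemma compact_lift K : compact K -> compact (lift K).
Proof.
move=> cK; apply: continuous_compact cK; apply: within_continuous_nrm => x Kx e e0.
exists e => // y Ky; rewrite opp_row_mx add_row_mx subrr => h.
by rewrite /nrm dot_row_mx dot0l addr0.
Qed.

Lemma convex_lift K : convex_set (K : set (convex_lmodType 'rV[R]_d)) ->
  forall x y (t : R), lift K x -> lift K y -> 0 <= t <= 1 ->
    lift K (x + t *: (y - x)).
Proof.
move=> cK _ _ t [p Kp <-] [q Kq <-] /andP[t0 t1].
exists (p + t *: (q - p)); last first.
  by rewrite opp_row_mx !add_row_mx scale_row_mx add_row_mx subrr scaler0 addr0.
have := cK q p (Itv01 t0 t1); rewrite !inE => /(_ Kq Kp); congr K.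
apply: etrans (_ : t *: q + (1 - t) *: p = _); first by [].
by rewrite scalerBr scalerBl scale1r addrCA.
Qed.

End Lift.

Section Separation.
Context {R : realType} {d m : nat}.
Variable K : 'I_m -> set 'rV[R]_d.
Hypothesis hK : forall i, convex_body (K i).
Hypothesis hsep : strongly_separated K.

Let cL i : compact (lift (K i)). Proof. by apply: compact_lift; case: (hK i). Qed.
Let L0 i : lift (K i) !=set0.
Proof.
have [_ _ [q /interior_subset Kq]] := hK i.
by exists (row_mx q (-1)%:M); exists q.
Qed.

Lemma lift_bounded : exists2 D, 0 <= D & forall i q, lift (K i) q -> nrm q <= D.
Proof.
have ex i : exists D, forall q, lift (K i) q -> nrm q <= D.
  have [||c _ hc] := EVT_max_rV (f := @nrm R (d + 1)) _ (@cL i).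
  - exact: L0.
  - by apply: continuous_subspaceT; exact: continuous_nrm.
  by exists (nrm c) => q Lq; apply: hc; rewrite inE.
have [D hD] := choice ex; exists (\sum_i `|D i|); first exact: sumr_ge0.
move=> i q Lq; apply: le_trans (hD i q Lq) _; apply: le_trans (ler_norm _) _.
by rewrite (bigD1 i)//= lerDl sumr_ge0.
Qed.

Lemma separator_margin (I : {set 'I_m}) : exists y, exists2 mu, 0 < mu &
  forall i q, lift (K i) q -> if i \in I then dot q y <= - mu else mu <= dot q y.
Proof.
have [u [a [_ hneg hpos]]] := hsep [set i | i \in I]%classic.
pose y : 'rV[R]_(d + 1) := row_mx u a%:M; exists y.
pose P i c := forall q, lift (K i) q ->
  if i \in I then dot q y <= - c else c <= dot q y.
have [||mu /andP[mu0 _] hmu] := @finite_uniform R _ P; last first.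
- by exists mu => // i; exact: hmu.
- move=> i c c' c'0 c'c h q /h; case: ifP => _; last exact: le_trans.
  by move=> /le_trans; apply; rewrite lerN2.
move=> i; pose s : R := if i \in I then -1 else 1.
have spos q : lift (K i) q -> 0 < s * dot q y.
  move=> [p Kp <-]; rewrite dot_lift /s; case: ifPn => iI.
    have : open_neg u a p by apply: hneg; exists i.
    by rewrite /open_neg/= mulN1r; lra.
  have : open_pos u a p by apply: hpos; exists i => //=; exact/negP.
  by rewrite /open_pos/= mul1r; lra.
have [||c] := EVT_min_rV (f := fun q => s * dot q y) _ (@cL i).
- exact: L0.
- apply: (@lipschitz_continuousR _ _ _ _ (`|s| * nrm y)) => x z _ _.
  rewrite -mulrBr normrM -dotBl -mulrA; apply: ler_wpM2l => //.
  by rewrite mulrC cauchy_schwarz.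
rewrite inE => /spos c0 hc; exists (s * dot c y) => // q Lq.
have : s * dot c y <= s * dot q y by apply: hc; rewrite inE.
move: (s * dot c y) => b; rewrite /s; case: ifP => _; by [rewrite mulN1r lerNr|rewrite mul1r].
Qed.

Lemma lift_independent : exists2 c0, 0 < c0 <= 1 &
  forall q : 'I_m -> 'rV[R]_(d + 1), (forall i, lift (K i) (q i)) ->
  forall z : 'rV[R]_m, c0 * nrm z <= nrm (\sum_i z 0 i *: q i).
Proof.
pose P (I : {set 'I_m}) c := forall q : 'I_m -> 'rV[R]_(d + 1),
  (forall i, lift (K i) (q i)) -> forall z : 'rV[R]_m,
  (forall i, (i \in I) = (z 0 i < 0)) -> c * nrm z <= nrm (\sum_i z 0 i *: q i).
have [||c0 c01 hc] := @finite_uniform R _ P; last first.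
- exists c0 => // q Lq z; apply: (hc [set i | z 0 i < 0]%SET q Lq z) => i.
  by rewrite inE.
- move=> I c c' c'0 c'c h q Lq z hz; apply: le_trans (h q Lq z hz).
  by apply: ler_wpM2r => //; exact: nrm_ge0.
move=> I; have [y [mu mu0 hmu]] := separator_margin I.
have y1 : 0 < nrm y + 1 by rewrite ltr_wpDl// nrm_ge0.
exists (mu / (nrm y + 1)) => [|q Lq z hz]; first exact: divr_gt0.
rewrite mulrAC ler_pdivrMr//; set w := \sum_i _.
apply: le_trans (_ : dot w y <= _); last first.
  apply: le_trans (dot_le _ _) _; apply: ler_wpM2l; first exact: nrm_ge0.
  by rewrite lerDl.
rewrite /w dot_suml; apply: le_trans (ler_wpM2l (ltW mu0) (nrm_le_sum z)) _.
rewrite mulr_sumr; apply: ler_sum => i _; rewrite dotZl.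
have := hmu i (q i) (Lq i); rewrite hz; case: ltrP => z0 h.
  by rewrite ltr0_norm// mulrN -mulNr mulrC ler_wnM2l// ltW.
by rewrite ger0_norm// mulrC ler_wpM2l.
Qed.

End Separation.

Lemma continuous_inverse (X Y Z : topologicalType) (f : X -> Y) (g : Y -> X)
    (h : Y -> Z) : compact [set: X] -> hausdorff_space Z ->
  cancel f g -> cancel g f -> continuous f -> continuous h -> injective h ->
  continuous g.
Proof.
move=> cX hZ fK gK cf ch ih; apply/continuousP => U oU.
have cC : compact (~` U).
  by apply: (subclosed_compact _ cX); [exact: open_closedC|exact: subsetT].
have cC' : compact (h @` (f @` (~` U))).
  apply: continuous_compact; first exact: continuous_subspaceT.
  by apply: continuous_compact => //; exact: continuous_subspaceT.
have oC := closed_openC (compact_closed hZ cC').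
move: ch => /continuousP/(_ _ oC); congr open.
apply/seteqP; split => y /= hy.
  by apply: contrapT => nU; apply: hy; exists y => //; exists (g y).
by move=> [_ [x nU <-] /ih e]; apply: nU; rewrite -(fK x) e.
Qed.

Lemma compact_set_type (T : topologicalType) (A : set T) :
  compact A -> compact [set: set_type A].
Proof.
move=> cA F PF _.
have FA : (set_val @ F) A.
  rewrite /fmap/= (_ : _ @^-1` _ = setT); first exact: filterT.
  by apply/seteqP; split => // x _; exact: set_valP.
have [x [Ax clx]] := cA _ _ FA.
exists (exist _ x (mem_set Ax)); split => // B C FB.
rewrite nbhsE => -[D [[V oV <-] Vx] VC].
have FB' : (set_val @ F) (set_val @` B).
  by apply: (@filterS _ F _ B _ _ FB) => y By; exists y.
have nV : nbhs x V by apply: open_nbhs_nbhs; split=> //; move: Vx; rewrite /= set_valE.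
by have [_ [[y By <-] Vy]] := clx _ _ FB' nV; exists y; split => //; exact: VC.
Qed.

Lemma continuous_mx (R : realType) (X : topologicalType) p q
    (f : X -> 'M[R]_(p, q)) :
  (forall i j, continuous (fun x => f x i j)) -> continuous f.
Proof.
move=> cf x; apply/cvg_ballP => e e0.
have h i : \forall y \near x, forall j, ball (f x i j) e (f y i j).
  apply: filter_forall => j.
  by have /cvg_ballP := cf i j x; apply.
by apply: filterS (filter_forall _ h) => y hy; split.
Qed.

Section ProjectiveHausdorff.
Context {R : realType} {n : nat}.
Notation V := (set_type (@nonzero_vectors R n)).

(* Embeds the projective space in a Hausdorff space. *)
Definition line_proj (v : V) : 'M[R]_(n + 1) :=
  \matrix_(i, j) (set_val v 0 i * set_val v 0 j / dot (set_val v) (set_val v)).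

Let nz (v : V) : dot (set_val v) (set_val v) != 0.
Proof. by rewrite dot_eq0; exact: (set_valP v). Qed.

Lemma continuous_line_proj : continuous line_proj.
Proof.
apply: continuous_mx => i j.
rewrite (_ : (fun _ => _) = fun v : V =>
    set_val v 0 i * set_val v 0 j / dot (set_val v) (set_val v)); last first.
  by apply/funext => v; rewrite mxE.
have cv : continuous (set_val : V -> 'rV[R]_(n + 1)) by exact: initial_continuous.
have cc k : continuous (fun v : V => set_val v 0 k).
  move=> v; apply: (@continuous_comp _ _ _ set_val (fun M : 'rV_(n + 1) => M 0 k) v).
    exact: cv.
  exact: coord_continuous.
have cn : continuous (fun v : V => nrm (set_val v)).
  move=> v; apply: (@continuous_comp _ _ _ set_val (@nrm R (n + 1)) v).
    exact: cv.
  exact: continuous_nrm.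
have cd : continuous (fun v : V => dot (set_val v) (set_val v)).
  move=> v; under eq_fun do rewrite -nrm_sqr expr2.
  exact: (continuousM (cn v) (cn v)).
move=> v; have h := continuousM (cc i v) (cc j v).
have h' := continuousV (s := fun v : V => dot (set_val v) (set_val v)) (nz v) (cd v).
exact: (continuousM h h').
Qed.

Lemma line_projP v w : line_proj v = line_proj w <-> proportional v w.
Proof.
split=> [e|/asboolP[c c0 vw]].
  pose c := dot (set_val v) (set_val w) / dot (set_val w) (set_val w).
  have vw : set_val v = c *: set_val w.
    apply/rowP => j; rewrite mxE -[LHS](mulfK (nz v)) {2}/dot mulr_sumr mulr_suml.
    rewrite /c /dot !mulr_suml; apply: eq_bigr => i _.
    have /matrixP/(_ i j) := e; rewrite !mxE => eij.
    transitivity (set_val v 0 i * (set_val v 0 i * set_val v 0 j /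
      dot (set_val v) (set_val v))); first by ring.
    by rewrite eij; ring.
  apply/asboolP; exists c => //; apply/negP => /eqP c0.
  by have := nz v; rewrite vw c0 scale0r dot0l eqxx.
apply/matrixP => i j; rewrite !mxE vw !mxE dotZl dotZr; field.
by rewrite nz c0.
Qed.

End ProjectiveHausdorff.

Section Tangents.
Context {R : realType} {d m : nat}.
Variable K : 'I_m -> set 'rV[R]_d.
Hypothesis hK : forall i, convex_body (K i).
Hypothesis m0 : (0 < m)%N.

Notation L := (fun i => lift (K i)).
Notation dir x := (lsubmx (x : 'rV[R]_(d + 1))).
Notation off x := (rsubmx (x : 'rV[R]_(d + 1)) 0 0).

Let cL i : compact (L i). Proof. by apply: compact_lift; case: (hK i). Qed.

Let K0 i : K i !=set0.
Proof. by have [_ _ [q /interior_subset Kq]] := hK i; exists q. Qed.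

Let L0 i : L i !=set0.
Proof. by have [q Kq] := K0 i; exists (row_mx q (-1)%:M); exists q. Qed.

Lemma support_zeros_lift x : support_zeros L x <-> nrm x = 1 /\
  forall i, (forall q, K i q -> dot q (dir x) <= off x) /\
    exists2 q, K i q & dot q (dir x) = off x.
Proof.
have [D _ hD] := lift_bounded hK.
have E q : dot (row_mx q (-1)%:M) x = dot q (dir x) - off x.
  by rewrite {1}[x]row_mxE dot_lift.
have hs i : hsup (L i) 0 x = dot (pmax (L i) 0 x) x by rewrite /hsup !mul0r subr0.
have hge i q : K i q -> dot q (dir x) - off x <= hsup (L i) 0 x.
  move=> Kq; have := @hsup_ge R _ (L i) D (@cL i) (L0 i) (hD i) 0 x (row_mx q (-1)%:M).
  by rewrite !mul0r subr0 E; apply; exists q.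
have hmem i : exists2 q, K i q & hsup (L i) 0 x = dot q (dir x) - off x.
  have [q Kq e] := pmax_mem (@cL i) (L0 i) (hD i) 0 x.
  by exists q => //; rewrite hs -E -e.
split=> -[x1 hx]; split => // i.
  split=> [q /hge|]; first by rewrite hx subr_le0.
  have [q Kq] := hmem i; rewrite hx => /esym/eqP; rewrite subr_eq0 => /eqP.
  by exists q.
have [hle [q Kq hq]] := hx i; apply/eqP; rewrite eq_le; apply/andP; split.
  by have [p Kp ->] := hmem i; rewrite subr_le0; exact: hle.
by have := hge i q Kq; rewrite hq subrr.
Qed.

Lemma support_zeros_dir x : support_zeros L x -> dir x != 0.
Proof.
move=> /support_zeros_lift[x1 hx]; apply/negP => /eqP u0.
have [_ [q _]] := hx (Ordinal m0); rewrite u0 dot0r => a0.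
suff x0 : x = 0 by move/eqP: x1; rewrite x0 nrm0 eq_sym oner_eq0.
by rewrite [x]row_mxE u0 -a0 raddf0 row_mx0.
Qed.

Lemma closed_negE (u q : 'rV[R]_d) a : closed_neg u a q <-> dot q u <= a.
Proof.
rewrite le_eqVlt; split => [[h|h]|/orP[/eqP h|h]].
- by apply/orP; right.
- by apply/orP; left; apply/eqP.
- by right.
- by left.
Qed.

Lemma support_zeros_tangent x (H : affine_hyperplane R d) : support_zeros L x ->
  points H = hyperplane (dir x) (off x) -> common_tangents K H.
Proof.
move=> zx HE; have u0 := support_zeros_dir zx.
have /support_zeros_lift[x1 hx] := zx.
have hC : closed_halfspaces H (closed_neg (dir x) (off x)).
  by exists (dir x), (off x); split => //; right.
split=> [i|].
  split; first by have [_ [q Kq hq]] := hx i; exists q; split => //; rewrite HE.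
  by exists (closed_neg (dir x) (off x)) => // q Kq; apply/closed_negE/(hx i).1.
by exists (closed_neg (dir x) (off x)) => // q [i _ Kq]; apply/closed_negE/(hx i).1.
Qed.

Lemma tangent_support_zeros (H : affine_hyperplane R d) : common_tangents K H ->
  exists2 x, support_zeros L x & points H = hyperplane (dir x) (off x).
Proof.
move=> [hT [C [v [b [v0 HE hC]]] KC]].
have [w [e [w0 HE' wle]]] : exists w e, [/\ w != 0, points H = hyperplane w e
    & forall i q, K i q -> dot q w <= e].
  case: hC => CE; last first.
    exists v, b; split => // i q Kq; apply/closed_negE; rewrite -CE; apply: KC.
    by exists i.
  exists (- v), (- b); split; first by rewrite oppr_eq0.
    rewrite HE; apply/seteqP; split=> q; rewrite /hyperplane/= dotNr.
      by move=> ->.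
    exact: oppr_inj.
  move=> i q Kq; have : C q by apply: KC; exists i.
  by rewrite CE dotNr lerN2 => -[/ltW|/= ->].
pose y : 'rV[R]_(d + 1) := row_mx w e%:M.
have y0 : 0 < nrm y.
  rewrite nrm_gt0; apply: contra_neq w0 => y0.
  by rewrite -[w](row_mxKl _ (e%:M : 'M[R]_1)) -/y y0 linear0.
pose s := (nrm y)^-1; have s0 : 0 < s by rewrite invr_gt0.
exists (s *: y); last first.
  rewrite HE' linearZ/= row_mxKl linearZ/= row_mxKr !mxE eqxx mulr1n.
  apply/seteqP; split => q; rewrite /hyperplane/= dotZr; first by move=> ->.
  by move/(mulfI (lt0r_neq0 s0)).
apply/support_zeros_lift; rewrite nrmZ gtr0_norm// mulVf ?gt_eqF//; split => // i.
rewrite linearZ/= row_mxKl linearZ/= row_mxKr !mxE eqxx mulr1n.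
split=> [q Kq|]; first by rewrite dotZr ler_pM2l// (wle i).
have [[q [Kq hq]] _] := hT i; rewrite HE' in hq.
by exists q => //; rewrite dotZr hq.
Qed.

Lemma convex_body_not_flat (S : set 'rV[R]_d) u a : convex_body S -> u != 0 ->
  ~ forall q, S q -> dot q u = a.
Proof.
move=> [_ _ [q0 /nbhs_ballP[e /= e0 hS]]] u0 h.
have nu : 0 < nrm u by rewrite nrm_gt0.
pose t := e / 2 / nrm u; have t0 : 0 < t by rewrite !divr_gt0.
have S0 := hS _ (ballxx q0 e0).
have /hS/h : ball q0 e (q0 + t *: u).
  apply: nrm_ball; rewrite opprD addrA subrr sub0r nrmN nrmZ gtr0_norm//.
  by rewrite /t divfK ?gt_eqF// gtr_pMr// invf_lt1// ltr1n.
rewrite dotDl dotZl (h _ S0) => /eqP; rewrite -subr_eq0 addrAC subrr add0r.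
by rewrite mulf_eq0 dot_eq0 (negbTE u0) gt_eqF.
Qed.

Lemma support_zeros_inj x y : support_zeros L x -> support_zeros L y ->
  hyperplane (dir x) (off x) = hyperplane (dir y) (off y) -> x = y.
Proof.
move=> zx zy e; have ux := support_zeros_dir zx; have uy := support_zeros_dir zy.
have [c [c0 uE aE]] := hyperplane_inj ux uy e.
have xy : x = c *: y.
  rewrite [x]row_mxE [y in RHS]row_mxE scale_row_mx uE; congr row_mx.
  by rewrite aE scale_scalar_mx.
have /support_zeros_lift[x1 hx] := zx; have /support_zeros_lift[y1 hy] := zy.
have := x1; rewrite xy nrmZ y1 mulr1 => /eqP; rewrite eqr_norml ler01 andbT.
move=> /orP[/eqP ->|/eqP cN]; first by rewrite scale1r.
exfalso; apply: (@convex_body_not_flat _ (dir x) (off x) (hK (Ordinal m0)) ux) => q Kq.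
apply/eqP; rewrite eq_le ((hx _).1 q Kq)/= uE aE cN dotZr !mulN1r lerN2.
exact: (hy _).1 q Kq.
Qed.

End Tangents.

Theorem theorem1 (R : realType) (d m : nat) (hm : (1 <= m)%N) (hmd : (m <= d)%N)
    (K : 'I_m -> set 'rV[R]_d)
    (hK : forall i : 'I_m, convex_body (K i))
    (hsep : strongly_separated K) :
  homeomorphic (set_type (common_tangents K)) (set_type (sphere R (d - m)%N)).
Proof.
pose L i := lift (K i).
have [D D0 LD] := lift_bounded hK.
have [c0 /andP[c00 c01] indep] := lift_independent hK hsep.
have cL i : compact (L i) by apply: compact_lift; case: (hK i).
have L0 i : L i !=set0.
  have [_ _ [q /interior_subset Kq]] := hK i.
  by exists (row_mx q (-1)%:M); exists q.
have convL i := convex_lift (let: And3 _ c _ := hK i in c).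
have [Psi [P1 P2 P3 P4]] :=
  support_zeros_param c00 c01 D0 indep convL cL L0 LD.
have dm : (d + 1 = m + (d - m).+1)%N by rewrite addn1 addnS subnKC.
have mem i : L i (pmax (L i) 1 0) by exact: (pmax_mem (@cL i) (L0 i) (LD i)).
have [phi [f1 f2 f3 f4]] := linear_sphere dm c00 (indep _ mem).
pose S := sphere R (d - m).
have SE v : S v <-> nrm v = 1.
  split=> [h|h]; first by rewrite /nrm h sqrtr1.
  by rewrite /S/sphere/= -nrm_sqr h expr1n.
pose G := Psi \o phi.
have G1 v : S v -> support_zeros L (G v) by move=> /SE/f1; exact: P1.
have G2 x : support_zeros L x -> exists2 v, S v & G v = x.
  by move=> /P2[w /f2[v /SE Sv <-] <-]; exists v.
have G3 v w : S v -> S w -> G v = G w -> v = w.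
  move=> /SE v1 /SE w1 e; apply: f3 => //.
  by apply: P3 e; exact: f1.
have G4 : {within S, continuous G}.
  apply: within_continuous_nrm => v /SE v1 e e0.
  have [e' e'0 h'] := P4 _ (f1 _ v1) e e0.
  have [e'' e''0 h''] := f4 v v1 e' e'0.
  exists e'' => // w /SE w1 /(h'' _ w1); exact: h' (f1 _ w1).
pose u v := lsubmx (G v : 'rV[R]_(d + 1)); pose a v := rsubmx (G v : 'rV[R]_(d + 1)) 0 0.
have u0 v : S v -> u v != 0 by move=> /G1; exact: (support_zeros_dir hK hm).
have exF (v : set_type S) : exists T : set_type (common_tangents K),
    points (set_val T) = hyperplane (u (set_val v)) (a (set_val v)).
  have hv := set_valP v.
  have hH : is_hyperplane (hyperplane (u (set_val v)) (a (set_val v))).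
    by exists (u (set_val v), a (set_val v)) => //; exact: u0.
  have hT : common_tangents K (AffineHyperplane hH).
    exact: (support_zeros_tangent hK hm (G1 _ hv)).
  by exists (exist (fun H => H \in common_tangents K) _ (mem_set hT)); rewrite set_valE.
have [F FE] := choice exF.
have exg (T : set_type (common_tangents K)) : exists v, F v = T.
  have [x zx xE] := tangent_support_zeros hK (set_valP T).
  have [v Sv vx] := G2 _ zx.
  pose v' : set_type S := exist (fun v => v \in S) v (mem_set Sv).
  exists v'; apply: val_inj; apply: parametrization_inj.
  have TE : points (set_val T) = hyperplane (u (set_val v')) (a (set_val v')).
    by rewrite xE /u /a !set_valE/= vx.
  have uv := u0 _ (set_valP v').
  exact: etrans (parametrizationE uv (FE v')) (esym (parametrizationE uv TE)).
have [g gK] := choice exg.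
have injF : injective F.
  move=> v w e; apply: val_inj; apply: G3; [exact: set_valP|exact: set_valP|].
  apply: (support_zeros_inj hK hm); [exact/G1/set_valP|exact/G1/set_valP|].
  by have := FE v; rewrite e FE.
have FK : cancel F g by move=> v; apply: injF; rewrite gK.
have cF : continuous F.
  apply/continuousP => _ [_ [C oC <-] <-].
  have [B oB BC] : open (\pi_{eq_quot (@proportional_equiv_rel R d)}%qT @^-1` C) := oC.
  have /subspace_sigL_continuousP/continuousP/(_ B oB) := G4; congr open.
  apply/funext => v; have uv := u0 _ (set_valP v).
  pose w : set_type nonzero_vectors := exist (fun w => w \in nonzero_vectors) _
    (homogeneous_subproof (a (set_val v)) uv).
  have wG : set_val w = G (set_val v) by rewrite [RHS]row_mxE {1}set_valE.
  have hB : B (set_val w) = C (homogeneous (a (set_val v)) uv).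
    by have := congr1 (fun A : set (set_type nonzero_vectors) => A w) BC.
  by rewrite /preimage/= (parametrizationE uv (FE v)) -hB wG.
exists g, F; split => //.
pose h := (line_proj \o repr : RP R d -> _) \o @parametrization R d \o
  (set_val : set_type (common_tangents K) -> _).
apply: (@continuous_inverse _ _ _ F g h) => //.
- apply: compact_set_type; rewrite (_ : S = [set v | nrm v = 1]).
    exact: compact_unit_sphere.
  by apply/seteqP; split=> v /SE.
- move=> T; apply: continuous_comp; first exact: initial_continuous.
  apply: continuous_comp; first exact: initial_continuous.
  apply: repr_comp_continuous; first exact: continuous_line_proj.
  by move=> v w /eqP/eqmodP vw; apply/eqP/line_projP.
- move=> T T' /line_projP pTT'; apply: val_inj; apply: parametrization_inj.
  rewrite -[LHS]reprK -[RHS]reprK; exact/eqmodP.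
Qed.
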